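(* Let $X$ be a real Banach space, $A\subset X$ open, $\mathcal M\subset X$ a real linear subspace of finite dimension $d$, $(e_j)_{j=1}^d$ a basis of $\mathcal M$, and $1\le s\le d$. Set $$\mathcal M_s=\bigcup_{I\subset\{1,\dots,d\},\ |I|\le s}\operatorname{span}\{e_j: j\in I\}.$$ Let $\mathbb K\in\{\mathbb R,\mathbb C\}$. Let $(\mathcal Z,\nu)$ be a probability space and $\mathfrak m\colon A\times\mathcal Z\to\mathbb K$ a map given by one of the following two sampling architectures. (I) Finite-dimensional analytic sampling: $\mathcal Z=Z$ is a connected real-analytic manifold of finite dimension $q\ge 1$ endowed with a smooth positive volume measure $\mathrm{vol}_Z$; $\nu=\mu$ is a Borel probability measure on $Z$ with $\mu\ll\mathrm{vol}_Z$; $\mathfrak m\colon A\times Z\to\mathbb K$ is real analytic; and for all $a_1\ne a_2$ in $A\cap\mathcal M$ the function $\mathfrak m(a_1,\cdot)-\mathfrak m(a_2,\cdot)$ is not identically zero on $Z$. (II) Gaussian multilinear sampling: $H$ is a separable Hilbert space over $\mathbb K$, $Z$ is an infinite-dimensional separable real Hilbert space, $r\ge1$ is an integer; $F\colon A\to\mathcal L^r(H;\mathbb K)$ is real analytic and is injective on $A\cap\mathcal M$; $\psi\colon Z\to H$ is bounded and real linear with $\overline{\operatorname{span}_{\mathbb K}\psi(Z)}=H$; $\gamma$ is a nondegenerate Gaussian Borel probability measure on $Z$; $\mathcal Z=Z^r$, $\nu=\gamma^r$ (the $r$-fold product measure), and $\mathfrak m(a,z)=F(a)(\psi z^1,\dots,\psi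 z^r)$ for $a\in A$, $z=(z^1,\dots,z^r)\in Z^r$. Let $M\ge 2\min\{d,2s\}+1$ and let $z_1,\dots,z_M\in\mathcal Z$ be independent samples with law $\nu$. Then, with probability one, the following holds for every $a_1,a_2\in A\cap\mathcal M_s$: if $\mathfrak m(a_1,z_i)=\mathfrak m(a_2,z_i)$ for $i=1,\dots,M$, then $a_1=a_2$.
   Context: Complex Banach spaces are regarded as real Banach spaces when analyticity is discussed. Real analytic map: for real Banach spaces $Y_1,Y_2$ and $U\subset Y_1$ open, $G\colon U\to Y_2$ is real analytic if for every $y\in U$ there are $\rho>0$ and continuous symmetric $j$-linear maps $G_j\colon Y_1^j\to Y_2$, $j\ge0$, with $\sum_{j\ge0}\|G_j\|\rho^j<\infty$ and $G(y+h)=\sum_{j\ge0}G_j(h,\dots,h)$ for $\|h\|_{Y_1}<\rho$. On a finite-dimensional real-analytic manifold, or a product of an open subset of a Banach space with one, analyticity is understood in analytic charts. $\mathcal L^r(H;\mathbb K)$ is the Banach space of bounded $\mathbb K$-multilinear forms on $H^r$. A Gaussian measure on $Z$ is nondegenerate if its covariance operator has trivial kernel (its mean is arbitrary). *)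

(* Defs.v *)
From HB Require Import structures.
From mathcomp Require Import all_boot all_order all_algebra perm.
From mathcomp Require Import all_classical all_reals all_analysis.
From mathcomp Require Import complex.

Set Implicit Arguments.
Unset Strict Implicit.
Unset Printing Implicit Defensive.

Import Order.TTheory GRing.Theory Num.Theory.
Import numFieldNormedType.Exports.

Local Open Scope classical_set_scope.
Local Open Scope ring_scope.

Inductive scalars := RealScalars | ComplexScalars.

Definition scalar_field (R : realType) (k : scalars) : numFieldType :=
  match k with RealScalars => R | ComplexScalars => R[i] end.

Definition of_real (R : realType) (k : scalars) : R -> scalar_field R k :=
  match k with RealScalars => id | ComplexScalars => real_complex R end.

Definition real_part (R : realType) (k : scalars) : scalar_field R k -> R :=
  match k with RealScalars => id | ComplexScalars => @complex.Re R end.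

Definition conjugate (R : realType) (k : scalars) :
    scalar_field R k -> scalar_field R k :=
  match k with RealScalars => id | ComplexScalars => @conjc R end.

Arguments of_real {R} k.
Arguments real_part {R k}.
Arguments conjugate {R k}.

Definition lin_span (K : numFieldType) (V : lmodType K) (S : set V) : set V :=
  [set x | exists n (c : 'I_n -> K) (v : 'I_n -> V),
     (forall i, S (v i)) /\ x = \sum_i c i *: v i].

Definition lin_free (K : numFieldType) (V : lmodType K) d (e : 'I_d -> V) :=
  forall c : 'I_d -> K, \sum_i c i *: e i = 0 -> forall i, c i = 0.

Definition lin_basis (K : numFieldType) (V : lmodType K) (W : set V) d
    (e : 'I_d -> V) := lin_free e /\ W = lin_span (range e).

Definition finite_dimensional (K : numFieldType) (V : lmodType K) :=
  exists n (v : 'I_n -> V), lin_span (range v) = setT.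

Definition sparse (K : numFieldType) (V : lmodType K) d (e : 'I_d -> V)
    (s : nat) : set V :=
  \bigcup_(I in [set I : {set 'I_d} | (#|I| <= s)%N]) lin_span (e @` [set` I]).

(* The norm of a normed module over C takes its values in C, whence the real
   part. *)
Definition real_norm (R : realType) (k : scalars)
  (W : normedModType (scalar_field R k)) (w : W) : R := real_part `|w|.

Definition bounded_real_linear (R : realType) (k : scalars)
    (V : normedModType R) (W : normedModType (scalar_field R k))
    (f : V -> W) :=
  (forall a x y, f (a *: x + y) = of_real k a *: f x + f y) /\
  exists C : R, forall x, real_norm (f x) <= C * `|x|.

Definition separable_space (T : topologicalType) :=
  exists2 D : set T, countable D & dense D.

Definition inner_product (R : realType) (k : scalars)
    (H : normedModType (scalar_field R k)) (ip : H -> H -> scalar_field R k) :=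
  [/\ forall a x y z, ip (a *: x + y) z = a * ip x z + ip y z,
      forall x y, ip y x = conjugate (ip x y) &
      forall x, ip x x = `|x| ^+ 2].

(* Multilinearity along a map of scalars: [sigma] is the identity for a
   K-multilinear map, and the inclusion of R in C for a real multilinear map
   with values in a complex space. *)
Definition multilinear (K1 K2 : numFieldType) (sigma : K1 -> K2)
    (V : lmodType K1) (W : lmodType K2) n (f : ('I_n -> V) -> W) :=
  forall (i : 'I_n) (h : 'I_n -> V) (a : K1) (x y : V),
    f (dfwith h i (a *: x + y)) =
    sigma a *: f (dfwith h i x) + f (dfwith h i y).

Definition symmetric_map (V W : Type) n (f : ('I_n -> V) -> W) :=
  forall (s : 'S_n) (h : 'I_n -> V), f (h \o s) = f h.

Definition mnorm (R : realType) (k : scalars) (K : numFieldType)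
    (V : normedModType K) (W : normedModType (scalar_field R k)) n
    (f : ('I_n -> V) -> W) : R :=
  sup [set real_norm (f h) | h in [set h | forall i, `|h i| <= 1]].

(* The target is a space over R or C, regarded as a real space. *)
Definition real_analytic (R : realType) (k : scalars) (Y1 : normedModType R)
    (Y2 : normedModType (scalar_field R k)) (U : set Y1) (G : Y1 -> Y2) :=
  forall y, U y -> exists (rho : R) (Gj : forall j, ('I_j -> Y1) -> Y2),
    [/\ 0 < rho,
        forall j, [/\ multilinear (of_real k) (Gj j), symmetric_map (Gj j) &
                      continuous (Gj j : {ptws 'I_j -> Y1} -> Y2)],
        cvgn (series (fun j => mnorm (Gj j) * rho ^+ j)) &
        forall h, `|h| < rho -> U (y + h) /\
          series (fun j => Gj j (fun=> h)) @ \oo --> G (y + h)].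

Section scalar_field_theory.
Variables (R : realType) (k : scalars).
Local Notation K := (scalar_field R k).

Lemma real_partD (x y : K) : real_part (x + y) = real_part x + real_part y.
Proof. by case: k x y => //= -[? ?] []. Qed.

Lemma real_part_le (x y : K) : x <= y -> real_part x <= real_part y.
Proof. by case: k x y => //= x y; rewrite lecE => /andP[]. Qed.

Lemma of_realK : cancel (of_real k : R -> K) real_part.
Proof. by case: k. Qed.

Lemma of_realM (x y : R) : of_real k (x * y) = of_real k x * of_real k y :> K.
Proof. by case: k => //=; rewrite rmorphM. Qed.

Lemma of_real_le (x y : R) : x <= y -> of_real k x <= of_real k y :> K.
Proof. by case: k => //= xy; rewrite lecR. Qed.

Lemma of_realD (x y : R) : of_real k (x + y) = of_real k x + of_real k y :> K.
Proof. by case: k => //=; rewrite rmorphD. Qed.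

Lemma of_real0 : of_real k 0 = 0 :> K.
Proof. by case: k. Qed.

Lemma real_part0 : real_part (0 : K) = 0.
Proof. by rewrite -of_real0 of_realK. Qed.

Lemma of_real1 : of_real k 1 = 1 :> K.
Proof. by case: k. Qed.

Lemma of_real_eq0 (x : R) : (of_real k x : K) = 0 -> x = 0.
Proof. by rewrite -of_real0 => /(can_inj of_realK). Qed.

Lemma real_partK (x : K) : 0 <= x -> of_real k (real_part x) = x.
Proof. by case: k x => //= -[a b]; rewrite lecE /= => /andP[/eqP ->]. Qed.

Lemma real_part_norm_ge0 (x : K) : 0 <= real_part `|x|.
Proof. by have := real_part_le (normr_ge0 x); rewrite -of_real0 of_realK. Qed.

Lemma of_real_norm (x : R) : 0 <= x -> `|of_real k x : K| = of_real k x.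
Proof. by move=> x0; rewrite ger0_norm// -of_real0 of_real_le. Qed.

Variable W : normedModType K.

Lemma of_real_norm_real (w : W) : of_real k (real_norm w) = `|w|.
Proof. exact/real_partK. Qed.

Lemma real_norm_ge0 (w : W) : 0 <= real_norm w.
Proof. by have := real_part_le (normr_ge0 w); rewrite -of_real0 of_realK. Qed.

Lemma real_normD (v w : W) : real_norm (v + w) <= real_norm v + real_norm w.
Proof. by rewrite /real_norm -real_partD; exact/real_part_le/ler_normD. Qed.

Lemma real_normZ (a : K) (w : W) :
  real_norm (a *: w) = real_part `|a| * real_norm w.
Proof.
apply: (can_inj of_realK); rewrite of_realM of_real_norm_real real_partK//.
by rewrite of_real_norm_real normrZ.
Qed.

Lemma real_norm0 : real_norm (0 : W) = 0.
Proof. by rewrite /real_norm normr0 -of_real0 of_realK. Qed.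

Lemma real_norm_eq0 (w : W) : real_norm w = 0 -> w = 0.
Proof. by move=> w0; apply/normr0_eq0; rewrite -of_real_norm_real w0 of_real0. Qed.

End scalar_field_theory.

Section multilinear_theory.
Variables (K : numFieldType) (V W : lmodType K) (n : nat).
Variable f : ('I_n -> V) -> W.
Hypothesis mf : multilinear id f.

Lemma dfwith_id (h : 'I_n -> V) i : dfwith h i (h i) = h :> ('I_n -> V).
Proof.
apply/funext => j; have [<-|ij] := eqVneq i j; first by rewrite dfwithin.
by rewrite dfwithout.
Qed.

Lemma multilinear_scale1 h i (c : K) :
  f (dfwith h i (c *: h i)) = c *: f h.
Proof.
have f0 : f (dfwith h i (0 : V)) = 0 :> W.
  have := @mf i h 1 0 0; rewrite scale1r addr0 scale1r => /eqP.
  by rewrite addrC -subr_eq subrr eq_sym => /eqP.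
by rewrite -[c *: h i]addr0 mf f0 addr0 dfwith_id.
Qed.

Lemma multilinear_scale h (c : K) : f (fun i => c *: h i) = c ^+ n *: f h.
Proof.
have H : forall l : seq 'I_n, uniq l ->
    f (fun i => if i \in l then c *: h i else h i) = c ^+ size l *: f h.
  elim=> [_|i l ih /= /andP[il ul]]; first by rewrite expr0 scale1r.
  rewrite exprS -scalerA -ih// -(multilinear_scale1 _ i); congr f.
  apply/funext => j; have [<-|ij] := eqVneq i j.
    by rewrite dfwithin inE eqxx (negbTE il).
  by rewrite dfwithout// inE eq_sym (negbTE ij).
rewrite -[n in c ^+ n]size_enum_ord -H ?enum_uniq//; congr f.
by apply/funext => i; rewrite mem_enum.
Qed.

End multilinear_theory.

Section multilinear_forms.
Variables (R : realType) (k : scalars).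
Local Notation K := (scalar_field R k).
Variables (H : normedModType K) (r : nat).

Definition bounded_multilinear : {pred ('I_r -> H) -> K^o} := fun f =>
  `[< multilinear id f /\
      exists C : R, forall h, (forall i, `|h i| <= 1) -> real_norm (f h) <= C >].

Record mform := MForm {
  mform_fun :> ('I_r -> H) -> K^o ;
  mformP : mform_fun \in bounded_multilinear }.

HB.instance Definition _ := [isSub for mform_fun].
HB.instance Definition _ := [Choice of mform by <:].

Lemma bounded_multilinear_submod : submod_closed bounded_multilinear.
Proof.
split=> [|a f g].
  apply/asboolP; split=> [i h a x y|]; first by rewrite /= scaler0 addr0.
  by exists 0 => h _; rewrite real_norm0.
move=> /asboolP[mf [C fC]] /asboolP[mg [D gD]]; apply/asboolP; split.
  move=> i h b x y; rewrite !fctE mf mg.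
  by rewrite !scalerDr !scalerA (mulrC a) addrACA.
exists (real_part `|a| * C + D) => h h1; rewrite !fctE.
rewrite (le_trans (real_normD _ _))// lerD ?gD// real_normZ.
by rewrite ler_wpM2l ?fC ?real_part_norm_ge0.
Qed.

HB.instance Definition _ := GRing.isSubmodClosed.Build K (('I_r -> H) -> K^o)
  bounded_multilinear bounded_multilinear_submod.
HB.instance Definition _ := [SubChoice_isSubLmodule of mform by <:].

Lemma mform_multilinear (f : mform) : multilinear id f.
Proof. by have /asboolP[] := mformP f. Qed.

Lemma mform_le_mnorm (f : mform) h :
  (forall i, `|h i| <= 1) -> real_norm (f h) <= mnorm f.
Proof.
move=> h1; apply: ub_le_sup; last by exists h.
have /asboolP[_ [C fC]] := mformP f.
by exists C => _ [g g1 <-]; exact: fC.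
Qed.

Lemma mnorm_le (f : mform) C :
  (forall h, (forall i, `|h i| <= 1) -> real_norm (f h) <= C) -> mnorm f <= C.
Proof.
move=> fC; apply: ge_sup; last by move=> _ [h h1 <-]; exact: fC.
by exists (real_norm (f (fun=> 0))), (fun=> 0) => // i; rewrite normr0.
Qed.

Lemma mnorm_ge0 (f : mform) : 0 <= mnorm f.
Proof.
apply: le_trans (mform_le_mnorm (h := fun=> 0) f _); first exact: real_norm_ge0.
by move=> i; rewrite normr0.
Qed.

Definition mform_norm (f : mform) : K := of_real k (mnorm f).

Lemma mform_normD f g : mform_norm (f + g) <= mform_norm f + mform_norm g.
Proof.
rewrite /mform_norm -of_realD of_real_le// mnorm_le// => h h1.
by rewrite (le_trans (real_normD _ _))// lerD// mform_le_mnorm.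
Qed.

Lemma mnormZ a (f : mform) : mnorm (a *: f : mform) = real_part `|a| * mnorm f.
Proof.
have le b (g : mform) : mnorm (b *: g : mform) <= real_part `|b| * mnorm g.
  apply: mnorm_le => h h1; rewrite /= real_normZ.
  by rewrite ler_wpM2l ?mform_le_mnorm ?real_part_norm_ge0.
apply/eqP; rewrite eq_le le andTb; have [->|a0] := eqVneq a 0.
  by rewrite normr0 real_part0 mul0r mnorm_ge0.
have na : 0 < real_part `|a|.
  rewrite lt_neqAle real_part_norm_ge0 andbT eq_sym; apply: contra_neq a0.
  move=> a0; apply/normr0_eq0.
  by rewrite -[LHS]real_partK// a0 of_real0.
have := le a^-1 (a *: f); rewrite scalerA mulVf// scale1r => h.
rewrite -ler_pdivlMl//; apply: le_trans h _.
suff -> : real_part `|a^-1| = (real_part `|a|)^-1 by [].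
apply: (mulfI (lt0r_neq0 na)); rewrite divff ?lt0r_neq0//.
apply: (can_inj (@of_realK R k)).
by rewrite of_realM !real_partK// of_real1 -normrM divff// normr1.
Qed.

Lemma mform_normZ a f : mform_norm (a *: f) = `|a| * mform_norm f.
Proof. by rewrite /mform_norm mnormZ of_realM real_partK. Qed.

Lemma mform_norm0_eq0 f : mform_norm f = 0 -> f = 0.
Proof.
move=> /of_real_eq0 f0; apply/val_inj/funext => h /=.
pose s : R := 1 + \sum_i real_norm (h i).
have s1 : 1 <= s by rewrite lerDl sumr_ge0// => i _; exact: real_norm_ge0.
have s0 : 0 < s by exact: lt_le_trans s1.
pose c : K := of_real k s^-1.
have hc i : `|c *: h i| <= 1.
  rewrite normrZ of_real_norm ?invr_ge0 ?(ltW s0)//.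
  rewrite -of_real_norm_real -of_realM -of_real1 of_real_le//.
  rewrite mulrC ler_pdivrMr// mul1r /s (bigD1 i)//= addrCA lerDl.
  by rewrite addr_ge0// sumr_ge0// => j _; exact: real_norm_ge0.
have := mform_le_mnorm f hc; rewrite f0 => fc.
have /real_norm_eq0/eqP : real_norm (f (fun i => c *: h i)) = 0.
  by apply/eqP; rewrite eq_le fc real_norm_ge0.
rewrite multilinear_scale; last exact: mform_multilinear.
rewrite scaler_eq0 expf_eq0 => /orP[/andP[_ /eqP/of_real_eq0/eqP]|/eqP//].
by rewrite invr_eq0 gt_eqF.
Qed.

HB.instance Definition _ :=
  Lmodule_isNormed.Build K mform mform_normD mform_normZ mform_norm0_eq0.

End multilinear_forms.

Section tuple_measure.
Context {d} {T : measurableType d} {R : realType}.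
Variable m : set T -> \bar R.

Fixpoint tuple_measure (n : nat) : set (n.-tuple T) -> \bar R :=
  match n with
  | 0 => \d_ [tuple]
  | n'.+1 => pushforward (m \x tuple_measure (n := n'))%E
               (fun p : T * n'.-tuple T => [tuple of p.1 :: p.2])
  end.

End tuple_measure.
Arguments tuple_measure {d T R} m n.

Definition row_of (R : realType) q (t : q.-tuple R) : 'rV[R]_q :=
  \row_j tnth t j.

Notation borel T := (g_sigma_algebraType (@open T)).

Section manifolds.
Variables (R : realType) (Z : ptopologicalType) (q : nat).

Record chart := Chart {
  chart_dom : set Z ;
  chart_map : Z -> 'rV[R]_q ;
  chart_inv : 'rV[R]_q -> Z }.

Definition chart_img (c : chart) := chart_map c @` chart_dom c.

Definition is_chart (c : chart) :=
  [/\ open (chart_dom c), open (chart_img c),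
      {in chart_dom c, cancel (chart_map c) (chart_inv c)},
      {within chart_dom c, continuous (chart_map c)} &
      {within chart_img c, continuous (chart_inv c)}].

Definition analytic_manifold (atlas : set chart) :=
  [/\ hausdorff_space Z, @second_countable Z,
      forall c, atlas c -> is_chart c,
      (forall z, exists2 c, atlas c & chart_dom c z) &
      forall c c', atlas c -> atlas c' ->
        @real_analytic R RealScalars 'rV[R]_q 'rV[R]_q
          (chart_map c @` (chart_dom c `&` chart_dom c'))
          (chart_map c' \o chart_inv c)].

(* [f] is read in the charts (id, c) of the product. *)
Definition analytic_on_product (k : scalars) (X : normedModType R)
    (atlas : set chart) (A : set X) (f : X -> Z -> scalar_field R k) :=
  forall c, atlas c ->
    @real_analytic R k (X * 'rV[R]_q)%type (scalar_field R k)^o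
      (A `*` chart_img c) (fun p => f p.1 (chart_inv c p.2)).

Fixpoint iter_derive (V : normedModType R) (f : V -> R^o) (vs : seq V) :=
  if vs is v :: vs' then fun x => 'D_v (iter_derive f vs') x else f.

Definition smooth_on (V : normedModType R) (U : set V) (f : V -> R^o) :=
  forall vs x, U x -> {for x, continuous (iter_derive f vs)} /\
    forall v, derivable (iter_derive f vs) x v.

Definition smooth_positive_volume (atlas : set chart)
    (vol : set (borel Z) -> \bar R) :=
  forall c, atlas c -> exists rho : 'rV[R]_q -> R,
    [/\ smooth_on (chart_img c) rho,
        forall x, chart_img c x -> 0 < rho x &
        forall B : set (borel Z), measurable B -> B `<=` chart_dom c ->
          vol B = (\int[tuple_measure (@lebesgue_measure R) q]_(t in
                     @row_of R q @^-1` (chart_map c @` B)) (rho (row_of t))%:E)%E].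

End manifolds.

Section gaussian.
Variables (R : realType) (Z : completeNormedModType R).
Implicit Type gamma : probability (borel Z) R.

(* [normal_prob m s] has standard deviation [s]; the library gives it a junk
   value at [s = 0]. *)
Definition gaussian_law (P : set R -> \bar R) := exists m s : R,
  forall B : set R, measurable B ->
    P B = if s == 0 then \d_m B else normal_prob m s B.

Definition gaussian_measure gamma := forall f : {linear Z -> R^o},
  continuous f -> gaussian_law (fun B => gamma (f @^-1` B)).

Definition covariance_operator (ip : Z -> Z -> R) gamma (C : {linear Z -> Z}) :=
  continuous C /\
  forall u v, covariance gamma (ip u) (ip v) = (ip (C u) v)%:E.

Definition nondegenerate_gaussian (ip : Z -> Z -> R) gamma :=
  exists C : {linear Z -> Z},
    covariance_operator ip gamma C /\ forall u, C u = 0 -> u = 0.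

End gaussian.

Section samples.
Local Open Scope ereal_scope.
Context {R : realType} {dO} {Omega : measurableType dO}.
Variable P : probability Omega R.
Context {dZ} {Z : measurableType dZ}.

Definition independent (I : finType) (z : I -> Omega -> Z) :=
  forall (J : {set I}) (B : I -> set Z), (forall i, measurable (B i)) ->
    P (\bigcap_(i in [set` J]) (z i @^-1` B i)) =
    \prod_(i in J) P (z i @^-1` B i).

Definition iid_samples (nu : set Z -> \bar R) (I : finType)
    (z : I -> Omega -> Z) :=
  [/\ forall i, measurable_fun setT (z i),
      forall i B, measurable B -> P (z i @^-1` B) = nu B &
      independent z].

End samples.

(* The exceptional event is contained in a measurable event of probability 0. *)
Definition almost_sure_recovery (R : realType) (X K : Type) (S : set X)
    dZ (Z : measurableType dZ) (nu : set Z -> \bar R) (m : X -> Z -> K)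
    (M : nat) :=
  forall (dO : measure_display) (Omega : measurableType dO)
    (P : probability Omega R) (z : 'I_M -> Omega -> Z),
    iid_samples P nu z ->
    {ae P, forall w, forall a1 a2, S a1 -> S a2 ->
       (forall i, m a1 (z i w) = m a2 (z i w)) -> a1 = a2}.

(* Main.v *)
(* Idea. A pair of s-sparse vectors is a linear image of a parameter p in R^(2s),
   and M > 2s. Call a relation S between parameters and samples thin if, for all
   p' in a ball of radius 1/n, the samples related to p' lie in one common set of
   probability O(1/n). Covering a cube by O(n^(2s)) balls shows that almost
   surely no p is related to all M independent samples, as n^(2s) n^(-M) -> 0;
   countably many thin relations may be used at once. It remains to cover the
   relation "p is a pair of distinct vectors not separated by z" by countably
   many thin ones. In a chart, z is a zero of finite order of an analytic
   function (identity theorem on the connected manifold), so some iterated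
   derivative h vanishes at z while a partial derivative of h does not: the zeros
   of h lie in a thin slab, and the density of mu is bounded on each of countably
   many sets. In the Gaussian case a nonzero multilinear form restricts to a
   nonzero functional of one coordinate, whose Gaussian law has variance bounded
   below because the covariance operator is injective. *)

Require Import Defs.
From HB Require Import structures.
From mathcomp Require Import all_boot all_order all_algebra perm.
From mathcomp Require Import all_classical all_reals all_analysis.
From mathcomp Require Import measurable_realfun complex ring lra.

Set Implicit Arguments.
Unset Strict Implicit.
Unset Printing Implicit Defensive.

Import Order.TTheory GRing.Theory Num.Theory.
Import numFieldNormedType.Exports.

Local Open Scope classical_set_scope.
Local Open Scope ring_scope.

(** * Thin families of sets *)

(** The exceptional event is a union over uncountably many p, so an estimate for each single p is
    worthless: the covering sets must be common to a whole ball of parameters, with a constant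
    independent of the ball. The relations themselves are never shown to be measurable; only their
    covers are. Uniformity is obtained by cutting into strata on which every radius, Lipschitz
    constant and lower bound is controlled by natural numbers, so that countably many strata
    suffice. Within a stratum and a ball of parameters, the equation at p is replaced by an
    approximate equation at one fixed p1, whose solution set is the required cover. Balls too large
    for this comparison are covered by the whole sample space, at the price of a larger constant.
    Gaussian samples live in infinite dimension, where neither charts nor Lebesgue measure are at
    hand; there, linearity in one slot replaces the lower bound on a derivative. *)

Definition thin (R : realType) N d (Z : measurableType d) (nu : set Z -> \bar R)
    (S : 'rV[R]_N -> set Z) :=
  exists C : R, forall (n : nat) (p0 : 'rV[R]_N), exists T : set Z,
    [/\ measurable T, (nu T <= (C / n.+1%:R)%:E)%E &
        forall p, `|p - p0| <= n.+1%:R^-1 -> S p `<=` T].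

Lemma negligible_bigcup_count d (T : measurableType d) (R : realType)
    (mu : {measure set T -> \bar R}) (I : countType) (F : I -> set T) :
  (forall i, mu.-negligible (F i)) -> mu.-negligible (\bigcup_i F i).
Proof.
move=> F0.
suff -> : \bigcup_i F i =
    \bigcup_n (if unpickle n is Some i then F i else set0).
  apply: negligible_bigcup => n; case: unpickle => [i|]; first exact: F0.
  exact: negligible_set0.
apply/seteqP; split=> [x [i _ Fx]|x [n _]]; first by exists (pickle i); rewrite ?pickleK.
by case: unpickle => // i Fx; exists i.
Qed.

Lemma negligible_le d (T : measurableType d) (R : realType)
    (mu : {measure set T -> \bar R}) (A : set T) (C : R) :
  (forall n, exists B, [/\ measurable B, A `<=` B & (mu B <= (C / n.+1%:R)%:E)%E]) ->
  mu.-negligible A.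
Proof.
move=> /choice[B HB]; exists (\bigcap_n B n); split.
- by apply: bigcap_measurable; [exists 0%N|move=> n _; case: (HB n)].
- apply/eqP; rewrite eq_le measure_ge0 andbT.
  have mB : measurable (\bigcap_n B n).
    by apply: bigcap_measurable; [exists 0%N|move=> n _; case: (HB n)].
  have le n : (mu (\bigcap_n B n) <= (C / n.+1%:R)%:E)%E.
    have [mBn _ Bn] := HB n; apply: le_trans Bn.
    by apply: le_measure; rewrite ?inE//; apply: bigcap_inf.
  have cv : ((fun n => (C / n.+1%:R)%:E) @ \oo --> 0%:E)%E.
    apply: cvg_EFin; first by apply: nearW => n.
    rewrite -[0](mulr0 C); apply: cvgMr; exact: cvg_harmonic.
  by apply: (cvge_ge _ cv); apply: nearW.
- by move=> x Ax n _; have [_ AB _] := HB n; apply: AB.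
Qed.

(** Each coordinate is shifted by K to become nonnegative and rounded down to a multiple of 1/(n+1).
    The shifted coordinate is at most 2K, which fixes the number of grid values. *)
Lemma grid_cover (R : realType) N (K n : nat) (p : 'rV[R]_N) : `|p| <= K%:R ->
  exists g : {ffun 'I_N -> 'I_((2 * K * n.+1).+1)},
    `|p - \row_j ((g j)%:R / n.+1%:R - K%:R)| <= n.+1%:R^-1.
Proof.
move=> pK; have n0 : 0 < n.+1%:R :> R by rewrite ltr0n.
have pj j : 0 <= p 0 j + K%:R <= 2 * K%:R.
  have : `|p 0 j| <= K%:R.
    apply: le_trans pK; rewrite [leRHS]/Num.norm/= mx_normrE.
    exact: (le_bigmax _ (fun ij => `|p ij.1 ij.2|) (0, j)).
  by rewrite ler_norml => /andP[? ?]; lra.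
have H j : exists k : 'I_((2 * K * n.+1).+1),
    `|p 0 j - (k%:R / n.+1%:R - K%:R)| <= n.+1%:R^-1.
  have [p0 p2] := andP (pj j).
  have t0 : 0 <= (p 0 j + K%:R) * n.+1%:R by rewrite mulr_ge0// ltW.
  set t := _ * _ in t0.
  have tl := Num.Theory.truncn_itv t0.
  have [tl1 tl2] := andP tl.
  have lt : (Num.truncn t < (2 * K * n.+1).+1)%N.
    rewrite ltnS -(ler_nat R) (le_trans tl1)// /t !natrM.
    by rewrite ler_wpM2r// ltW.
  exists (Ordinal lt); rewrite /= opprB addrA.
  have -> : p 0 j + K%:R = t / n.+1%:R by rewrite /t mulfK// gt_eqF.
  rewrite -mulrBl normrM ger0_norm ?subr_ge0// [X in _ * X]ger0_norm ?invr_ge0 ?(ltW n0)//.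
  by rewrite ler_piMl ?invr_ge0 ?(ltW n0)// ltW// ltrBlDl natr1.
have [g Hg] := choice H.
exists [ffun j => g j]; rewrite [leLHS]/Num.norm/= mx_normrE.
apply/bigmax_leP => /=; split; first by rewrite invr_ge0 ltW.
by move=> [i j] _ /=; rewrite !mxE ffunE ord1; exact: Hg.
Qed.

Lemma measure_bigsetU_le d (T : measurableType d) (R : realType)
    (mu : {measure set T -> \bar R}) (I : Type) (F : I -> set T) (r : seq I) :
  (forall i, measurable (F i)) ->
  (mu (\big[setU/set0]_(i <- r) F i) <= \sum_(i <- r) mu (F i))%E.
Proof.
move=> mF; elim: r => [|i r ih]; first by rewrite !big_nil measure0.
rewrite !big_cons; apply: le_trans (leeD (le_refl _) ih).
by apply: measureU2 => //; exact: bigsetU_measurable.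
Qed.

Lemma lee_prode (R : realType) (I : Type) (r : seq I) (P : pred I) (F G : I -> \bar R) :
  (forall i, 0 <= F i <= G i)%E ->
  (\prod_(i <- r | P i) F i <= \prod_(i <- r | P i) G i)%E.
Proof.
move=> FG; suff /andP[] : (0 <= \prod_(i <- r | P i) F i <= \prod_(i <- r | P i) G i)%E by [].
elim/big_ind2 : _ => [|a b c d /andP[a0 ab] /andP[c0 cd]|i _]; rewrite ?lexx ?lee01//.
by rewrite mule_ge0//= lee_pmul.
Qed.

(* A grid of mesh 1/n needs O(n^N) centres, and around each centre the M
   independent samples lie in the corresponding sets with probability O(n^-M). *)
Lemma thin_samples (R : realType) N M dO (Omega : measurableType dO)
    (P : probability Omega R) dZ (Z : measurableType dZ) (nu : set Z -> \bar R)
    (z : 'I_M -> Omega -> Z) (I : countType) (S : I -> 'rV[R]_N -> set Z) :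
  iid_samples P nu z -> (N < M)%N -> (forall l, thin nu (S l)) ->
  P.-negligible [set w | exists p, forall i, exists l, S l p (z i w)].
Proof.
move=> [mz lz iz] NM thS.
(* Fixing a bound for p and the relation that each of the M samples satisfies leaves countably many
   cases. *)
pose F (Kf : nat * {ffun 'I_M -> I}) := [set w | exists p : 'rV[R]_N,
   `|p| <= Kf.1%:R /\ forall i, S (Kf.2 i) p (z i w)].
apply: (@negligibleS _ _ _ _ (\bigcup_Kf F Kf)).
  move=> w [p /choice[f Hf]].
  exists ((Num.truncn `|p|).+1, [ffun i => f i]) => //; exists p; split => /=.
    by have /andP[_ /ltW] := Num.Theory.truncn_itv (normr_ge0 p).
  by move=> i; rewrite ffunE.
apply: negligible_bigcup_count => -[K f]; rewrite /F /=.
have [C HC] := choice (fun l => thS l).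
(* The grid has at most ((2K+1)(n+1))^N points. Absolute values appear because no sign is assumed of
   the constants of thinness. *)
pose D : R := (2 * K%:R + 1) ^+ N * \prod_i `|C (f i)|.
apply: (@negligible_le _ _ _ _ _ D) => n.
have n0 : 0 < n.+1%:R :> R by rewrite ltr0n.
pose G := {ffun 'I_N -> 'I_((2 * K * n.+1).+1)}.
pose ctr (g : G) : 'rV[R]_N := \row_j ((g j)%:R / n.+1%:R - K%:R).
have /choice[T HT] : forall gi : G * 'I_M, exists T : set Z,
    [/\ measurable T, (nu T <= (C (f gi.2) / n.+1%:R)%:E)%E &
        forall p, `|p - ctr gi.1| <= n.+1%:R^-1 -> S (f gi.2) p `<=` T].
  by move=> gi; apply: HC.
pose Bg g := \bigcap_(i in [set` [set: 'I_M]%SET]) (z i @^-1` T (g, i)).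
have mBg g : measurable (Bg g).
  apply: fin_bigcap_measurable => // i _.
  by rewrite -[X in measurable X]setTI; apply: mz => //; case: (HT (g, i)).
exists (\big[setU/set0]_(g : G) Bg g); split.
- exact: bigsetU_measurable.
- move=> w [p [pK Sp]]; have [g Hg] := grid_cover n pK.
  rewrite -bigcup_seq; exists g; first by rewrite /= mem_index_enum.
  move=> i _ /=.
  by have [_ _ /(_ p Hg)] := HT (g, i); apply; exact: Sp.
- apply: (le_trans (measure_bigsetU_le _ _ mBg)).
  have PB g : (P (Bg g) <= (\prod_i (`|C (f i)| / n.+1%:R))%:E)%E.
    rewrite /Bg iz; last by move=> i; case: (HT (g, i)).
    rewrite -prodEFin; under eq_bigl do rewrite inE.
    apply: lee_prode => i; rewrite measure_ge0/=.
    have [mT nT _] := HT (g, i).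
    rewrite lz//; apply: le_trans nT _.
    by rewrite lee_fin ler_wpM2r ?ler_norm// invr_ge0 ltW.
  apply: (le_trans (lee_sum _ (fun g _ => PB g))).
  rewrite sumEFin lee_fin sumr_const card_ffun !card_ord.
  rewrite big_split/= prodr_const card_ord -[leLHS]mulr_natl natrX /D.
  rewrite mulrCA [leRHS](_ : _ = \prod_i `|C (f i)| * ((2 * K%:R + 1) ^+ N / n.+1%:R)); last by ring.
  apply: ler_wpM2l; first by apply: prodr_ge0.
  apply: (@le_trans _ _ (((2 * K%:R + 1) * n.+1%:R) ^+ N * n.+1%:R^-1 ^+ M)).
    apply: ler_wpM2r; first by rewrite exprn_ge0// invr_ge0 ltW.
    apply: lerXn2r; rewrite ?nnegrE ?mulr_ge0 ?addr_ge0 ?mulr_ge0//.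
    by rewrite mulrDl mul1r -natr1 !natrM lerD2l ler1n.
  rewrite exprMn -mulrA; apply: ler_wpM2l; first by rewrite exprn_ge0// addr_ge0// mulr_ge0.
  (* Of the M factors 1/(n+1), N cancel the size of the grid, one is kept, and the others are at
     most 1. *)
  rewrite -(subnKC NM) addSn exprS exprD.
  rewrite (_ : _ * _ = (n.+1%:R * n.+1%:R^-1) ^+ N * (n.+1%:R^-1 * n.+1%:R^-1 ^+ (M - N.+1))); last first.
    by rewrite exprMn; ring.
  rewrite divff ?gt_eqF// expr1n mul1r.
  rewrite ler_piMr ?invr_ge0 ?(ltW n0)// exprn_ile1 ?invr_ge0 ?(ltW n0)//.
  by rewrite invf_le1// ler1n.
Qed.

(** * Slices of tuple measures *)

Section tuple_measure_theory.
Context d (T : measurableType d) (R : realType).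
Variable m : {sigma_finite_measure set T -> \bar R}.

Let tcons n (p : T * n.-tuple T) : n.+1.-tuple T := [tuple of p.1 :: p.2].

Lemma measurable_tcons n : measurable_fun setT (@tcons n).
Proof. exact: measurable_cons. Qed.

(** [tuple_measure] is a bare set function; Fubini and Radon-Nikodym below need it as a sigma-finite
    measure. *)
Lemma tuple_measureE n : exists mu : {sigma_finite_measure set (n.-tuple T) -> \bar R},
  tuple_measure m n = mu.
Proof.
elim: n => [|n [mu muE]].
  by exists (\d_ ([tuple] : 0.-tuple T)).
have mc := @measurable_tcons n.
pose pm : {measure set (T * n.-tuple T)%type -> \bar R} := (m \x mu)%E.
pose nu0 : set (n.+1.-tuple T) -> \bar R := pushforward pm (@tcons n).
have sf : sigma_finite setT nu0.
  have /sigma_finiteP[F [TF ndF Foo]] := sigma_finiteT m.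
  have /sigma_finiteP[G [TG ndG Goo]] := sigma_finiteT mu.
  pose unc (t : n.+1.-tuple T) := (thead t, [tuple of behead t]).
  have munc : measurable_fun setT unc.
    apply/measurable_fun_pairP; split => /=.
      exact: (measurable_tnth ord0).
    exact: measurable_behead.
  have uncK : cancel (@tcons n) unc.
    by move=> [x t]; congr pair; apply/val_inj.
  exists (fun i => unc @^-1` (F i `*` G i)).
    rewrite -preimage_bigcup (_ : \bigcup_i _ = setT) ?preimage_setT//.
    rewrite predeqE => -[x y]; split=> // _.
    have : [set: T] x by []. rewrite TF => -[k _ Fkx].
    have : [set: n.-tuple T] y by []. rewrite TG => -[l _ Gly].
    (* Both exhaustions are nondecreasing, so a common index serves the head and the tail. *)
    exists (maxn k l) => //; split.
    - by move: x Fkx; exact/subsetPset/ndF/leq_maxl.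
    - by move: y Gly; exact/subsetPset/ndG/leq_maxr.
  move=> i; have [mF Fo] := Foo i; have [mG Go] := Goo i; split.
    by rewrite -[X in measurable X]setTI; apply: munc => //; exact: measurableX.
  rewrite /nu0 /pushforward -comp_preimage (_ : unc \o _ = id); last first.
    by apply/funext => x; exact: uncK.
  by rewrite preimage_id /pm/= product_measure1E// lte_mul_pinfty// ge0_fin_numE.
have nu00 : nu0 set0 = 0%E by rewrite /nu0 /pushforward preimage_set0 measure0.
have nu0_ge0 A : (0 <= nu0 A)%E by exact: measure_ge0.
have nu0_sig : semi_sigma_additive nu0.
  move=> F mF tF mUF; rewrite /nu0 /pushforward preimage_bigcup.
  apply: measure_semi_sigma_additive.
  - by move=> i; rewrite -[X in measurable X]setTI; exact: mc.
  - apply/trivIsetP => /= i j _ _ ij; rewrite -preimage_setI.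
    by move/trivIsetP : tF => /(_ i j Logic.I Logic.I ij) ->; rewrite preimage_set0.
  - by rewrite -preimage_bigcup -[X in measurable X]setTI; exact: mc.
pose nu1 : {measure set (n.+1.-tuple T) -> \bar R} :=
  HB.pack nu0 (isMeasure.Build _ _ _ nu0 nu00 nu0_ge0 nu0_sig).
pose nu2 : {sigma_finite_measure set (n.+1.-tuple T) -> \bar R} :=
  HB.pack nu0 (Measure.class nu1) (Measure_isSigmaFinite.Build _ _ _ nu1 sf).
by exists nu2; rewrite /= muE.
Qed.

Definition tupd n (z : n.-tuple T) (k : 'I_n) (t : T) : n.-tuple T :=
  [tuple if i == k then t else tnth z i | i < n].

Lemma tupd_measurable n (z : n.-tuple T) k : measurable_fun setT (tupd z k).
Proof.
apply/measurable_fun_tnthP => i; rewrite /comp.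
rewrite (_ : (fun _ => _) = if i == k then id else cst (tnth z i)).
  by case: ifP.
by apply/funext => t; rewrite tnth_mktuple; case: ifP.
Qed.

Let integral_le_cst d' (T' : measurableType d') (mu : {measure set T' -> \bar R})
    (f : T' -> \bar R) (A : set T') (c b : R) :
  measurable A -> measurable_fun [set: T'] f -> (forall x, 0 <= f x)%E ->
  (forall x, A x -> f x <= c%:E)%E -> (forall x, ~ A x -> f x = 0%E) ->
  0 <= c -> (mu A <= b%:E)%E -> (\int[mu]_x f x <= (c * b)%:E)%E.
Proof.
move=> mA mf f0 fA fnA c0 mAb.
have -> : (\int[mu]_x f x = \int[mu]_(x in A) f x)%E.
  rewrite [RHS]integral_mkcond; congr integral; apply/funext => x.
  by rewrite patchE; case: ifPn => //; rewrite notin_setE => /fnA.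
apply: (@le_trans _ _ (\int[mu]_(x in A) (cst c%:E) x)%E).
  apply: ge0_le_integral => //; first exact: measurable_funTS.
rewrite integral_cst// EFinM; apply: lee_wpmul2l; last exact: mAb.
by rewrite lee_fin.
Qed.

Lemma tuple_box_measurable n (A : set T) : measurable A ->
  measurable [set z : n.-tuple T | forall i, A (tnth z i)].
Proof.
move=> mA.
rewrite (_ : mkset _ = \bigcap_(i in [set: 'I_n]) (fun z => tnth z i) @^-1` A).
  apply: fin_bigcap_measurable => // i _.
  by rewrite -[X in measurable X]setTI; exact: measurable_tnth.
by apply/seteqP; split=> [z + i _|z + i]; [apply|apply].
Qed.

Lemma tuple_measure_box n (A : set T) (b : R) : measurable A -> 0 <= b ->
  (m A <= b%:E)%E ->
  (tuple_measure m n [set z | forall i, A (tnth z i)] <= (b ^+ n)%:E)%E.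
Proof.
move=> mA b0 mAb; elim: n => [|n ih].
  by rewrite /= diracE expr0 lee_fin; case: (_ \in _).
rewrite /=; have [mu muE] := tuple_measureE n; rewrite muE in ih *.
rewrite /pushforward/= exprSr.
apply: (@integral_le_cst _ _ m _ A) => //; last by rewrite exprn_ge0.
- apply: measurable_fun_xsection; rewrite -[X in measurable X]setTI.
  by apply: measurable_tcons => //; exact: tuple_box_measurable.
- move=> x Ax /=; apply: le_trans ih; apply: le_measure; rewrite ?inE.
  + apply: measurable_xsection; rewrite -[X in measurable X]setTI.
    by apply: measurable_tcons => //; exact: tuple_box_measurable.
  + exact: tuple_box_measurable.
  + move=> z; rewrite /xsection/= inE => /= H i.
    by have := H (lift ord0 i); rewrite tnthS.
- move=> x nAx /=; rewrite (_ : xsection _ _ = set0) ?measure0//.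
  rewrite -subset0 => z; rewrite /xsection/= inE => /(_ ord0).
  by [].
Qed.

(** Fubini with the head integrated first. The box confines the tails to a set of measure at most
    b^n, which matters because m may be infinite. *)
Lemma tuple_measure_slice0 n (A : set T) (S : set (n.+1.-tuple T))
    (b c : R) : measurable A -> measurable S -> 0 <= b -> 0 <= c ->
  (m A <= b%:E)%E -> S `<=` [set z | forall i, A (tnth z i)] ->
  (forall z, (m [set t | S (tupd z ord0 t)] <= c%:E)%E) ->
  (tuple_measure m n.+1 S <= (c * b ^+ n)%:E)%E.
Proof.
move=> mA mS b0 c0 mAb SA Sk.
have [mu muE] := tuple_measureE n.
have mcS : measurable (@tcons n @^-1` S).
  by rewrite -[X in measurable X]setTI; exact: measurable_tcons.
have -> : tuple_measure m n.+1 S = (m \x mu)%E (@tcons n @^-1` S) by rewrite -muE.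
have bE := tuple_measure_box n mA b0 mAb; rewrite muE in bE.
(* The product measure is rewritten as an integral over the tails of the measure of the set of
   heads. *)
rewrite (_ : (m \x mu)%E _ = (m \x^ mu)%E (@tcons n @^-1` S)); last first.
  by apply: product_measure_unique => // B C mB mC; exact: product_measure2E.
apply: (@integral_le_cst _ _ mu _ [set z | forall i, A (tnth z i)]) => //.
- exact: tuple_box_measurable.
- exact: measurable_fun_ysection.
(* The head [point] is a placeholder, overwritten by [tupd] at index 0. *)
- move=> z _; apply: le_trans (Sk (tcons (point, z))).
  apply: le_measure; rewrite ?inE//.
  + exact: measurable_ysection.
  + by rewrite -[X in measurable X]setTI; exact: tupd_measurable.
  + move=> t; rewrite /ysection/= inE/=; congr S.
    apply: eq_from_tnth => i; rewrite tnth_mktuple.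
    case: (unliftP ord0 i) => [i'|] ->; last by rewrite eqxx.
    by rewrite eq_sym (negbTE (neq_lift _ _)) !tnthS.
- move=> z nz /=; rewrite (_ : ysection _ _ = set0) ?measure0//.
  rewrite -subset0 => t; rewrite /ysection/= inE/= => /SA H; apply: nz => i.
  by have := H (lift ord0 i); rewrite tnthS.
Qed.

(** A nonzero index k lies in the tail: freeze the head, use induction on the tail, then integrate
    over the head, which costs one more factor b. *)
Lemma tuple_measure_slice n (k : 'I_n.+1) (A : set T) (S : set (n.+1.-tuple T))
    (b c : R) : measurable A -> measurable S -> 0 <= b -> 0 <= c ->
  (m A <= b%:E)%E -> S `<=` [set z | forall i, A (tnth z i)] ->
  (forall z, (m [set t | S (tupd z k t)] <= c%:E)%E) ->
  (tuple_measure m n.+1 S <= (c * b ^+ n)%:E)%E.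
Proof.
move=> mA + b0 c0 mAb.
elim: n k S => [|n ih] k S mS SA Sk.
  by apply: (tuple_measure_slice0 mA) => //; rewrite -[ord0](ord1 k).
have [mu muE] := tuple_measureE n.+1.
case: (unliftP ord0 k) => [j|] kE; last first.
  by apply: (tuple_measure_slice0 mA) => //; rewrite -kE.
have mcS : measurable (@tcons n.+1 @^-1` S).
  by rewrite -[X in measurable X]setTI; exact: measurable_tcons.
have -> : tuple_measure m n.+2 S = (m \x mu)%E (@tcons n.+1 @^-1` S) by rewrite -muE.
rewrite exprSr mulrA; apply: (@integral_le_cst _ _ m _ A) => //; last first.
- by rewrite mulr_ge0// exprn_ge0.
- move=> x nAx /=; rewrite (_ : xsection _ _ = set0) ?measure0//.
  by rewrite -subset0 => z; rewrite /xsection/= inE/= => /SA /(_ ord0).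
- move=> x Ax /=; rewrite -muE; apply: (ih j).
  + exact: measurable_xsection.
  + move=> z; rewrite /xsection/= inE/= => /SA H i.
    by have := H (lift ord0 i); rewrite tnthS.
  + move=> z; apply: le_trans (Sk (tcons (x, z))).
    apply: le_measure; rewrite ?inE//.
    * rewrite -[X in measurable X]setTI; apply: tupd_measurable => //.
      exact: measurable_xsection.
    * by rewrite -[X in measurable X]setTI; exact: tupd_measurable.
    * move=> t; rewrite /xsection/= inE/= kE; congr S.
      apply: eq_from_tnth => i; rewrite tnth_mktuple.
      case: (unliftP ord0 i) => [i'|] ->.
        by rewrite !tnthS tnth_mktuple (inj_eq lift_inj) .
      by rewrite (negbTE (neq_lift _ _)).
- exact: measurable_fun_xsection.
Qed.

End tuple_measure_theory.

(** * Power series of multilinear maps *)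

Section multilinear_bounds.
Variables (R : realType) (k : scalars).
Local Notation K := (scalar_field R k).
Variable W : normedModType K.

Lemma real_normN (w : W) : real_norm (- w) = real_norm w.
Proof. by rewrite /real_norm normrN. Qed.

Lemma real_norm_sum (I : Type) (r : seq I) (P : pred I) (F : I -> W) :
  real_norm (\sum_(i <- r | P i) F i) <= \sum_(i <- r | P i) real_norm (F i).
Proof.
elim/big_ind2 : _ => [|x1 x2 y1 y2 le1 le2|//]; first by rewrite real_norm0.
by rewrite (le_trans (real_normD _ _))// lerD.
Qed.

Lemma real_norm_of_realZ (a : R) (w : W) :
  real_norm (of_real k a *: w) = `|a| * real_norm w.
Proof.
rewrite real_normZ; congr (_ * _).
case: (leP 0 a) => a0; first by rewrite of_real_norm// of_realK ger0_norm.
have -> : of_real k a = - of_real k (- a) :> K.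
  by apply/eqP; rewrite -addr_eq0 -of_realD subrr of_real0.
by rewrite normrN of_real_norm ?oppr_ge0 ?(ltW a0)// of_realK ltr0_norm.
Qed.

Lemma real_norm_cvg_dist (u : nat -> W) (l : W) (e : R) : u @ \oo --> l -> 0 < e ->
  \forall n \near \oo, real_norm (l - u n) < e.
Proof.
move=> /cvgrPdist_lt + e0 => /(_ (of_real k e)).
have e0' : 0 < of_real k e :> K.
  rewrite lt_neqAle -of_real0 of_real_le ?ltW// andbT of_real0 eq_sym.
  by apply/negP => /eqP/of_real_eq0/eqP; rewrite gt_eqF.
move=> /(_ e0'); apply: filterS => n lt.
rewrite lt_neqAle -[X in _ && (_ <= X)](@of_realK R k) real_part_le ?ltW//= andbT.
apply/negP => /eqP E; move: lt; rewrite -E of_real_norm_real ltxx //.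
Qed.

Lemma real_norm_cvg_le (u : nat -> W) (l : W) (B : R) : u @ \oo --> l ->
  (forall n, real_norm (u n) <= B) -> real_norm l <= B.
Proof.
move=> ul uB; apply/ler_addgt0Pr => e e0.
have [n _ /(_ n (leqnn n)) un] := real_norm_cvg_dist ul e0.
by rewrite -[l](subrK (u n)) (le_trans (real_normD _ _))// addrC lerD// ltW.
Qed.

(** Analyticity supplies only continuity for the product topology, and the supremum in [mnorm] is
    meaningful only for bounded maps. If f were unbounded on unit vectors, dividing witnesses with
    values above (m+1)^(n+1) by m+1 would give a sequence tending to 0 whose values stay above 1. *)
Lemma continuous_multilinear_bounded (Y : normedModType R) n (f : ('I_n -> Y) -> W) :
  multilinear (of_real k) f -> continuous (f : {ptws 'I_n -> Y} -> W) ->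
  exists C, forall h, (forall i, `|h i| <= 1) -> real_norm (f h) <= C.
Proof.
move=> mf cf; case: n f mf cf => [|n] f mf cf.
  (* In degree 0 there is a single argument, and the scaling argument does not apply. *)
  exists (real_norm (f (fun=> 0))) => h _.
  by rewrite (_ : h = fun=> 0)//; apply/funext => -[].
apply/not_existsP => /= nC.
have scale (a : R) h : f (fun i => a *: h i) = of_real k (a ^+ n.+1) *: f h.
  have sc1 (i : 'I_n.+1) (g : 'I_n.+1 -> Y) : f (dfwith g i (a *: g i)) = of_real k a *: f g.
    have f0 : f (dfwith g i (0 : Y)) = 0 :> W.
      have := mf i g 1 0 0; rewrite scale1r addr0 of_real1 scale1r => /eqP.
      by rewrite addrC -subr_eq subrr eq_sym => /eqP.
    rewrite -[a *: g i]addr0 mf f0 addr0; congr (_ *: f _).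
    apply/funext => j; have [<-|ij] := eqVneq i j; first by rewrite dfwithin.
    by rewrite dfwithout.
  have H : forall l : seq 'I_n.+1, uniq l ->
      f (fun i => if i \in l then a *: h i else h i) = of_real k (a ^+ size l) *: f h.
    elim=> [_|i l ih /= /andP[il ul]]; first by rewrite expr0 of_real1 scale1r.
    rewrite exprS of_realM -scalerA -ih// -(sc1 i); congr f.
    apply/funext => j; have [<-|ij] := eqVneq i j.
      by rewrite dfwithin inE eqxx (negbTE il).
    by rewrite dfwithout// inE eq_sym (negbTE ij).
  rewrite -[n.+1 in RHS]size_enum_ord -H ?enum_uniq//; congr f.
  by apply/funext => i; rewrite mem_enum.
have /choice[g Hg] : forall m : nat, exists g : 'I_n.+1 -> Y,
    (forall i, `|g i| <= 1) /\ m.+1%:R ^+ n.+1 < real_norm (f g).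
  move=> m; have := nC (m.+1%:R ^+ n.+1).
  move=> /existsNP[g /not_implyP[g1 /negP]]; rewrite -ltNge => g2.
  by exists g.
pose u (m : nat) : {ptws 'I_n.+1 -> Y} := fun i => m.+1%:R^-1 *: g m i.
have u0 : u @ \oo --> (cst 0 : {ptws 'I_n.+1 -> Y}).
  apply/cvg_sup => i; apply/cvg_image.
    by rewrite eqEsubset; split => v // _; exists (cst v).
  move=> Q /= Qn; exists ((fun g : 'I_n.+1 -> Y => g i) @^-1` Q); last first.
    by rewrite image_preimage// eqEsubset; split => v // _; exists (cst v).
  suff : u^~ i @ \oo --> (0 : Y) by apply.
  apply/cvgrPdist_le => e e0.
  have := @cvg_harmonic R; move=> /cvgrPdist_le /(_ e e0).
  apply: filterS => m /=; rewrite !sub0r !normrN => me.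
  rewrite /u normrZ (le_trans _ me)// ler_piMr//.
  by have [] := Hg m.
have fu : (f \o u) @ \oo --> f (cst 0) by apply: continuous_cvg => //; exact: cf.
have f0 : f (cst 0) = 0.
  have E := scale 0 (cst 0).
  rewrite (_ : cst 0 = fun i : 'I_n.+1 => 0 *: cst (0 : Y) i).
    by rewrite E expr0n/= of_real0; exact: scale0r.
  by apply/funext => i; rewrite scale0r.
have [m _ /(_ m (leqnn m))] := real_norm_cvg_dist fu ltr01.
rewrite f0 sub0r real_normN /= /u scale real_norm_of_realZ.
have [_ fm] := Hg m.
have m0 : 0 < m.+1%:R :> R by rewrite ltr0n.
rewrite ger0_norm ?exprn_ge0 ?invr_ge0 ?(ltW m0)//.
rewrite exprVn mulrC ltr_pdivrMr ?exprn_gt0// mul1r => fm'.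
by have := lt_trans fm fm'; rewrite ltxx.
Qed.

End multilinear_bounds.

(** * Majorised power series at a point *)

Section expansions.
Variables (R : realType) (k : scalars).
Local Notation K := (scalar_field R k).
Variable Y : normedModType R.
Variable W : normedModType K.
Implicit Types (T : seq Y -> W) (f : Y -> W).

(* [T] packs a family of symmetric multilinear maps, the one of degree [j]
   being the restriction of [T] to sequences of length [j]. *)
Definition symm_multilinear T :=
  (forall a x y s, T (a *: x + y :: s) = of_real k a *: T (x :: s) + T (y :: s)) /\
  (forall s t, perm_eq s t -> T s = T t).

(** Operator norms are replaced by arbitrary majorants c, and summability by a bound on partial
    sums. Expansions can then be composed, subtracted and differentiated without computing a
    norm. *)
Definition expands f y T := exists (rho : R) (c : nat -> R) (B : R),
  [/\ 0 < rho, forall j, 0 <= c j,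
      forall s, real_norm (T s) <= c (size s) * \prod_(x <- s) `|x|,
      forall n, \sum_(j < n) c j * rho ^+ j <= B &
      forall h, `|h| < rho -> series (fun j => T (nseq j h)) @ \oo --> f (y + h)].

Lemma symm_multilinear0 T s : symm_multilinear T -> T (0 :: s) = 0.
Proof.
move=> [mT _]; have := mT 1 0 0 s; rewrite scale1r addr0 of_real1 scale1r.
by move=> /eqP; rewrite addrC -subr_eq subrr eq_sym => /eqP.
Qed.

Lemma symm_multilinearZ T a x s : symm_multilinear T ->
  T (a *: x :: s) = of_real k a *: T (x :: s).
Proof.
by move=> mT; have [l _] := mT; rewrite -[a *: x]addr0 l symm_multilinear0// addr0.
Qed.

Lemma symm_multilinearD T x y s : symm_multilinear T ->
  T (x + y :: s) = T (x :: s) + T (y :: s).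
Proof.
by move=> [l _]; rewrite -[X in X + _ :: _]scale1r l of_real1 scale1r.
Qed.

Lemma symm_multilinear_scale T (a : Y -> R) (u : Y -> Y) s : symm_multilinear T ->
  T (map (fun x => a x *: u x) s) = of_real k (\prod_(x <- s) a x) *: T (map u s).
Proof.
move=> mT.
(* Linearity is available at the head only. A head that has been treated moves into the suffix t by
   symmetry, and the next one comes forward. *)
suff H t : T (map (fun x => a x *: u x) s ++ t) =
    of_real k (\prod_(x <- s) a x) *: T (map u s ++ t).
  by have := H [::]; rewrite !cats0.
have [_ sT] := mT.
elim: s t => [|x s ih] t /=; first by rewrite big_nil of_real1 scale1r.
rewrite symm_multilinearZ// big_cons of_realM -scalerA; congr (_ *: _).
rewrite (sT _ (map (fun x => a x *: u x) s ++ u x :: t)); last first.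
  by rewrite -cat_cons -cat_rcons perm_cat2r perm_sym perm_rcons.
rewrite ih; congr (_ *: _); apply: sT.
by rewrite -cat_rcons -cat_cons perm_cat2r perm_rcons.
Qed.

Lemma symm_multilinear_bound T n (C : R) : symm_multilinear T ->
  (forall s, size s = n -> (forall x, x \in s -> `|x| <= 1) -> real_norm (T s) <= C) ->
  forall s, size s = n -> real_norm (T s) <= C * \prod_(x <- s) `|x|.
Proof.
move=> mT TC s sn.
have -> : T s = of_real k (\prod_(x <- s) `|x|) *: T (map (fun x => `|x|^-1 *: x) s).
  rewrite -(@symm_multilinear_scale T (fun x => `|x|))//; congr T.
  rewrite -[LHS]map_id; apply: eq_map => x; rewrite scalerA.
  have [->|x0] := eqVneq x 0; first by rewrite scaler0.
  by rewrite divff ?scale1r// normr_eq0.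
rewrite real_norm_of_realZ ger0_norm ?prodr_ge0// mulrC ler_wpM2r ?prodr_ge0//.
apply: TC; first by rewrite size_map.
move=> _ /mapP[x _ ->]; rewrite normrZ normfV normr_id.
have [->|x0] := eqVneq x 0; first by rewrite normr0 mulr0.
by rewrite mulVf// normr_eq0.
Qed.

Lemma real_analytic_expands (U : set Y) f y : real_analytic U f -> U y ->
  exists2 T, symm_multilinear T & expands f y T.
Proof.
move=> /[apply] -[rho [G [rho0 GP cv Gf]]].
(* The default 0 is never read, since the indices stay below the length of s. *)
pose T (s : seq Y) := G (size s) (fun i => nth 0 s i).
have TE n (u : n.-tuple Y) : T u = G n (fun i => tnth u i).
  case: u => s sn; rewrite /T /=; have E := eqP sn; subst n.
  by congr G; apply/funext => i; rewrite (tnth_nth 0).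
have mT : symm_multilinear T.
  split=> [a x y' s|s t st].
    have [mG _ _] := GP (size s).+1.
    pose h0 (i : 'I_(size s).+1) : Y := nth 0 (0 :: s) i.
    have E (z : Y) : T (z :: s) = G (size s).+1 (dfwith h0 ord0 z).
      rewrite /T/=; congr G; apply/funext => i.
      have [<-|i0] := eqVneq ord0 i; first by rewrite dfwithin.
      rewrite dfwithout//; case: i i0 => -[|i]//= ? .
    by rewrite !E mG.
  have := st; rewrite -[t]/(tval (in_tuple t)) => /tuple_permP[p ->].
  rewrite !TE.
  have [_ sG _] := GP (size t); rewrite -[RHS](sG p); congr G.
  by apply/funext => i; rewrite tnth_mktuple.
exists T => //.
have bG j : exists C, forall h, (forall i, `|h i| <= 1) -> real_norm (G j h) <= C.
  by have [mG _ cG] := GP j; exact: continuous_multilinear_bounded.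
have leG j h : (forall i, `|h i| <= 1) -> real_norm (G j h) <= mnorm (G j).
  move=> h1; apply: ub_le_sup; last by exists h.
  by have [C HC] := bG j; exists C => _ [g g1 <-]; exact: HC.
have G0 j : 0 <= mnorm (G j).
  apply: le_trans (leG j (fun=> 0) _); first exact: real_norm_ge0.
  by move=> i; rewrite normr0.
exists rho, (fun j => mnorm (G j)), (limn (series (fun j => mnorm (G j) * rho ^+ j))).
split => //.
- move=> s; apply: symm_multilinear_bound (erefl (size s)) => // t ts t1.
  rewrite -ts; apply: leG => i; apply: t1; exact: mem_nth.
- move=> n; rewrite -[leLHS](big_mkord xpredT (fun j => mnorm (G j) * rho ^+ j)).
  apply: (@nondecreasing_cvgn_le _ (series (fun j => mnorm (G j) * rho ^+ j))) => //.
  apply: nondecreasing_series => j _ _; by rewrite mulr_ge0// exprn_ge0// ltW.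
- move=> h hrho; have [_] := Gf h hrho.
  rewrite (_ : (fun j => T (nseq j h)) = (fun j => G j (fun=> h)))//.
  apply/funext => j; rewrite (TE j [tuple of nseq j h]); congr G.
  by apply/funext => i; rewrite (tnth_nth 0) nth_nseq ltn_ord.
Qed.

Lemma prod_norm_nseq j (h : Y) : \prod_(x <- nseq j h) `|x| = `|h| ^+ j.
Proof. by rewrite big_nseq iter_mulr_1. Qed.

(** Every term of positive degree contains a factor |h|, and the remaining power of |h| is bounded
    by that of rho. The estimate is Lipschitz at the centre only, which is all the strata
    require. *)
Lemma expands_calm f y T : symm_multilinear T -> expands f y T ->
  exists (rho L : R), [/\ 0 < rho, 0 <= L & forall h, `|h| < rho ->
    real_norm (f (y + h) - T [::]) <= L * `|h|].
Proof.
move=> mT [rho [c [B [rho0 c0 Tc cB Tf]]]].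
exists rho, (B / rho); split => //.
  rewrite divr_ge0 ?(ltW rho0)//; have := cB 0%N; by rewrite big_ord0.
move=> h hrho.
have cv : series (fun j => T (nseq j.+1 h)) @ \oo --> f (y + h) - T [::].
  rewrite (_ : series _ = (fun n => series (fun j => T (nseq j h)) n.+1 - T [::])).
    apply: cvgB; last exact: cvg_cst.
    by rewrite cvg_shiftS; exact: Tf.
  apply/funext => n; rewrite /series/= [in RHS]big_nat_recl//= addrAC subrr add0r.
  by [].
apply: (real_norm_cvg_le cv) => n; rewrite /series/= big_mkord.
apply: le_trans (real_norm_sum _ _ _) _.
apply: (@le_trans _ _ (\sum_(j < n) c j.+1 * rho ^+ j.+1 * (`|h| / rho))).
  apply: ler_sum => j _; apply: (le_trans (Tc (nseq j.+1 h))).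
  rewrite size_nseq prod_norm_nseq -mulrA; apply: ler_wpM2l => //.
  have -> : rho ^+ j.+1 * (`|h| / rho) = `|h| * rho ^+ j.
    by rewrite exprS; field; rewrite gt_eqF.
  by rewrite exprS ler_wpM2l// lerXn2r ?nnegrE ?(ltW rho0)// ltW.
rewrite -mulr_suml mulrA mulrAC; apply: ler_wpM2r => //.
rewrite ler_wpM2r ?invr_ge0 ?(ltW rho0)//.
apply: le_trans (cB n.+1); rewrite big_ord_recl lerDr mulr_ge0//.
Qed.

Lemma expands_center f y T : symm_multilinear T -> expands f y T -> T [::] = f y.
Proof.
move=> mT /(expands_calm mT)[rho [L [rho0 _ /(_ 0)]]].
rewrite normr0 mulr0 addr0 => /(_ rho0) le0.
apply/esym/eqP; rewrite -subr_eq0; apply/eqP/real_norm_eq0/eqP.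
by rewrite eq_le le0 real_norm_ge0.
Qed.

End expansions.

Section expansion_operations.
Variables (R : realType) (k : scalars).
Local Notation K := (scalar_field R k).
Variable W : normedModType K.

Lemma symm_multilinear_comp (Y1 Y : normedModType R) (l : Y1 -> Y) (T : seq Y -> W) :
  (forall a x y, l (a *: x + y) = a *: l x + l y) ->
  symm_multilinear T -> symm_multilinear (T \o map l).
Proof.
move=> ll [mT sT]; split=> [a x y s|s t st] /=; first by rewrite ll mT.
by apply: sT; exact: perm_map.
Qed.

Lemma expands_comp (Y1 Y : normedModType R) (l : Y1 -> Y) (C : R) (f : Y -> W) y T :
  (forall a x y, l (a *: x + y) = a *: l x + l y) ->
  0 < C -> (forall x, `|l x| <= C * `|x|) ->
  expands f (l y) T -> expands (f \o l) y (T \o map l).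
Proof.
move=> ll C0 lC [rho [c [B [rho0 c0 Tc cB Tf]]]].
(* The factors C^j in the majorants cancel against the smaller radius, so the bound B is
   unchanged. *)
exists (rho / C), (fun j => c j * C ^+ j), B; split.
- by rewrite divr_gt0.
- by move=> j; rewrite mulr_ge0// exprn_ge0// ltW.
- move=> s /=; apply: le_trans (Tc _) _; rewrite size_map -mulrA ler_wpM2l//.
  rewrite big_map; elim: s => [|x s ih]; first by rewrite !big_nil expr0 mulr1.
  rewrite !big_cons /= exprS mulrACA ler_pM//.
  by rewrite prodr_ge0.
- move=> n; apply: le_trans (cB n); apply: ler_sum => j _.
  by rewrite -mulrA -exprMn mulrCA divff ?gt_eqF// mulr1.
- move=> h hr /=; have -> : l (y + h) = l y + l h.
    by have := ll 1 y h; rewrite !scale1r.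
  rewrite (_ : (fun j => _) = (fun j => T (nseq j (l h)))).
    by apply: Tf; apply: le_lt_trans (lC h) _; rewrite mulrC -ltr_pdivlMr.
  by apply/funext => j; rewrite /= map_nseq.
Qed.

Variable Y : normedModType R.
Implicit Types (f g : Y -> W).

Lemma symm_multilinearB (T S : seq Y -> W) :
  symm_multilinear T -> symm_multilinear S -> symm_multilinear (fun s => T s - S s).
Proof.
move=> [mT sT] [mS sS]; split=> [a x y s|s t st]; last by rewrite (sT s t)// (sS s t).
by rewrite mT mS scalerBr opprD addrACA.
Qed.

Lemma expandsB f g y T S :
  expands f y T -> expands g y S -> expands (f \- g) y (fun s => T s - S s).
Proof.
move=> [rho [c [B [rho0 c0 Tc cB Tf]]]] [rho' [c' [B' [rho'0 c'0 Sc cB' Sg]]]].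
exists (Num.min rho rho'), (fun j => c j + c' j), (B + B'); split.
- by rewrite lt_min rho0.
- by move=> j; rewrite addr_ge0.
- move=> s; rewrite mulrDl (le_trans (real_normD _ _))// real_normN lerD//.
- move=> n; under eq_bigr do rewrite mulrDl.
  have m0 : 0 <= Num.min rho rho' by rewrite le_min !ltW.
  rewrite big_split/= lerD//.
    apply: le_trans (cB n); apply: ler_sum => j _; rewrite ler_wpM2l//.
    by rewrite lerXn2r ?nnegrE ?(ltW rho0)// ge_min lexx.
  apply: le_trans (cB' n); apply: ler_sum => j _; rewrite ler_wpM2l//.
  by rewrite lerXn2r ?nnegrE ?(ltW rho'0)// ge_min lexx orbT.
- move=> h; rewrite lt_min => /andP[h1 h2] /=.
  rewrite (_ : series _ = series (fun j => T (nseq j h)) - series (fun j => S (nseq j h))).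
    by apply: cvgB; [exact: Tf|exact: Sg].
  by apply/funext => n; rewrite /series/= !fctE sumrB.
Qed.

Variable phi : W -> R^o.
Hypothesis phil : forall a x y, phi (of_real k a *: x + y) = a *: phi x + phi y.
Hypothesis phi_le : forall w, `|phi w| <= real_norm w.

Lemma symm_multilinear_real (T : seq Y -> W) :
  symm_multilinear T -> @symm_multilinear R RealScalars Y R^o (phi \o T).
Proof.
by move=> [mT sT]; split=> [a x y s|s t st] /=; [rewrite mT phil|rewrite (sT s t)].
Qed.

Lemma expands_real f y T : expands f y T ->
  @expands R RealScalars Y R^o (phi \o f) y (phi \o T).
Proof.
move=> [rho [c [B [rho0 c0 Tc cB Tf]]]].
exists rho, c, B; split => //.
- by move=> s; apply: le_trans (Tc s); exact: phi_le.
- move=> h hr.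
  have phi0 : phi 0 = 0.
    have := phil 1 0 0; rewrite of_real1 !scale1r addr0 => /eqP.
    by rewrite addrC -subr_eq subrr eq_sym => /eqP.
  have phiD a b : phi (a + b) = phi a + phi b.
    by have := phil 1 a b; rewrite of_real1 !scale1r.
  have phiN a : phi (- a) = - phi a.
    by apply/eqP; rewrite -addr_eq0 -phiD addNr phi0.
  rewrite (_ : series _ = phi \o series (fun j => T (nseq j h))); last first.
    apply/funext => n; rewrite /series/=.
    by rewrite (big_morph phi phiD phi0).
  apply/cvgrPdist_lt => e e0.
  have := real_norm_cvg_dist (Tf h hr) e0; apply: filterS => n /=.
  by apply: le_lt_trans; rewrite -phiN -phiD; exact: phi_le.
Qed.

End expansion_operations.

(** * Increments of the homogeneous terms *)

Section real_expansions.
Variables (R : realType) (Y : normedModType R).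
Local Notation symm_multilinear := (@symm_multilinear R RealScalars Y R^o).
Local Notation expands := (@expands R RealScalars Y R^o).
Implicit Types (T : seq Y -> R^o) (f : Y -> R^o).

Let ring_aux (a e b d : R) j : a + e - b - (j * d + d) = (a - b - j * d) + (e - d).
Proof. ring. Qed.

Let ring_aux2 (j2 cc w B b p h : R) :
  j2 * cc * (w / B) ^+ 2 * b * (h * p) = j2 * (h * (cc * (w / B) ^+ 2 * b * p)).
Proof. ring. Qed.

Let ring_aux3 (j cc w B b p : R) : 0 < B ->
  j * cc * (w / B) * b * (w * p) = j * (B * (cc * (w / B) ^+ 2 * b * p)).
Proof. by move=> B0; field; rewrite gt_eqF. Qed.

Let ring_aux4 (j2 cc w B p : R) i :
  j2 * cc * (w / B) ^+ 2 * B ^+ i.+1 * p = j2 * (B * (cc * (w / B) ^+ 2 * B ^+ i * p)).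
Proof. by rewrite [B ^+ i.+1]exprS; ring. Qed.

(** With u the square root of t, j u^j is at most the sum of u^i for i < j, hence at most 1/(1-u);
    squaring gives the claim. *)
Lemma sqr_geometric_bound (t : R) : 0 <= t < 1 ->
  exists2 C, 0 <= C & forall j, j%:R ^+ 2 * t ^+ j <= C.
Proof.
move=> /andP[t0 t1]; pose u := Num.sqrt t.
have u0 : 0 <= u by exact: sqrtr_ge0.
have u1 : u < 1 by rewrite -sqrtr1 ltr_sqrt.
exists ((1 - u)^-1 ^+ 2); first by rewrite exprn_ge0// invr_ge0 subr_ge0 ltW.
move=> j; have -> : t ^+ j = (u ^+ j) ^+ 2 by rewrite exprAC sqr_sqrtr.
rewrite -exprMn lerXn2r ?nnegrE ?mulr_ge0 ?exprn_ge0 ?invr_ge0 ?subr_ge0 ?(ltW u1)//.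
rewrite -[leRHS]mul1r ler_pdivlMr ?subr_gt0//.
have H : j%:R * u ^+ j <= \sum_(i < j) u ^+ i.
  have -> : j%:R * u ^+ j = \sum_(i < j) u ^+ j.
    by rewrite sumr_const card_ord mulr_natl.
  by apply: ler_sum => i _; rewrite ler_wiXn2l ?(ltW u1) ?(ltnW (ltn_ord i)).
have := subrX1 u j => E.
have : (1 - u) * \sum_(i < j) u ^+ i <= 1.
  rewrite -[1 - u]opprB mulNr -E opprB lerBlDl lerDr exprn_ge0//.
by apply: le_trans; rewrite mulrC ler_wpM2l// subr_ge0 ltW.
Qed.

(** Shrinking the radius absorbs the factor j^2, which is the growth of the second-order remainders
    when a power series is differentiated termwise. *)
Lemma sqr_series_bound (c : nat -> R) (rho B r : R) : (forall j, 0 <= c j) ->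
  0 < r < rho -> (forall n, \sum_(j < n) c j * rho ^+ j <= B) ->
  exists B', forall n, \sum_(j < n) j%:R ^+ 2 * c j * r ^+ j <= B'.
Proof.
move=> c0 /andP[r0 rrho] cB; have rho0 := lt_trans r0 rrho.
have [|C C0 HC] := @sqr_geometric_bound (r / rho).
  by rewrite divr_ge0 ?(ltW r0) ?(ltW rho0)//= ltr_pdivrMr// mul1r.
exists (C * B) => n; apply: le_trans (ler_wpM2l C0 (cB n)).
rewrite mulr_sumr; apply: ler_sum => j _.
have -> : r ^+ j = rho ^+ j * (r / rho) ^+ j.
  by rewrite -exprMn mulrCA divff ?gt_eqF// mulr1.
rewrite (_ : _ * _ = j%:R ^+ 2 * (r / rho) ^+ j * (c j * rho ^+ j)); last by ring.
by rewrite ler_wpM2r// mulr_ge0// exprn_ge0// ltW.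
Qed.

Section increments.
Variables (T : seq Y -> R^o) (c : nat -> R) (h v : Y) (B : R).
Hypotheses (mT : symm_multilinear T) (c0 : forall j, 0 <= c j).
Hypothesis Tc : forall s, `|T s| <= c (size s) * \prod_(x <- s) `|x|.
Hypotheses (B0 : 0 < B) (hB : `|h| <= B) (hvB : `|h + v| <= B).

Let sT : forall s t, perm_eq s t -> T s = T t. Proof. by case: mT. Qed.

Let T_rot x s t : T (s ++ x :: t) = T (x :: s ++ t).
Proof. by apply: sT; rewrite -cat_rcons -cat_cons perm_cat2r perm_rcons. Qed.

Let Tle x s j (u : Y) : `|u| <= B ->
  `|T (x :: s ++ nseq j u)| <=
  c (size s + j.+1) * (`|x| * \prod_(y <- s) `|y|) * B ^+ j.
Proof.
move=> uB; apply: le_trans (Tc _) _ => /=.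
rewrite size_cat size_nseq addnS -mulrA ler_wpM2l// big_cons big_cat/=.
rewrite prod_norm_nseq -mulrA ler_wpM2l// ler_wpM2l ?prodr_ge0//.
by rewrite lerXn2r ?nnegrE ?(ltW B0).
Qed.

(** Copies of h + v are split one at a time into h and v; s holds the entries already split off,
    which is what the induction needs. *)
Lemma increment_le j s :
  `|T (s ++ nseq j (h + v)) - T (s ++ nseq j h)| <=
  j%:R * c (size s + j) * (`|v| / B) * B ^+ j * \prod_(x <- s) `|x|.
Proof.
elim: j s => [|j ih] s; first by rewrite subrr normr0 !mul0r.
rewrite /= !T_rot (symm_multilinearD _ _ _ mT) /= addrAC.
apply: le_trans (ler_normD _ _) _.
have := ih (h :: s); rewrite /= addSnnS big_cons => ih'.
apply: le_trans (lerD ih' (Tle v s j hvB)) _.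
set cc := c _; set p := \prod_(_ <- _) _.
have p0 : 0 <= p by exact: prodr_ge0.
have -> : cc * (`|v| * p) * B ^+ j = 1 * cc * (`|v| / B) * B ^+ j.+1 * p.
  by rewrite exprS; field; rewrite gt_eqF.
rewrite -natr1 !mulrDl lerD2r exprS.
have -> : j%:R * cc * (`|v| / B) * B ^+ j * (`|h| * p) =
   `|h| * (j%:R * cc * (`|v| / B) * B ^+ j * p) by ring.
have -> : j%:R * cc * (`|v| / B) * (B * B ^+ j) * p =
   B * (j%:R * cc * (`|v| / B) * B ^+ j * p) by ring.
by rewrite ler_wpM2r// !mulr_ge0// ?invr_ge0 ?exprn_ge0 ?(ltW B0) ?/cc.
Qed.

(** Splitting off one copy of h + v leaves a second-order remainder with h in front and a
    first-order increment with v in front. Their coefficients j^2 and j add up to at most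
    (j+1)^2. *)
Lemma increment2_le j s :
  `|T (s ++ nseq j (h + v)) - T (s ++ nseq j h) - j%:R * T (v :: s ++ nseq j.-1 h)| <=
  j%:R ^+ 2 * c (size s + j) * (`|v| / B) ^+ 2 * B ^+ j * \prod_(x <- s) `|x|.
Proof.
elim: j s => [|j ih] s; first by rewrite subrr mul0r subr0 normr0 expr2 !mul0r.
rewrite /= !T_rot (symm_multilinearD _ _ _ mT) /= .
have E : j%:R * T (v :: h :: s ++ nseq j.-1 h) = j%:R * T (v :: s ++ nseq j h).
  (* For j = 0 the truncated predecessor is harmless, because its coefficient is 0. *)
  case: j {ih} => [|j]; first by rewrite !mul0r.
  congr (_ * _); apply: sT => /=; rewrite perm_cons perm_sym.
  by rewrite -cat_rcons -cat_cons perm_cat2r perm_rcons.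
have := ih (h :: s); rewrite /= addSnnS big_cons E => ih'.
have := increment_le j (v :: s); rewrite /= addSnnS big_cons => iv.
rewrite -natr1 mulrDl mul1r.
set a := T (h :: s ++ nseq j (h + v)) in ih' *.
set b := T (h :: s ++ nseq j h) in ih' *.
set d := T (v :: s ++ nseq j h) in ih' iv *.
set e := T (v :: s ++ nseq j (h + v)) in iv *.
have -> : a + e - b - (j%:R * d + d) = (a - b - j%:R * d) + (e - d).
  exact: ring_aux.
apply: le_trans (ler_normD _ _) _; apply: le_trans (lerD ih' iv) _.
set cc := c _; set p := \prod_(_ <- _) _; set w := `|v|.
have p0 : 0 <= p by exact: prodr_ge0.
have cc0 : 0 <= cc by exact: c0.
pose Q := cc * (w / B) ^+ 2 * B ^+ j * p.
have Q0 : 0 <= Q.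
  have w0 : 0 <= w / B := divr_ge0 (normr_ge0 v) (ltW B0).
  by apply: mulr_ge0 p0; rewrite mulr_ge0 ?exprn_ge0 ?(ltW B0)// mulr_ge0 ?exprn_ge0.
apply: (@le_trans _ _ (j%:R ^+ 2 * (B * Q) + j%:R * (B * Q))).
  apply: lerD.
    rewrite (_ : _ * (`|h| * p) = j%:R ^+ 2 * (`|h| * Q)); last exact: ring_aux2.
    by rewrite ler_wpM2l ?exprn_ge0// ler_wpM2r.
  rewrite le_eqVlt; apply/orP; left; apply/eqP; exact: ring_aux3.
rewrite (_ : (j%:R + 1) ^+ 2 * _ * _ * _ * _ = (j%:R + 1) ^+ 2 * (B * Q)); last first.
  exact: ring_aux4.
rewrite -mulrDl ler_wpM2r ?(mulr_ge0 (ltW B0) Q0)//.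
have j0 : 0 <= j%:R :> R by [].
have -> : (j%:R + 1) ^+ 2 = j%:R ^+ 2 + j%:R + (j%:R + 1) :> R by ring.
by rewrite lerDl addr_ge0.
Qed.

End increments.
End real_expansions.

(** * Directional derivatives of analytic functions *)

Section analytic_derivatives.
Variables (R : realType) (Y : normedModType R).
Local Notation symm_multilinear := (@symm_multilinear R RealScalars Y R^o).
Local Notation expands := (@expands R RealScalars Y R^o).
Implicit Types (T : seq Y -> R^o) (f : Y -> R^o).

Lemma is_derive_quadratic f (x v : Y) (D K e : R) : 0 < e ->
  (forall t : R, `|t| < e -> `|f (x + t *: v) - f x - t * D| <= K * t ^+ 2) ->
  is_derive x v f D.
Proof.
move=> e0 H.
have K0 : 0 <= K.
  have := H (e / 2); rewrite ger0_norm ?divr_ge0 ?(ltW e0)//.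
  have -> : e / 2 < e by lra.
  move=> /(_ isT)/(le_trans (normr_ge0 _)).
  by rewrite pmulr_lge0// exprn_gt0// divr_gt0.
have cv : (fun h => h^-1 *: ((f \o shift x) (h *: v) - f x)) @ 0^' --> (D : R^o).
  apply/cvgrPdist_le => eps eps0.
  have d0 : 0 < eps / (K + 1) by rewrite divr_gt0// ltr_wpDl.
  near=> t.
  have t0 : t != 0 by near: t; exact: nbhs_dnbhs_neq.
  have te : `|t| < e by near: t; exact: dnbhs0_lt.
  have td : `|t| < eps / (K + 1) by near: t; exact: dnbhs0_lt.
  have := H t te => /= Ht.
  rewrite [t *: v + x]addrC.
  have -> : D - t^-1 *: (f (x + t *: v) - f x) =
      - (t^-1 * (f (x + t *: v) - f x - t * D)).
    by rewrite mulrBr mulKf// opprB.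
  rewrite normrN normrM normfV ler_pdivrMl ?normr_gt0//.
  apply: (le_trans Ht).
  rewrite -[t ^+ 2]ger0_norm ?sqr_ge0// normrX expr2 mulrA [leRHS]mulrC.
  rewrite ler_wpM2r//.
  apply: (@le_trans _ _ ((K + 1) * `|t|)); first by rewrite ler_wpM2r// lerDl.
  by rewrite mulrC -ler_pdivlMr ?ltr_wpDl// ltW.
by split; [apply/cvg_ex; exists D|apply: cvg_lim].
Unshelve. all: by end_near. Qed.

(** Termwise differentiation: by symmetry the derivative of T(h,...,h) with j+1 entries is j+1 times
    T(v,h,...,h). The second-order estimates, summed over j, bound the remainder by a multiple of
    t^2. *)
Lemma expands_derive f y T v : symm_multilinear T -> expands f y T ->
  (exists2 rho : R, 0 < rho & forall h, `|h| < rho -> derivable f (y + h) v) /\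
  expands ('D_v f) y (fun s => (size s).+1%:R * T (v :: s)).
Proof.
move=> mT [rho [c [B [rho0 c0 Tc cB Tf]]]].
pose DT (h : Y) (j : nat) : R^o := j.+1%:R * T (v :: nseq j h).
have DTle h j r : 0 < r -> `|h| <= r ->
    `|DT h j| <= j.+1%:R * c j.+1 * `|v| * r ^+ j.
  move=> r0 hr; rewrite /DT normrM ger0_norm// -!mulrA ler_wpM2l//.
  apply: le_trans (Tc _) _; rewrite /= size_nseq ler_wpM2l// big_cons ler_wpM2l//.
  by rewrite prod_norm_nseq lerXn2r ?nnegrE ?(ltW r0).
have main h : `|h| < rho ->
    exists2 D : R, series (DT h) @ \oo --> (D : R^o) & is_derive (y + h) v f D.
  (* An r strictly between |h| and rho leaves room both for h + t v and for the loss of radius in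
     [sqr_series_bound]. *)
  move=> hrho; pose r := (`|h| + rho) / 2.
  have hr : `|h| < r by rewrite /r; lra.
  have r0 : 0 < r := le_lt_trans (normr_ge0 h) hr.
  have [|M HM] := sqr_series_bound c0 (r := r) _ cB.
    by rewrite r0 /r; lra.
  have cDT : cvgn (series (DT h)).
    apply: (@normed_cvg _ R^o); apply: nondecreasing_is_cvgn.
      by apply: nondecreasing_series => ? _ _; exact: normr_ge0.
    exists (`|v| / r * M) => _ [n _ <-]; rewrite -[leLHS]/(\sum_(0 <= j < n) `|DT h j|) big_mkord.
    apply: (@le_trans _ _ (\sum_(j < n) `|v| / r * (j.+1%:R ^+ 2 * c j.+1 * r ^+ j.+1))).
      apply: ler_sum => j _; apply: le_trans (DTle h j r r0 (ltW hr)) _.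
      have -> : `|v| / r * (j.+1%:R ^+ 2 * c j.+1 * r ^+ j.+1) =
          j.+1%:R ^+ 2 * (c j.+1 * `|v| * r ^+ j).
        by rewrite [r ^+ j.+1]exprS; field; rewrite gt_eqF.
      rewrite (_ : j.+1%:R * _ * _ * _ = j.+1%:R * (c j.+1 * `|v| * r ^+ j)); last by ring.
      apply: ler_wpM2r; last by rewrite expr2 ler_peMl// ler1n.
      by apply: mulr_ge0; rewrite ?mulr_ge0// exprn_ge0// ltW.
    rewrite -mulr_sumr; apply: (ler_wpM2l (divr_ge0 (normr_ge0 v) (ltW r0))).
    apply: le_trans (HM n.+1); rewrite big_ord_recl lerDr.
    by rewrite expr2 !mul0r.
  exists (limn (series (DT h))) => //.
  set D := limn _.
  (* For such t the point h + t v stays in the ball of radius r; the summand 1 covers v = 0. *)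
  apply: (@is_derive_quadratic _ _ _ _ ((`|v| / r) ^+ 2 * M) ((r - `|h|) / (`|v| + 1))).
    by rewrite divr_gt0 ?subr_gt0// ltr_wpDl.
  have v1 : 0 < `|v| + 1 by rewrite ltr_wpDl.
  move=> t te.
  have htr : `|h + t *: v| <= r.
    apply: le_trans (ler_normD _ _) _; rewrite -lerBrDl normrZ.
    move: te; rewrite (ltr_pdivlMr _ _ v1) => te.
    by apply: le_trans (ltW te); rewrite ler_wpM2l// lerDl.
  have htrho : `|h + t *: v| < rho.
    by apply: le_lt_trans htr _; rewrite /r; lra.
  (* The derivative term of index j comes from degree j + 1, so n of them match n + 1 terms of the
     series of f. *)
  pose u (n : nat) : R^o := series (fun j => T (nseq j (h + t *: v))) n.+1 -
    series (fun j => T (nseq j h)) n.+1 - t * series (DT h) n.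
  have cu : u @ \oo --> (f (y + h + t *: v) - f (y + h) - t * D : R^o).
    apply: cvgB; last by apply: cvgMr => //; exact: cDT.
    apply: cvgB; first by rewrite -addrA cvg_shiftS; exact: Tf.
    by rewrite cvg_shiftS; exact: Tf.
  apply: (@real_norm_cvg_le R RealScalars R^o u _ _ cu) => n.
  rewrite /real_norm /= /u /series/= !big_mkord.
  have -> : t * (\sum_(j < n) DT h j) =
      \sum_(j < n.+1) j%:R * T (t *: v :: nseq j.-1 h).
    rewrite big_ord_recl/= mul0r add0r mulr_sumr; apply: eq_bigr => j _.
    by rewrite /DT (symm_multilinearZ _ _ _ mT)/= mulrCA.
  rewrite -sumrB -sumrB; apply: le_trans (ler_norm_sum _ _ _) _.
  apply: (@le_trans _ _ (\sum_(j < n.+1) (`|t| ^+ 2 * (`|v| / r) ^+ 2) * (j%:R ^+ 2 * c j * r ^+ j))).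
    apply: ler_sum => j _.
    have := increment2_le mT c0 Tc r0 (ltW hr) htr j [::].
    rewrite /= big_nil mulr1 => /le_trans; apply.
    rewrite normrZ le_eqVlt; apply/orP; left; apply/eqP.
    by rewrite !exprMn; ring.
  rewrite -mulr_sumr mulrC -normrX ger0_norm ?sqr_ge0//.
  rewrite [_ * (`|v| / r) ^+ 2]mulrC mulrA ler_wpM2r ?sqr_ge0// mulrC.
  by rewrite ler_wpM2l ?sqr_ge0.
split.
  by exists rho => // h /main[D _ [? _]].
have r0 : 0 < rho / 2 by rewrite divr_gt0.
have [|M HM] := sqr_series_bound c0 (r := rho / 2) _ cB; first by lra.
exists (rho / 2), (fun j => j.+1%:R * c j.+1 * `|v|), (`|v| / (rho / 2) * M); split => //.
- by move=> j; rewrite !mulr_ge0.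
- move=> s; rewrite /real_norm/= normrM ger0_norm// -!mulrA ler_wpM2l//.
  by apply: le_trans (Tc _) _; rewrite big_cons.
- move=> n.
  apply: (@le_trans _ _ (\sum_(j < n) `|v| / (rho / 2) * (j.+1%:R ^+ 2 * c j.+1 * (rho / 2) ^+ j.+1))).
    apply: ler_sum => j _.
    have -> : `|v| / (rho / 2) * (j.+1%:R ^+ 2 * c j.+1 * (rho / 2) ^+ j.+1) =
        j.+1%:R ^+ 2 * (c j.+1 * `|v| * (rho / 2) ^+ j).
      by rewrite [(rho / 2) ^+ j.+1]exprS; field; rewrite gt_eqF.
    rewrite (_ : j.+1%:R * _ * _ * _ = j.+1%:R * (c j.+1 * `|v| * (rho / 2) ^+ j)); last by ring.
    apply: ler_wpM2r; last by rewrite expr2 ler_peMl// ler1n.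
    by apply: mulr_ge0; rewrite ?mulr_ge0// exprn_ge0// ltW.
  rewrite -mulr_sumr; apply: (ler_wpM2l (divr_ge0 (normr_ge0 v) (ltW r0))).
  apply: le_trans (HM n.+1); rewrite big_ord_recl lerDr.
  by rewrite expr2 !mul0r.
- move=> h hr; have [|D cD dD] := main h; first by lra.
  rewrite derive_val (_ : (fun j => _) = DT h)//.
  by apply/funext => j; rewrite size_nseq.
Qed.

(** The last vector of the word is the first one differentiated along, so induction from the inside
    works on reversed words. *)
Lemma iter_derive_rcons f vs v :
  iter_derive f (rcons vs v) = iter_derive ('D_v f) vs.
Proof. by elim: vs => //= w vs ->. Qed.

Lemma symm_multilinear_derive T v : symm_multilinear T ->
  symm_multilinear (fun s => (size s).+1%:R * T (v :: s)).
Proof.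
move=> [lT sT]; split=> [a x x' t|t t' tt'] /=.
  have sw z : T [:: v, z & t] = T [:: z, v & t].
    by apply: sT; apply/seq.permP => P /=; rewrite addnCA.
  by rewrite !sw lT /= mulrDr scalerAr.
by rewrite (perm_size tt'); congr (_ * _); apply: sT; rewrite perm_cons.
Qed.

(** Each differentiation moves one vector into the coefficient and multiplies by its degree;
    evaluating at the centre collects these factors into a factorial. *)
Lemma expands_iter_derive f y T s : symm_multilinear T -> expands f y T ->
  iter_derive f (rev s) y = (size s)`!%:R * T s.
Proof.
elim: s f T => [|v s ih] f T mT fT.
  by rewrite fact0 mul1r (expands_center mT fT).
have [_ fT'] := expands_derive v mT fT.
rewrite rev_cons iter_derive_rcons (ih _ _ (symm_multilinear_derive v mT) fT').
by rewrite /= factS natrM -mulrA mulrCA mulrA.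
Qed.

(* Taylor coefficients are determined by their values on a basis. *)
Lemma expands_eq0 q (e : 'I_q -> Y) f y T : symm_multilinear T -> expands f y T ->
  (forall w : seq 'I_q, iter_derive f (map e w) y = 0) ->
  exists2 rho : R, 0 < rho & forall u : 'I_q -> R,
    `|\sum_i u i *: e i| < rho -> f (y + \sum_i u i *: e i) = 0.
Proof.
move=> mT fT w0.
have Tw (w : seq 'I_q) : T (map e w) = 0.
  have := expands_iter_derive (map e w) mT fT.
  rewrite -map_rev w0 => /esym/eqP; rewrite mulf_eq0 pnatr_eq0.
  by rewrite -leqn0 leqNgt fact_gt0 => /eqP.
have lsum (F : 'I_q -> Y) s : T (\sum_i F i :: s) = \sum_i T (F i :: s).
  elim/big_ind2 : _ => [|a a' b b' <- <-|//].
    exact: (symm_multilinear0 _ mT).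
  exact: (symm_multilinearD _ _ _ mT).
(* Only combinations of the e i are inserted, so nothing is claimed in the other directions of Y.
   The word w collects the basis vectors already expanded. *)
have Tu (u : 'I_q -> R) j (w : seq 'I_q) :
    T (nseq j (\sum_i u i *: e i) ++ map e w) = 0.
  elim: j w => [|j ih] w; first exact: Tw.
  rewrite /= lsum big1// => i _; rewrite (symm_multilinearZ _ _ _ mT).
  have [_ sT] := mT.
  rewrite (sT _ (nseq j (\sum_i u i *: e i) ++ map e (i :: w))) ?ih ?scaler0//=.
  by rewrite -cat_cons -cat_rcons perm_cat2r perm_sym perm_rcons.
have [rho [c [B [rho0 c0 Tc cB Tf]]]] := fT.
exists rho => // u ur.
have := Tf _ ur; rewrite (_ : series _ = cst 0).
  by move=> cv; apply: (@cvg_unique _ (@norm_hausdorff _ R^o) (cst (0 : R^o) @ \oo)) => //; exact: cvg_cst.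
apply/funext => n; rewrite /series/= big1_seq// => j _.
by have := Tu u j [::]; rewrite cats0.
Qed.

Definition analytic_at f y := exists2 T, symm_multilinear T & expands f y T.

Lemma analytic_at_derive f y v : analytic_at f y -> analytic_at ('D_v f) y.
Proof.
move=> [T mT fT]; have [_ fT'] := expands_derive v mT fT.
by eexists; [exact: symm_multilinear_derive v mT|exact: fT'].
Qed.

Lemma analytic_at_iter_derive f y vs : analytic_at f y -> analytic_at (iter_derive f vs) y.
Proof. by move=> fy; elim: vs => //= v vs ih; exact: analytic_at_derive. Qed.

Lemma analytic_at_derivable f y v : analytic_at f y -> derivable f y v.
Proof.
move=> [T mT fT]; have [[rho rho0 H] _] := expands_derive v mT fT.
by rewrite -[y]addr0; apply: H; rewrite normr0.
Qed.

Lemma analytic_at_calm f y : analytic_at f y ->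
  exists (rho L : R), [/\ 0 < rho, 0 <= L & forall h, `|h| < rho ->
    `|f (y + h) - f y| <= L * `|h|].
Proof.
move=> [T mT fT]; have [rho [L [rho0 L0 H]]] := expands_calm mT fT.
by exists rho, L; split => // h /H; rewrite (expands_center mT fT).
Qed.

Lemma analytic_at_continuous f y : analytic_at f y -> {for y, continuous f}.
Proof.
move=> /analytic_at_calm[rho [L [rho0 L0 H]]]; apply/cvgrPdist_le => e e0.
have d0 : 0 < Num.min rho (e / (L + 1)).
  by rewrite lt_min rho0 divr_gt0// ltr_wpDl.
apply/nbhs_normP; exists (Num.min rho (e / (L + 1))) => //= y'.
rewrite /ball_/= lt_min distrC => /andP[h1 h2].
rewrite distrC -[y'](subrKC y) (le_trans (H _ h1))//.
apply: (@le_trans _ _ ((L + 1) * `|y' - y|)); first by rewrite ler_wpM2r// lerDl.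
by rewrite mulrC -ler_pdivlMr ?ltr_wpDl// ltW.
Qed.

Lemma invS_lt_eventually (e : R) : 0 < e -> exists n : nat, forall m, (n <= m)%N -> m.+1%:R^-1 < e.
Proof.
move=> e0; exists (Num.truncn e^-1) => m nm.
rewrite invf_plt ?posrE ?ltr0n//.
have ei : 0 < e^-1 by rewrite invr_gt0.
have /andP[_ lt] := Num.Theory.truncn_itv (ltW ei).
by apply: lt_le_trans lt _; rewrite ler_nat ltnS.
Qed.

(** The local data of f at y are compressed into one natural number, so that regularity comes in
    countably many grades with uniform constants. *)
Lemma analytic_regular (U : set Y) f y v : open U -> (forall x, U x -> analytic_at f x) ->
  U y -> 'D_v f y != 0 -> exists L : nat,
    (forall y', `|y' - y| <= L.+1%:R^-1 -> U y' /\ L.+1%:R^-1 <= `|'D_v f y'|) /\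
    (forall h, `|h| <= L.+1%:R^-1 -> `|f (y + h) - f y| <= L.+1%:R * `|h|).
Proof.
move=> oU fU Uy Dy.
have [rho [C [rho0 C0 H]]] := analytic_at_calm (fU y Uy).
have cD := analytic_at_continuous (analytic_at_derive v (fU y Uy)).
have Dpos : 0 < `|'D_v f y| / 2 by rewrite divr_gt0// normr_gt0.
have := cD; move=> /cvgrPdist_lt /(_ _ Dpos) nD.
have nU : nbhs y U by exact: open_nbhs_nbhs.
have Z : nbhs y ([set t | `|'D_v f y - 'D_v f t| < `|'D_v f y| / 2] `&` U).
  by apply: filterI.
move/nbhs_ballP : Z => [d /= d0 dsub].
have [n1 Hn1] := invS_lt_eventually d0.
have [n2 Hn2] := invS_lt_eventually Dpos.
have [n3 Hn3] := invS_lt_eventually rho0.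
(* The four entries take care of the ball inside U, the lower bound for the derivative, the radius
   of the Lipschitz estimate and its constant. *)
pose L := maxn (maxn n1 n2) (maxn n3 (Num.truncn C)).
have L1 : (n1 <= L)%N by rewrite /L !leq_max leqnn.
have L2 : (n2 <= L)%N by rewrite /L !leq_max leqnn orbT.
have L3 : (n3 <= L)%N by rewrite /L !leq_max leqnn !orbT.
have L4 : (Num.truncn C <= L)%N by rewrite /L !leq_max leqnn !orbT.
exists L; split=> [y' yy'|h hL].
  have : ball y d y' by rewrite -ball_normE /ball_/= distrC (le_lt_trans yy')// Hn1.
  move=> /dsub[Dy' Uy']; split=> //.
  apply: (le_trans (ltW (Hn2 _ L2))).
  have : `|'D_v f y| <= `|'D_v f y - 'D_v f y'| + `|'D_v f y'|.
    by have := ler_normD ('D_v f y - 'D_v f y') ('D_v f y'); rewrite subrK.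
  by move: Dy' => /=; lra.
apply: le_trans (H h _) _; first by rewrite (le_lt_trans hL)// Hn3.
rewrite ler_wpM2r//; have /andP[_ /ltW CL] := Num.Theory.truncn_itv C0.
by apply: (le_trans CL); rewrite ler_nat ltnS.
Qed.

End analytic_derivatives.

(** * Sparse vectors *)

Section sparse_parameters.
Variables (R : realType) (X : normedModType R) (d : nat) (e : 'I_d -> X) (s : nat).
Implicit Types (sg : {ffun 'I_s -> 'I_d}) (p : 'rV[R]_(s + s)).

(** The two vectors of a pair use the two halves of p. The index map may repeat an index, which
    accommodates supports smaller than s. *)
Definition lparam sg p : X := \sum_i p 0 (lshift s i) *: e (sg i).
Definition rparam sg p : X := \sum_i p 0 (rshift s i) *: e (sg i).

Lemma sparse_combination x : (0 < s <= d)%N -> sparse e s x ->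
  exists sg (b : 'I_s -> R), x = \sum_i b i *: e (sg i).
Proof.
move=> /andP[s0 sd] [I /= Is [n [c [v [vI ->]]]]].
(* This index pads the enumeration of a support with fewer than s elements. *)
have i0 : 'I_d := Ordinal (leq_trans s0 sd).
pose sg : {ffun 'I_s -> 'I_d} := [ffun k : 'I_s => nth i0 (enum I) k].
exists sg.
elim/big_ind : _ => [|u u' [b ->] [b' ->]|l _].
- by exists (fun=> 0); rewrite big1// => i _; rewrite scale0r.
- exists (fun i => b i + b' i); rewrite -big_split/=.
  by apply: eq_bigr => i _; rewrite scalerDl.
- have [i /= iI vE] := vI l.
  have ik : (index i (enum I) < s)%N.
    by apply: leq_trans Is; rewrite cardE index_mem mem_enum.
  exists (fun k => if k == Ordinal ik then c l else 0).
  rewrite (bigD1 (Ordinal ik))//= eqxx big1 ?addr0.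
    by rewrite -vE ffunE nth_index// mem_enum.
  by move=> k /negbTE ->; rewrite scale0r.
Qed.

Lemma sparse_pair x y : (0 < s <= d)%N -> sparse e s x -> sparse e s y ->
  exists sg sg' p, x = lparam sg p /\ y = rparam sg' p.
Proof.
move=> sd /(sparse_combination sd)[sg [b ->]] /(sparse_combination sd)[sg' [b' ->]].
exists sg, sg', (row_mx (\row_i b i) (\row_i b' i)); split.
  by apply: eq_bigr => i _; rewrite row_mxEl mxE.
by apply: eq_bigr => i _; rewrite row_mxEr mxE.
Qed.

Lemma lparam_linear sg a p p' : lparam sg (a *: p + p') = a *: lparam sg p + lparam sg p'.
Proof.
rewrite /lparam scaler_sumr -big_split/=; apply: eq_bigr => i _.
by rewrite !mxE scalerDl scalerA.
Qed.

Lemma rparam_linear sg a p p' : rparam sg (a *: p + p') = a *: rparam sg p + rparam sg p'.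
Proof.
rewrite /rparam scaler_sumr -big_split/=; apply: eq_bigr => i _.
by rewrite !mxE scalerDl scalerA.
Qed.

Lemma rV_coord_le n (p : 'rV[R]_n) i : `|p 0 i| <= `|p|.
Proof.
rewrite [leRHS]/Num.norm/= mx_normrE.
exact: (le_bigmax _ (fun ij => `|p ij.1 ij.2|) (0, i)).
Qed.

Lemma param_bound sg : exists2 C : R, 0 < C & forall p,
  `|lparam sg p| <= C * `|p| /\ `|rparam sg p| <= C * `|p|.
Proof.
exists (1 + \sum_i `|e (sg i)|).
  by rewrite ltr_pwDl// sumr_ge0.
move=> p; rewrite mulrDl mul1r mulr_suml; split.
  apply: ler_wpDl => //; apply: le_trans (ler_norm_sum _ _ _) _.
  by apply: ler_sum => i _; rewrite normrZ mulrC ler_wpM2l// rV_coord_le.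
apply: ler_wpDl => //; apply: le_trans (ler_norm_sum _ _ _) _.
by apply: ler_sum => i _; rewrite normrZ mulrC ler_wpM2l// rV_coord_le.
Qed.

Lemma lparam_span sg p : lin_span (range e) (lparam sg p).
Proof. by exists s, (fun i => p 0 (lshift s i)), (fun i => e (sg i)); split=> // i; exists (sg i). Qed.

Lemma rparam_span sg p : lin_span (range e) (rparam sg p).
Proof. by exists s, (fun i => p 0 (rshift s i)), (fun i => e (sg i)); split=> // i; exists (sg i). Qed.

(** Common to both architectures: there are finitely many pairs of index maps, and for each of them
    the parameter p has 2s < M coordinates. *)
Lemma recovery_of_thin (A V : set X) (K : Type) dZ (Z : measurableType dZ)
    (nu : set Z -> \bar R) (m : X -> Z -> K) (M : nat) :
  (0 < s <= d)%N -> (s + s < M)%N -> V = lin_span (range e) ->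
  (forall sg sg', exists (I : countType) (S : I -> 'rV[R]_(s + s) -> set Z),
     (forall l, thin nu (S l)) /\
     forall p z, (A `&` V) (lparam sg p) -> (A `&` V) (rparam sg' p) ->
       lparam sg p <> rparam sg' p -> m (lparam sg p) z = m (rparam sg' p) z ->
       exists l, S l p z) ->
  almost_sure_recovery (A `&` sparse e s) nu m M.
Proof.
move=> sd sM VE H dO Omega P z iid.
apply: (@negligibleS _ _ _ _ (\bigcup_(ss : {ffun 'I_s -> 'I_d} * {ffun 'I_s -> 'I_d})
  [set w | exists p, [/\ (A `&` V) (lparam ss.1 p), (A `&` V) (rparam ss.2 p),
     lparam ss.1 p <> rparam ss.2 p &
     forall i, m (lparam ss.1 p) (z i w) = m (rparam ss.2 p) (z i w)]])).
  move=> w /= /existsNP[a1 /existsNP[a2 /not_implyP[[Aa1 sa1]]]].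
  move=> /not_implyP[[Aa2 sa2]] /not_implyP[maa a12].
  have [sg [sg' [p [E1 E2]]]] := sparse_pair sd sa1 sa2.
  exists (sg, sg') => //; exists p; split => /=; rewrite -?E1 -?E2//; split=> //.
    by rewrite VE E1; exact: lparam_span.
  by rewrite VE E2; exact: rparam_span.
apply: negligible_bigcup_count => -[sg sg'].
have [I [S [thS HS]]] := H sg sg'.
apply: negligibleS (thin_samples iid sM thS) => w /= [p [l r ne me]].
by exists p => i; apply: HS.
Qed.

End sparse_parameters.

(** * Measurability and densities *)

(** The product sigma-algebra contains countable unions of boxes; with sides taken from a countable
    base there are only countably many boxes to unite. *)
Lemma tuple_open_measurable d (T : measurableType d) (B : nat -> set T) r
    (O : set (r.-tuple T)) : (forall n, measurable (B n)) ->
  (forall z, O z -> exists f : {ffun 'I_r -> nat}, (forall i, B (f i) (tnth z i)) /\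
     forall z', (forall i, B (f i) (tnth z' i)) -> O z') ->
  measurable O.
Proof.
move=> mB HO.
pose box (f : {ffun 'I_r -> nat}) : set (r.-tuple T) :=
  \bigcap_(i in [set: 'I_r]) (fun z => tnth z i) @^-1` B (f i).
have mbox f : measurable (box f).
  apply: fin_bigcap_measurable => // i _.
  by rewrite -[X in measurable X]setTI; exact: measurable_tnth.
rewrite (_ : O = \bigcup_n (if unpickle n is Some f then
    (if `[< box f `<=` O >] then box f else set0) else set0)).
  apply: bigcup_measurable => n _; case: unpickle => // f; case: ifP => // _.
apply/seteqP; split=> [z Oz|z [n _]]; last first.
  by case: unpickle => // f; case: asboolP => // fO /fO.
have [f [fz fO]] := HO z Oz; exists (pickle f) => //; rewrite pickleK.
case: asboolP => [_ i _|[]]; first exact: fz.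
by move=> z' fz'; apply: fO => i; apply: fz'.
Qed.

Lemma separable_base (R : realType) (Z : normedModType R) : separable_space Z ->
  exists B : nat -> set Z, (forall n, open (B n)) /\
    forall z (e : R), 0 < e -> exists n, B n z /\ forall z', B n z' -> `|z' - z| < e.
Proof.
move=> [D cD dD].
have [z0 Dz0] : exists z0, D z0.
  have [|z [_ Dz]] := dD setT _ openT; last by exists z.
  by exists 0.
have [f fD] : exists f : nat -> Z, D `<=` range f.
  move/pfcard_geP : cD => [D0|[g]]; first by exists (fun=> 0); rewrite D0.
  by exists g; exact: (@surj _ _ _ _ g).
exists (fun n => if unpickle n is Some (i, j) then ball (f i) (j.+1%:R^-1) else set0).
split=> [n|z e e0].
  case: unpickle => [[i j]|]; [|exact: open0].
  by apply: ball_open; rewrite invr_gt0 ltr0n.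
have [j Hj] := invS_lt_eventually (divr_gt0 e0 (ltr0n R 2)).
have j0 : 0 < j.+1%:R^-1 :> R by rewrite invr_gt0 ltr0n.
have oB : open (ball z (j.+1%:R^-1 : R)) by exact: ball_open.
have [|y [yz /fD[i _ iy]]] := dD _ _ oB; first by exists z; exact: ballxx.
exists (pickle (i, j)); rewrite pickleK iy; split.
  exact: ball_sym.
move=> z'; move: yz; rewrite -!ball_normE /ball_/= => yz yz'.
rewrite -[z' - z](subrKA y) (le_lt_trans (ler_normD _ _))// [e]splitr ltrD//.
  by rewrite distrC (lt_trans yz')// Hj.
by rewrite distrC (lt_trans yz)// Hj.
Qed.

Lemma measurable_fun_itv_preimage d (T : measurableType d) (R : realType) (D : set T)
    (f : T -> R) : measurable D ->
  (forall a b : R, measurable (D `&` f @^-1` `]a, b[)) -> measurable_fun D f.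
Proof.
move=> mD H; apply: (measurability _ (RGenOpens.measurableE R)).
by move=> _ [_ [a [b ->] <-]]; exact: H.
Qed.

Section density_levels.
Context d (T : measurableType d) (R : realType).
Variables (nu : {finite_measure set T -> \bar R}).
Variables (mu : {sigma_finite_measure set T -> \bar R}).
Local Open Scope ereal_scope.

(* The sets where the density of [nu] is at most [n]. *)
Lemma dominated_levels : nu `<< mu -> exists D : nat -> set T,
  [/\ forall n, measurable (D n), forall x, exists n, D n x &
      forall n E, measurable E -> nu (E `&` D n) <= n%:R%:E * mu E].
Proof.
move=> numu; pose f := Radon_Nikodym_SigmaFinite.f nu mu.
have f0 : forall x, 0 <= f x by exact: Radon_Nikodym_SigmaFinite.f_ge0.
have ff : forall x, f x \is a fin_num by exact: Radon_Nikodym_SigmaFinite.f_fin_num.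
have mf : measurable_fun setT f.
  exact: measurable_int (Radon_Nikodym_SigmaFinite.f_integrable numu).
have mD n : measurable [set x | f x <= n%:R%:E].
  by rewrite -[X in measurable X]setTI; exact: emeasurable_fun_infty_c.
exists (fun n => [set x | f x <= n%:R%:E]); split=> // [x|n E mE].
  exists (Num.truncn (fine (f x))).+1; rewrite /= -(fineK (ff x)) lee_fin.
  have fx0 : (0 <= fine (f x))%R by rewrite fine_ge0.
  by have /andP[_ /ltW] := Num.Theory.truncn_itv fx0.
have mED := measurableI _ _ mE (mD n).
rewrite (Radon_Nikodym_SigmaFinite.f_integral numu mED).
apply: (@le_trans _ _ (\int[mu]_(x in E `&` [set x | f x <= n%:R%:E]) (cst n%:R%:E) x)).
  apply: ge0_le_integral => //.
  - exact: measurable_funTS.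
  - by move=> x [].
rewrite integral_cst//; apply: lee_wpmul2l; first by rewrite lee_fin.
by apply: le_measure; rewrite ?inE.
Qed.

End density_levels.

Lemma finite_image_measure d d' (T : measurableType d) (T' : measurableType d')
    (R : realType) (mu : {finite_measure set T -> \bar R}) (D : set T) (f : T -> T') :
  measurable D -> measurable_fun setT f ->
  exists nu : {finite_measure set T' -> \bar R},
    forall E, nu E = mu (D `&` f @^-1` E).
Proof.
move=> mD mf; pose nu E := mu (D `&` f @^-1` E).
have mDf E : measurable E -> measurable (D `&` f @^-1` E).
  by move=> mE; apply: measurableI => //; rewrite -[X in measurable X]setTI; exact: mf.
have nu0 : nu set0 = 0%E by rewrite /nu preimage_set0 setI0 measure0.
have nu_ge0 A : (0 <= nu A)%E by exact: measure_ge0.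
have nu_sig : semi_sigma_additive nu.
  move=> F mF tF mUF; rewrite /nu preimage_bigcup setI_bigcupr.
  apply: measure_semi_sigma_additive.
  - by move=> i; exact: mDf.
  - apply/trivIsetP => /= i j _ _ ij; rewrite setIACA -preimage_setI.
    by move/trivIsetP : tF => /(_ i j Logic.I Logic.I ij) ->; rewrite preimage_set0 setI0.
  - by rewrite -setI_bigcupr -preimage_bigcup; exact: mDf.
pose nu1 : {measure set T' -> \bar R} :=
  HB.pack nu (isMeasure.Build _ _ _ nu nu0 nu_ge0 nu_sig).
have fin : fin_num_fun nu.
  by move=> E mE; apply: fin_num_measure; exact: mDf.
pose nu2 : {finite_measure set T' -> \bar R} :=
  HB.pack nu (Measure.class nu1) (Measure_isFinite.Build _ _ _ nu1 fin).
by exists nu2.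
Qed.

(** * Charts *)

(** The mean value theorem on the segment expresses the increment by one value of the derivative, so
    a lower bound on its modulus is enough. *)
Lemma derive_norm_mvt (R : realType) (Y : normedModType R) (f : Y -> R^o) (y v : Y)
    (t k : R) : 0 <= t ->
  (forall s, 0 <= s <= t -> derivable f (y + s *: v) v /\
     k <= `|'D_v f (y + s *: v)|) ->
  k * t <= `|f (y + t *: v) - f y|.
Proof.
move=> t0 H; pose F (s : R) : R := f (y + s *: v).
have dq (s : R) : (fun h : R => h^-1 *: ((F \o shift s) (h *: (1 : R)) - F s)) =
    (fun h => h^-1 *: ((f \o shift (y + s *: v)) (h *: v) - f (y + s *: v))).
  apply/funext => h; rewrite /F /=; congr (_ *: (f _ - _)).
  by rewrite [h *: 1]mulr1 scalerDl addrCA.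
have dF (s : R) : 0 <= s <= t -> is_derive s (1 : R) F ('D_v f (y + s *: v)).
  move=> /H[ds _]; split; first by rewrite /derivable dq.
  by rewrite /derive dq.
have [||c] := @MVT_segment R F (fun s => 'D_v f (y + s *: v)) 0 t t0.
- by move=> s; rewrite in_itv/= => /andP[s0 st]; apply: dF; rewrite !ltW.
- apply: derivable_within_continuous => s; rewrite in_itv/= => /dF.
  by case.
rewrite in_itv/= /F scale0r addr0 subr0 => cI ->.
by rewrite normrM [`|t|]ger0_norm// ler_wpM2r//; have [] := H c cI.
Qed.

Section rows.
Variables (R : realType) (q : nat).

Definition tuple_of (x : 'rV[R]_q) : q.-tuple R := [tuple x 0 j | j < q].

Lemma tuple_ofK : cancel tuple_of (@row_of R q).
Proof. by move=> x; apply/rowP => j; rewrite mxE tnth_mktuple. Qed.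

Lemma row_ofK : cancel (@row_of R q) tuple_of.
Proof. by move=> t; apply: eq_from_tnth => j; rewrite tnth_mktuple mxE. Qed.

Lemma rV_norm_lt (x : 'rV[R]_q) (e : R) : 0 < e -> (forall i, `|x 0 i| < e) -> `|x| < e.
Proof.
move=> e0 H; rewrite [ltLHS]/Num.norm/= mx_normrE.
by apply/bigmax_ltP; split => // -[i j] _ /=; rewrite ord1.
Qed.

Lemma rV_norm_le (x : 'rV[R]_q) (e : R) : 0 <= e -> (forall i, `|x 0 i| <= e) -> `|x| <= e.
Proof.
move=> e0 H; rewrite [leLHS]/Num.norm/= mx_normrE.
by apply/bigmax_leP; split => // -[i j] _ /=; rewrite ord1.
Qed.

(** Topology is carried by rows and measure by tuples; this is the bridge. *)
Lemma row_of_open_measurable (O : set 'rV[R]_q) : open O ->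
  measurable (@row_of R q @^-1` O).
Proof.
move=> oO.
have sR : separable_space R^o.
  by exists (@ratr R @` setT); [|exact: dense_rat]; apply: sub_countable (card_image_le _ _) (countableP _).
have [B [oB HB]] := separable_base sR.
apply: (@tuple_open_measurable _ R B) => [n|t Ot].
  exact: (@open_measurable R _ (oB n)).
have /nbhs_ballP[e /= e0 eO] : nbhs (row_of t) O by exact: open_nbhs_nbhs.
have /choice[f Hf] : forall i, exists n, B n (tnth t i) /\
    forall z', B n z' -> `|z' - tnth t i| < e by move=> i; exact: HB.
exists [ffun i => f i]; split=> [i|t' Ht']; first by rewrite ffunE; case: (Hf i).
apply: eO; rewrite -ball_normE /ball_/= distrC; apply: rV_norm_lt => // i.
by rewrite !mxE; have [_] := Hf i; apply; have := Ht' i; rewrite ffunE.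
Qed.

End rows.

(** A line parallel to axis j meets S inside an interval of length 2 dl around any of its points in
    S; Fubini over the other q coordinates gives the rest. *)
Lemma lebesgue_slab (R : realType) q (S : set 'rV[R]_q.+1) (j : 'I_q.+1) (K dl : R) :
  0 <= K -> 0 <= dl -> measurable (@row_of R q.+1 @^-1` S) ->
  (forall x, S x -> forall i, `|x 0 i| <= K) ->
  (forall x y, S x -> S y -> (forall i, i != j -> x 0 i = y 0 i) -> `|x 0 j - y 0 j| <= dl) ->
  (tuple_measure (@lebesgue_measure R) q.+1 (@row_of R q.+1 @^-1` S)
    <= ((2 * dl) * (2 * K) ^+ q)%:E)%E.
Proof.
move=> K0 dl0 mS SK Sj.
have itv (a b : R) : a <= b -> lebesgue_measure `[a, b] = (b - a)%:E.
  move=> ab; rewrite lebesgue_measure_itv/= lte_fin; case: ltP => // ba.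
  have -> : b = a by apply/eqP; rewrite eq_le ab ba.
  by rewrite subrr.
apply: (@tuple_measure_slice _ _ R (@lebesgue_measure R) q j (`[- K, K]%classic)) => //.
- exact: mulr_ge0.
- exact: mulr_ge0.
- pose I : set R := `[- K, K]%classic.
  have E : (lebesgue_measure I <= (2 * K)%:E)%E.
    by rewrite itv; [rewrite lee_fin; lra|lra].
  exact: E.
- move=> t /SK tK i; have := tK i; rewrite mxE ler_norml /=.
  by rewrite in_itv.
move=> z; set D := [set t | _].
have mD : measurable D.
  by rewrite -[X in measurable X]setTI; exact: (tupd_measurable z j).
have [[t0 Dt0]|D0] := pselect (exists t, D t); last first.
  rewrite (_ : D = set0) ?measure0 ?lee_fin ?mulr_ge0//.
  by rewrite -subset0 => t Dt; apply: D0; exists t.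
pose I : set R := `[t0 - dl, t0 + dl]%classic.
have mI : measurable I by exact: measurable_itv.
apply: (@le_trans _ _ (lebesgue_measure I)).
  apply: le_measure; [exact/mem_set|exact/mem_set|move=> t Dt /=].
  have := Sj _ _ Dt Dt0; rewrite !mxE !tnth_mktuple eqxx.
  rewrite /I /= in_itv/= -ler_distl; apply => i ij.
  by rewrite !mxE !tnth_mktuple (negbTE ij).
by rewrite itv; [rewrite lee_fin; lra|lra].
Qed.

Section chart_measure.
Variables (R : realType) (Z : ptopologicalType) (q : nat) (c : chart R Z q).
Hypothesis chc : is_chart c.

Lemma chart_preimage_open (O : set 'rV[R]_q) : open O ->
  open (chart_dom c `&` chart_map c @^-1` O).
Proof.
have [oD oI mK cM cI] := chc => oO.
rewrite openE => z [Dz Oz]; rewrite /interior.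
move: cM; rewrite continuous_open_subspace// => /(_ z); rewrite inE => /(_ Dz) cz.
apply: filterI; first exact: open_nbhs_nbhs.
by apply: cz; exact: open_nbhs_nbhs.
Qed.

Lemma borel_open_measurable (O : set (borel Z)) : @open Z O -> measurable O.
Proof. by move=> oO; exact: sub_sigma_algebra. Qed.

(** The value 0 outside the chart makes the map total and measurable; the estimates always intersect
    with [chart_dom]. *)
Definition chart_tuple (z : borel Z) : q.-tuple R :=
  tuple_of (if `[< chart_dom c z >] then chart_map c z else 0).

Lemma measurable_chart_tuple : measurable_fun setT chart_tuple.
Proof.
have [oD _ _ _ _] := chc.
apply/measurable_fun_tnthP => i; apply: measurable_fun_itv_preimage => // a b.
rewrite setTI.
have oab : open ([set x : 'rV[R]_q | x 0 i \in `]a, b[]).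
  apply: (@open_comp _ _ (fun x : 'rV[R]_q => x 0 i) `]a, b[%classic).
    by move=> x _; exact: coord_continuous.
  exact: interval_open.
have -> : (@tnth q R ^~ i \o chart_tuple) @^-1` `]a, b[ =
    (chart_dom c `&` chart_map c @^-1` [set x | x 0 i \in `]a, b[ ]) `|`
    (~` chart_dom c `&` [set z | (0 : R) \in `]a, b[ ]).
  apply/seteqP; split => [z|z].
    rewrite /= /chart_tuple tnth_mktuple; case: asboolP => Dz h; [left|right] => //.
    by split => //; move: h; rewrite mxE.
  rewrite /= /chart_tuple tnth_mktuple => -[[Dz h]|[Dz h]]; case: asboolP => //.
  by rewrite mxE.
apply: measurableU.
  by apply: borel_open_measurable; exact: chart_preimage_open.
apply: measurableI.
  by apply: measurableC; exact: borel_open_measurable.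
by have [h|h] := boolP ((0 : R) \in `]a, b[); [rewrite (_ : [set _ | _] = setT)|rewrite (_ : [set _ | _] = set0)]; rewrite ?predeqE//; move=> z; split.
Qed.

Lemma chart_tupleE z : chart_dom c z -> chart_tuple z = tuple_of (chart_map c z).
Proof. by move=> Dz; rewrite /chart_tuple; case: asboolP. Qed.

(** The law of the chart coordinates is dominated by Lebesgue measure: a Lebesgue null set has zero
    volume in the chart, hence zero probability. The levels are those of the resulting density. *)
Lemma chart_levels (vol : {measure set (borel Z) -> \bar R})
    (mu : probability (borel Z) R) (rho : 'rV[R]_q -> R) :
  smooth_on (chart_img c) rho ->
  (forall B : set (borel Z), measurable B -> B `<=` chart_dom c ->
     vol B = (\int[tuple_measure (@lebesgue_measure R) q]_(t in
                     @row_of R q @^-1` (chart_map c @` B)) (rho (row_of t))%:E)%E) ->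
  mu `<< vol ->
  exists D : nat -> set (q.-tuple R), [/\ forall n, measurable (D n),
    forall t, exists n, D n t &
    forall n E, measurable E ->
      (mu (chart_dom c `&` chart_tuple @^-1` (E `&` D n)) <=
       n%:R%:E * tuple_measure (@lebesgue_measure R) q E)%E].
Proof.
have [oD oI mK cM cI] := chc => srho volE muvol.
have mD : measurable (chart_dom c : set (borel Z)) by exact: borel_open_measurable.
have [la laE] := tuple_measureE (@lebesgue_measure R) q.
have [nu nuE] := @finite_image_measure _ _ (borel Z)
  (q.-tuple (g_sigma_algebraType (R.-ocitv.-measurable)))%type
  R mu (chart_dom c) chart_tuple mD measurable_chart_tuple.
have nula : nu `<< la.
  apply/null_content_dominatesP => E mE E0; rewrite nuE.
  pose B : set (borel Z) := chart_dom c `&` chart_tuple @^-1` E.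
  have mB : measurable B.
    apply: measurableI => //; rewrite -[X in measurable X]setTI.
    exact: measurable_chart_tuple.
  move/null_content_dominatesP : muvol; apply => //.
  apply: (etrans (volE B mB _)); first by move=> z [].
  have imgE : @row_of R q @^-1` (chart_map c @` B) = E `&` @row_of R q @^-1` chart_img c.
    apply/seteqP; split=> [t [z [Dz Ez] zt]|t [Et [z Dz zt]]].
      split; last by exists z.
      by move: Ez; rewrite /= chart_tupleE// zt row_ofK.
    by exists z => //; split => //; rewrite /= chart_tupleE// zt row_ofK.
  rewrite imgE laE.
  have mI := row_of_open_measurable oI.
  have mEI : measurable (E `&` @row_of R q @^-1` chart_img c) by exact: measurableI.
  apply: null_set_integral => //; last first.
    apply/eqP; rewrite eq_le measure_ge0 andbT -E0.
    by apply: le_measure; rewrite ?inE.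
  apply: measurable_funS (mI) _ _; first by move=> t [].
  apply/measurable_EFinP; apply: measurable_fun_itv_preimage => // a b.
  have -> : @row_of R q @^-1` chart_img c `&` (fun t => rho (row_of t)) @^-1` `]a, b[ =
     @row_of R q @^-1` (chart_img c `&` rho @^-1` `]a, b[%classic) by [].
  apply: row_of_open_measurable; rewrite openE => x [Ix rx]; rewrite /interior.
  apply: filterI; first exact: open_nbhs_nbhs.
  (* The empty word of derivatives gives the continuity of rho itself. *)
  have [crho _] := srho [::] x Ix.
  have oab : @open R (`]a, b[%classic : set R) by exact: interval_open.
  by apply: (crho (`]a, b[%classic)); exact: open_nbhs_nbhs.
have [D [mDn Dx Dle]] := dominated_levels nula.
exists D; split => // n E mE.
by have := Dle n E mE; rewrite nuE laE.
Qed.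

End chart_measure.

(** * Strata for analytic sampling *)

Section scalar_parts.
Variables (R : realType) (k : scalars).
Local Notation K := (scalar_field R k).

(** The mean value theorem and Gaussian laws concern real functions, so scalars are split into real
    components; for real scalars both values of b give the identity. *)
Definition part (b : bool) : K -> R :=
  match k with
  | RealScalars => id
  | ComplexScalars => fun z => if b then complex.Im z else complex.Re z
  end.

Lemma part_linear b a (x y : K) : part b (of_real k a * x + y) = a * part b x + part b y.
Proof.
rewrite /part; case: k x y => //= -[x1 x2] [y1 y2].
by case: b => /=; ring.
Qed.

Lemma part0 b : part b 0 = 0.
Proof. by rewrite /part; case: k => //; case: b. Qed.

Lemma part_le b (x : K^o) : `|part b x| <= real_norm x.
Proof.
rewrite /part /real_norm; case: k x => //= z.
suff : `|if b then complex.Im z else complex.Re z| <= complex.Re (`|z : R[i]|) by [].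
by rewrite normc_def /=; case: b; rewrite -sqrtr_sqr ler_wsqrtr// ?lerDl ?lerDr ?sqr_ge0.
Qed.

Lemma part_eq0 (x : K) : (forall b, part b x = 0) -> x = 0.
Proof.
rewrite /part; case: k x => /= [x /(_ true)//|[x y] H].
by have := H true; have := H false => /= -> ->.
Qed.

End scalar_parts.

Section strata.
Variables (R : realType) (N q : nat).
Local Notation Par := 'rV[R]_N.
Local Notation Y := (Par * 'rV[R]_q)%type.
Implicit Types (U : set Y) (h : Y -> R^o).

Definition axis (j : 'I_q) : Y := (0, delta_mx 0 j).

(** The side 1/(L+1) is the radius in [regular], so one regular point controls its whole cell. A
    cube also contains the segments along an axis between its points. *)
Definition cell (L : nat) (r : {ffun 'I_q -> int}) : set 'rV[R]_q :=
  [set x | forall i, (r i)%:~R <= L.+1%:R * x 0 i <= (r i)%:~R + 1].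

(** The lower bound on the derivative makes zero sets thin in direction j; the Lipschitz bound at y
    compares different parameters at the same chart point. *)
Definition regular U h j (L : nat) (y : Y) :=
  (forall y', `|y' - y| <= L.+1%:R^-1 -> U y' /\ L.+1%:R^-1 <= `|'D_(axis j) h y'|) /\
  (forall u, `|u| <= L.+1%:R^-1 -> `|h (y + u) - h y| <= L.+1%:R * `|u|).

Lemma pair_norm_le (p : Par) (x : 'rV[R]_q) (a : R) :
  `|p| <= a -> `|x| <= a -> `|(p, x) : Y| <= a.
Proof. by move=> pa xa; rewrite prod_normE/= ge_max pa xa. Qed.

Lemma cell_dist L r x y : cell L r x -> cell L r y -> `|x - y| <= L.+1%:R^-1.
Proof.
move=> cx cy; have L0 : 0 < L.+1%:R :> R by rewrite ltr0n.
apply: rV_norm_le => [|i]; first by rewrite invr_ge0 ltW.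
rewrite !mxE -(ler_pM2l L0) divff ?gt_eqF// -[X in X * `|_|]ger0_norm ?(ltW L0)//.
rewrite -normrM mulrBr; have /andP[? ?] := cx i; have /andP[? ?] := cy i.
by rewrite ler_norml; lra.
Qed.

Lemma cell_cover L x : exists r, cell L r x.
Proof.
exists [ffun i => Num.floor (L.+1%:R * x 0 i)] => i; rewrite ffunE.
by rewrite Num.Theory.floor_le_tmp/= -[1]/(1%:~R) -intrD ltW// Num.Theory.floorD1_gt.
Qed.

Lemma cell_bounded L r x i : cell L r x -> `|x 0 i| <= 1 + \sum_j `|(r j)%:~R : R|.
Proof.
move=> /(_ i)/andP[h1 h2]; have L0 : 0 < L.+1%:R :> R by rewrite ltr0n.
apply: (@le_trans _ _ (1 + `|(r i)%:~R : R|)); last first.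
  by rewrite lerD2l (bigD1 i)//= lerDl sumr_ge0.
have : `|L.+1%:R * x 0 i| <= 1 + `|(r i)%:~R : R|.
  have := ler_norm ((r i)%:~R : R); have := ler_norm (- (r i)%:~R : R).
  by rewrite normrN ler_norml => *; lra.
apply: le_trans; rewrite normrM ger0_norm ?(ltW L0)// ler_peMl// ler1n//.
Qed.

Lemma closed_cell L r : closed (cell L r).
Proof.
have L0 : 0 < L.+1%:R :> R by rewrite ltr0n.
move=> x clx i.
have H e : 0 < e -> exists2 y, cell L r y & `|L.+1%:R * x 0 i - L.+1%:R * y 0 i| <= e.
  move=> e0; have eL : 0 < e / L.+1%:R by rewrite divr_gt0.
  have [y [cy]] := clx _ (nbhsx_ballx x _ eL).
  rewrite -ball_normE /ball_/= => yx; exists y => //.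
  rewrite -mulrBr normrM ger0_norm ?(ltW L0)// mulrC -ler_pdivlMr//.
  by apply: le_trans (ltW yx); have := rV_coord_le (x - y) i; rewrite !mxE.
apply/andP; split; apply/ler_addgt0Pr => e /H[y /(_ i)/andP[h1 h2]].
  by rewrite ler_norml => /andP[? ?]; lra.
by rewrite ler_norml => /andP[? ?]; lra.
Qed.

Lemma closed_levels (C : set 'rV[R]_q) (f : 'rV[R]_q -> R^o) (e : R) : closed C ->
  (forall x, C x -> {for x, continuous f}) -> closed [set x | C x /\ `|f x| <= e].
Proof.
move=> cC cf x clx.
have Cx : C x by apply: cC => B nB; have [y [[Cy _] By]] := clx B nB; exists y.
split=> //; rewrite leNgt; apply/negP => ex.
have nx : nbhs x [set y | e < `|f y|].
  have d0 : 0 < `|f x| - e by rewrite subr_gt0.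
  have /cvgrPdist_lt/(_ _ d0) := cf x Cx; apply: filterS => y /= fxy.
  have := ler_normD (f x - f y) (f y); rewrite subrK.
  by move: fxy => /=; lra.
by have [y [[_ fy] /=]] := clx _ nx; rewrite ltNge fy.
Qed.

Lemma axis_scale j (t : R) (p : Par) (x : 'rV[R]_q) :
  (p, x) + t *: axis j = (p, x + t *: delta_mx 0 j).
Proof. by congr pair; rewrite /= ?scaler0 ?addr0. Qed.

(** Between the two points h changes by at most 2 eta, but by at least their distance divided by L +
    1. *)
Lemma slab_dist U h j L r p x1 (eta : R) x y :
  (forall y, U y -> derivable h y (axis j)) ->
  regular U h j L (p, x1) -> cell L r x1 -> cell L r x -> cell L r y ->
  `|h (p, x)| <= eta -> `|h (p, y)| <= eta ->
  (forall i, i != j -> x 0 i = y 0 i) -> `|x 0 j - y 0 j| <= 2 * eta * L.+1%:R.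
Proof.
move=> dh [reg _] c1; have L0 : 0 < L.+1%:R :> R by rewrite ltr0n.
wlog xy : x y / x 0 j <= y 0 j.
  move=> H cx cy hx hy E; have [xy|/ltW yx] := leP (x 0 j) (y 0 j); first exact: H.
  by rewrite distrC; apply: H => // i ij; rewrite E.
move=> cx cy hx hy E; set t := y 0 j - x 0 j.
have t0 : 0 <= t by rewrite subr_ge0.
have yE : (p, x) + t *: axis j = (p, y) :> Y.
  rewrite axis_scale; congr pair; apply/rowP => i; rewrite !mxE eqxx/=.
  by have [->|ij] := eqVneq i j; rewrite ?mulr1 ?mulr0 ?addr0 /t ?subrKC ?E.
have := @derive_norm_mvt _ _ h (p, x) (axis j) t L.+1%:R^-1 t0.
rewrite yE => mvt.
have {}mvt : L.+1%:R^-1 * t <= `|h (p, y) - h (p, x)|.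
  apply: mvt => s /andP[s0 st]; rewrite axis_scale.
  have cs : cell L r (x + s *: delta_mx 0 j).
    move=> i; rewrite !mxE eqxx/=.
    have [->|ij] := eqVneq i j; last by rewrite mulr0 addr0; exact: cx.
    rewrite mulr1; have /andP[h1 _] := cx j; have /andP[_ h2] := cy j.
    apply/andP; split.
      by apply: (le_trans h1); rewrite ler_wpM2l ?(ltW L0)// lerDl.
    by apply: le_trans h2; rewrite ler_wpM2l ?(ltW L0)// -lerBrDl.
  have [Us Ds] : U (p, x + s *: delta_mx 0 j) /\
      L.+1%:R^-1 <= `|'D_(axis j) h (p, x + s *: delta_mx 0 j)|.
    apply: reg; rewrite (_ : _ - _ = (0, x + s *: delta_mx 0 j - x1) :> Y).
      apply: pair_norm_le; first by rewrite normr0 invr_ge0 ltW.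
      exact: cell_dist cs c1.
    by congr pair; rewrite /= subrr.
  by split => //; exact: dh.
rewrite distrC ger0_norm//.
rewrite -ler_pdivrMr// mulrC; apply: (le_trans mvt).
by rewrite (le_trans (ler_normB _ _))// mulr_natl mulr2n lerD.
Qed.

Lemma slab_measurable (p : Par) h L r (eta : R) :
  (forall x, cell L r x -> {for (p, x), continuous h}) ->
  measurable (@row_of R q @^-1` [set x | cell L r x /\ `|h (p, x)| <= eta]).
Proof.
move=> ch; rewrite -[X in measurable X]setCK preimage_setC; apply: measurableC.
apply: row_of_open_measurable; apply: closed_openC.
apply: (@closed_levels _ (fun x => h (p, x))); first exact: closed_cell.
move=> x cx B nB; have /nbhs_ballP[e /= e0 eB] := ch x cx B nB.
have H : nbhs x (ball x e) by exact: nbhsx_ballx.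
apply: filterS H => y xy; apply: eB.
rewrite -ball_normE /ball_/= (_ : _ - _ = (0, x - y)); last first.
  by congr pair; rewrite /= subrr.
rewrite prod_normE/= normr0 gt_max e0/=.
by move: xy; rewrite -ball_normE.
Qed.

End strata.

Section thin_strata.
Variables (R : realType) (N q : nat) (Z : ptopologicalType) (c : chart R Z q.+1).
Variables (mu : probability (borel Z) R).
Local Notation Y := ('rV[R]_N * 'rV[R]_q.+1)%type.
Hypothesis chc : is_chart c.

Definition stratum (U : set Y) (h : Y -> R^o) j L r (D : set (q.+1.-tuple R))
    (p : 'rV[R]_N) : set (borel Z) :=
  [set z | [/\ chart_dom c z, cell L r (chart_map c z), D (chart_tuple c z),
    h (p, chart_map c z) = 0 & regular U h j L (p, chart_map c z)]].

(** Fix one pair (p1, z1) of the stratum over the ball. A zero of h(p, .) for another p in the ball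
    is within eta of being a zero of h(p1, .), so all samples lie in one slab defined by p1. *)
Lemma thin_stratum (U : set Y) (h : Y -> R^o) j L r (D : set (q.+1.-tuple R)) (n : nat) :
  (forall y, U y -> analytic_at h y) -> measurable D ->
  (forall E, measurable E -> (mu (chart_dom c `&` chart_tuple c @^-1` (E `&` D)) <=
       n%:R%:E * tuple_measure (@lebesgue_measure R) q.+1 E)%E) ->
  thin mu (stratum U h j L r D).
Proof.
move=> Uh mD Dle; have [oD oI mK cM cI] := chc.
have L0 : 0 < L.+1%:R :> R by rewrite ltr0n.
pose K : R := 1 + \sum_i `|(r i)%:~R|.
have K0 : 0 <= K by rewrite addr_ge0// sumr_ge0.
(* The density bound n times the slab bound with thickness 2 eta (L+1), where eta = 2 (L+1)/(m+1);
   the factor 1/(m+1) is left out. *)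
pose C : R := n%:R * (8 * L.+1%:R ^+ 2 * (2 * K) ^+ q).
have C0 : 0 <= C by rewrite !mulr_ge0// ?exprn_ge0 ?mulr_ge0.
exists (2 * L.+1%:R + C) => m p0.
have m0 : 0 < m.+1%:R :> R by rewrite ltr0n.
(* For such m the distance 2/(m+1) between parameters exceeds the radius of regularity; the whole
   space then serves as cover. *)
have [mL|Lm] := ltP (m.+1%:R : R) (2 * L.+1%:R).
  exists setT; split => //; rewrite probability_setT lee_fin ler_pdivlMr// mul1r.
  by rewrite ler_wpDr// ltW.
have [[p1 [z1 [p01 [Dz1 cz1 _ hz1 regz1]]]]|nS] := pselect (exists p1 z1,
    `|p1 - p0| <= m.+1%:R^-1 /\ stratum U h j L r D p1 z1); last first.
  exists set0; split => //.
    rewrite measure0 lee_fin; apply: divr_ge0 (ltW m0).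
    exact: addr_ge0 (mulr_ge0 _ (ltW L0)) C0.
  by move=> p pp0 z Sz; apply: nS; exists p, z.
set x1 := chart_map c z1 in cz1 hz1 regz1.
pose eta : R := L.+1%:R * (2 / m.+1%:R).
have eta0 : 0 <= eta := mulr_ge0 (ltW L0) (divr_ge0 (ler0n _ 2) (ltW m0)).
pose Sx := [set x | cell L r x /\ `|h (p1, x)| <= eta].
pose E := @row_of R q.+1 @^-1` Sx.
have Ucell x : cell L r x -> U (p1, x).
  move=> cx; have [reg _] := regz1.
  have d : `|(p1, x) - (p1, x1) : Y| <= L.+1%:R^-1.
    rewrite (_ : _ - _ = (0, x - x1)); last by congr pair; rewrite /= subrr.
    apply: pair_norm_le; first by rewrite normr0 invr_ge0 ltW.
    exact: cell_dist cx cz1.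
  by have [] := reg _ d.
have mE : measurable E.
  by apply: slab_measurable => x /Ucell /Uh; exact: analytic_at_continuous.
exists (chart_dom c `&` chart_tuple c @^-1` (E `&` D)); split.
- apply: measurableI; first exact: borel_open_measurable.
  rewrite -[X in measurable X]setTI; apply: measurable_chart_tuple => //.
  exact: measurableI.
- apply: (le_trans (Dle E mE)).
  have slab : (tuple_measure (@lebesgue_measure R) q.+1 E <=
      ((2 * (2 * eta * L.+1%:R)) * (2 * K) ^+ q)%:E)%E.
    apply: (lebesgue_slab (j := j)) => //.
    - by rewrite mulr_ge0 ?(ltW L0)// mulr_ge0.
    - by move=> x [cx _] i; exact: cell_bounded cx.
    - move=> x y [cx hx] [cy hy] xy.
      apply: (slab_dist (U := U) _ regz1 cz1 cx cy hx hy xy) => y' /Uh.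
      exact: analytic_at_derivable.
  apply: le_trans (lee_wpmul2l _ slab) _; first by rewrite lee_fin.
  rewrite -EFinM lee_fin ler_pdivlMr// /eta.
  rewrite (_ : _ * m.+1%:R = C); last by rewrite /C; field; rewrite gt_eqF.
  by rewrite lerDr mulr_ge0// ltW.
- move=> p pp0 z [Dz cz Dzt hz [_ calm]]; split => //; split; last by [].
  rewrite /E /= chart_tupleE// tuple_ofK; split => //.
  have pp1 : `|p1 - p| <= 2 / m.+1%:R.
    rewrite -[p1 - p](subrKA p0) (le_trans (ler_normD _ _))//.
    by rewrite mulr_natl mulr2n lerD// distrC.
  have nu : `|(p1 - p, 0) : Y| <= 2 / m.+1%:R.
    by apply: pair_norm_le => //; rewrite normr0 divr_ge0 ?(ltW m0).
  have := calm (p1 - p, 0).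
  rewrite (_ : (p, _) + _ = (p1, chart_map c z) :> Y); last first.
    by congr pair; rewrite /= ?subrKC ?addr0.
  rewrite hz subr0 => H; apply: le_trans (H _) _.
    apply: (le_trans nu); rewrite ler_pdivrMr// mulrC ler_pdivlMr//.
  by rewrite ler_wpM2l ?(ltW L0).
Qed.

End thin_strata.

(** The axis directions leave p fixed, so these derivatives see only the slice where h vanishes. *)
Lemma iter_derive_eq0 (R : realType) N q (V : set 'rV[R]_q)
    (h : ('rV[R]_N * 'rV[R]_q)%type -> R^o) (p : 'rV[R]_N) :
  open V -> (forall x, V x -> h (p, x) = 0) ->
  forall w x, V x -> iter_derive h (map (@axis R N q) w) (p, x) = 0.
Proof.
move=> oV hV; elim=> [|j w ih] x Vx /=; first exact: hV.
have /nbhs_ballP[e /= e0 eV] : nbhs x V by exact: open_nbhs_nbhs.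
set F := iter_derive _ _ in ih *.
suff : is_derive (p, x) (axis R N j) F 0 by case.
apply: (@is_derive_quadratic _ _ _ _ _ _ 0 e e0) => t te.
rewrite axis_scale !ih//; first by rewrite mulr0 !subr0 normr0 mul0r.
apply: eV; rewrite -ball_normE /ball_/= opprD addrA subrr sub0r normrN.
apply: rV_norm_lt => // i; rewrite !mxE eqxx/=.
by case: (i == j); rewrite ?mulr1// mulr0 normr0.
Qed.

(** * Identity theorem and recovery for analytic sampling *)

Section finite_dimensional_sampling.
Variables (R : realType) (k : scalars) (X : normedModType R) (A : set X).
Variables (q N : nat) (Z : ptopologicalType) (atlas : set (chart R Z q)).
Variable (m : X -> Z -> scalar_field R k).
Variables (lp rp : 'rV[R]_N -> X) (C : R).
Local Notation K := (scalar_field R k).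
Local Notation Y := ('rV[R]_N * 'rV[R]_q)%type.

Hypothesis lpl : forall a x y, lp (a *: x + y) = a *: lp x + lp y.
Hypothesis rpl : forall a x y, rp (a *: x + y) = a *: rp x + rp y.
Hypothesis C0 : 0 < C.
Hypothesis lpC : forall p, `|lp p| <= C * `|p|.
Hypothesis rpC : forall p, `|rp p| <= C * `|p|.
Hypothesis oA : open A.
Hypothesis manZ : analytic_manifold atlas.
Hypothesis anm : analytic_on_product atlas A m.

Definition gap b (c : chart R Z q) (y : Y) : R^o :=
  part b (m (lp y.1) (chart_inv c y.2) - m (rp y.1) (chart_inv c y.2)).

Definition gap_dom (c : chart R Z q) : set Y :=
  [set y | [/\ A (lp y.1), A (rp y.1) & chart_img c y.2]].

Let is_ch c : atlas c -> is_chart c.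
Proof. by case: manZ => _ _ H _ _; exact: H. Qed.

Lemma linear_bounded_open (l : 'rV[R]_N -> X) :
  (forall a x y, l (a *: x + y) = a *: l x + l y) ->
  (forall p, `|l p| <= C * `|p|) -> forall y : Y, A (l y.1) ->
  nbhs y [set y' | A (l y'.1)].
Proof.
move=> ll lC y Ay.
have /nbhs_ballP[e /= e0 eA] : nbhs (l y.1) A by exact: open_nbhs_nbhs.
apply/nbhs_ballP; exists (e / C) => /= [|y'].
  by rewrite divr_gt0.
rewrite -ball_normE /ball_/= prod_normE/= gt_max => /andP[yy' _].
apply: eA; rewrite -ball_normE /ball_/=.
have -> : l y.1 - l y'.1 = l (y.1 - y'.1).
  by have := ll (-1) y'.1 y.1; rewrite !scaleN1r addrC [in RHS]addrC => ->.
by apply: le_lt_trans (lC _) _; rewrite mulrC -ltr_pdivlMr.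
Qed.

Lemma open_gap_dom c : atlas c -> open (gap_dom c).
Proof.
move=> /is_ch[_ oI _ _ _]; rewrite openE => y [Al Ar Iy]; rewrite /interior.
have n1 := linear_bounded_open lpl lpC Al.
have n2 := linear_bounded_open rpl rpC Ar.
have n3 : nbhs y [set y' : Y | chart_img c y'.2].
  have /nbhs_ballP[e /= e0 eI] : nbhs y.2 (chart_img c) by exact: open_nbhs_nbhs.
  apply/nbhs_ballP; exists e => //= y'.
  rewrite -ball_normE /ball_/= prod_normE/= gt_max => /andP[_ yy'].
  by apply: eI; rewrite -ball_normE.
by apply: filterS (filterI n1 (filterI n2 n3)) => y' [? [? ?]].
Qed.

Lemma gap_analytic b c y : atlas c -> gap_dom c y -> analytic_at (gap b c) y.
Proof.
move=> ac [Al Ar Iy].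
have lift (l : 'rV[R]_N -> X) :
    (forall a x y, l (a *: x + y) = a *: l x + l y) ->
    (forall p, `|l p| <= C * `|p|) -> A (l y.1) ->
    exists2 T : seq Y -> K^o, symm_multilinear T &
      expands (fun y : Y => m (l y.1) (chart_inv c y.2) : K^o) y T.
  move=> ll lC Aly.
  have [T mT fT] := real_analytic_expands (anm ac) (y := (l y.1, y.2)) (conj Aly Iy).
  pose L (y : Y) : (X * 'rV[R]_q)%type := (l y.1, y.2).
  have LL a x x' : L (a *: x + x') = a *: L x + L x'.
    by rewrite /L ll.
  exists (T \o map L); first exact: symm_multilinear_comp.
  apply: (expands_comp (C := C + 1) LL _ _ fT); first by rewrite addr_gt0.
  move=> x; rewrite mulrDl mul1r /L !prod_normE/= ge_max; apply/andP; split.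
    apply: ler_wpDr; first by rewrite le_max normr_ge0.
    apply: le_trans (lC _) _; apply: ler_wpM2l (ltW C0) _ _ _.
    by rewrite le_max lexx.
  apply: ler_wpDl; last by rewrite le_max lexx orbT.
  by rewrite mulr_ge0 ?(ltW C0)// le_max normr_ge0.
have [T1 mT1 f1] := lift lp lpl lpC Al.
have [T2 mT2 f2] := lift rp rpl rpC Ar.
exists (part b \o (fun s => T1 s - T2 s)).
  apply: symm_multilinear_real; last exact: symm_multilinearB.
  exact: part_linear.
apply: (@expands_real R k K^o Y (part b)) (expandsB f1 f2).
  exact: part_linear.
exact: part_le.
Qed.

(* The set where all derivatives vanish is open and closed. *)
Lemma gap_identity b p c0 z0 : connected [set: Z] -> A (lp p) -> A (rp p) ->
  atlas c0 -> chart_dom c0 z0 ->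
  (forall w, iter_derive (gap b c0) (map (@axis R N q) w) (p, chart_map c0 z0) = 0) ->
  forall z, part b (m (lp p) z - m (rp p) z) = 0.
Proof.
move=> conn Al Ar ac0 Dz0 w0.
have [_ _ _ cov _] := manZ.
pose u z : R := part b (m (lp p) z - m (rp p) z).
(* O is described without charts, so derivatives never have to be transformed from one chart to
   another. *)
pose O : set Z := [set z | nbhs z [set z' | u z' = 0]].
have gapE c z : atlas c -> chart_dom c z -> gap b c (p, chart_map c z) = u z.
  by move=> /is_ch[_ _ mK _ _] Dz; rewrite /gap /= mK// inE.
have words c z : atlas c -> chart_dom c z ->
    (forall w, iter_derive (gap b c) (map (@axis R N q) w) (p, chart_map c z) = 0) -> O z.
  move=> ac Dz wz; have [oD oI mK cM cI] := is_ch ac.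
  have Uz : gap_dom c (p, chart_map c z) by split => //; exists z.
  have [T mT fT] := gap_analytic b ac Uz.
  have [rho rho0 H] := expands_eq0 mT fT wz.
  have oB : open (ball (chart_map c z) rho) by exact: ball_open.
  have oP := chart_preimage_open (is_ch ac) oB.
  have : nbhs z (chart_dom c `&` chart_map c @^-1` ball (chart_map c z) rho).
    by apply: open_nbhs_nbhs; split => //; split => //; exact: ballxx.
  apply: filterS => z' [Dz' Bz']; rewrite /= -(gapE c)//.
  pose v i : R := (chart_map c z' - chart_map c z) 0 i.
  have vE : \sum_i v i *: axis R N i = (0, chart_map c z' - chart_map c z) :> Y.
    transitivity ((0, \sum_i v i *: delta_mx 0 i) : Y).
      rewrite [LHS]surjective_pairing; congr pair.
        rewrite (big_morph (fun y : Y => y.1) (fun _ _ => erefl) erefl) big1// => i _.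
        by rewrite /= scaler0.
      by rewrite (big_morph (fun y : Y => y.2) (fun _ _ => erefl) erefl).
    by congr pair; rewrite [RHS]row_sum_delta.
  have := H v; rewrite vE (_ : _ + (0, _) = (p, chart_map c z')); last first.
    by congr pair; rewrite /= ?addr0 ?subrKC.
  apply; rewrite prod_normE/= normr0 gt_max rho0/=.
  by move: Bz'; rewrite /= -ball_normE /ball_/= distrC.
have oO : open O.
  by rewrite openE => z Oz; rewrite /interior; move: (Oz) => /nbhs_interior.
(* At a limit point of O each derivative in a chart is a limit of zeros, hence zero by continuity,
   and [words] applies. *)
have cO : closed O.
  move=> z clz; have [c ac Dz] := cov z; have [oD oI mK cM cI] := is_ch ac.
  apply: (words c) => // w.
  have Uz : gap_dom c (p, chart_map c z) by split => //; exists z.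
  have cw := analytic_at_continuous (analytic_at_iter_derive (map (@axis R N q) w)
     (gap_analytic b ac Uz)).
  set F := iter_derive _ _ in cw *.
  apply/eqP/negPn/negP => Fn0.
  have Fpos : 0 < `|F (p, chart_map c z)| by rewrite normr_gt0.
  have /cvgrPdist_lt/(_ _ Fpos)/nbhs_ballP[e /= e0 He] := cw.
  have oB : open (ball (chart_map c z) e) by exact: ball_open.
  have oP := chart_preimage_open (is_ch ac) oB.
  have nz : nbhs z (chart_dom c `&` chart_map c @^-1` ball (chart_map c z) e).
    by apply: open_nbhs_nbhs; split => //; split => //; exact: ballxx.
  have [z' [Oz' [Dz' Bz']]] := clz _ nz.
  have := He (p, chart_map c z'); rewrite /= => H; move: H.
  have -> : F (p, chart_map c z') = 0.
    have [V [oV Vz'] VO] : exists2 V : set Z, open_nbhs z' V & V `<=` [set z | u z = 0].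
      by move: Oz'; rewrite /O /= nbhsE.
    pose W : set 'rV[R]_q := chart_img c `&` chart_inv c @^-1` V.
    have oW : open W.
      move: cI; rewrite continuous_open_subspace// => cI.
      rewrite openE => x [Ix Vx]; rewrite /interior; apply: filterI.
        exact: open_nbhs_nbhs.
      by apply: cI; rewrite ?inE//; exact: open_nbhs_nbhs.
    apply: (iter_derive_eq0 oW) => [x [[z1 Dz1 <-]]|].
      by rewrite /= mK ?inE// => /VO; rewrite gapE.
    by split; [exists z'|rewrite /= mK// inE].
  rewrite subr0 ltxx => H; suff : false by []; apply: H.
  rewrite -ball_normE /ball_/= (_ : _ - _ = (0, chart_map c z - chart_map c z')); last first.
    by congr pair; rewrite /= subrr.
  rewrite prod_normE/= normr0 gt_max e0/=.
  by move: Bz'; rewrite /= -ball_normE.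
have : O = setT.
  apply: conn; first by exists z0; exact: words w0.
    by exists O => //; rewrite setTI.
  by exists O => //; rewrite setTI.
move=> OT z; have Oz : O z by rewrite OT.
exact: nbhs_singleton Oz.
Qed.

End finite_dimensional_sampling.

(** Lindelof argument: for every basic open set that fits into some chart choose one such chart;
    other basic sets receive a dummy. *)
Lemma countable_atlas (R : realType) (Z : ptopologicalType) q
    (atlas : set (chart R Z q)) : analytic_manifold atlas ->
  exists ch : nat -> chart R Z q, (forall n, atlas (ch n)) /\
    forall z, exists n, chart_dom (ch n) z.
Proof.
move=> [_ [B cB [oB bB]] isch cov _].
have [c0 ac0 _] := cov point.
have [g gB] : exists g : nat -> set Z, B `<=` range g.
  move/pfcard_geP : cB => [D0|[g]]; first by exists (fun=> set0); rewrite D0.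
  by exists g; exact: (@surj _ _ _ _ g).
have /choice[ch Hch] : forall n, exists c, atlas c /\
    ((exists2 c', atlas c' & g n `<=` chart_dom c') -> g n `<=` chart_dom c).
  move=> n; have [[c ac gc]|nc] := pselect (exists2 c', atlas c' & g n `<=` chart_dom c').
    by exists c.
  by exists c0; split.
exists ch; split=> [n|z]; first by case: (Hch n).
have [c ac Dz] := cov z; have [oD _ _ _ _] := isch c ac.
have nz : nbhs z (chart_dom c) by exact: open_nbhs_nbhs.
have [b [Bb bz] bc] := bB z _ nz.
have [n _ nb] := gB b Bb; exists n.
by have [_ H] := Hch n; apply: H; [exists c => //; rewrite nb|rewrite nb].
Qed.

(* At a zero of finite order some iterated derivative vanishes to first order. *)
Lemma last_vanishing_word (R : realType) (Y : normedModType R) q (e : 'I_q -> Y)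
    (f : Y -> R^o) y w : f y = 0 -> iter_derive f (map e w) y != 0 ->
  exists w' j, iter_derive f (map e w') y = 0 /\ 'D_(e j) (iter_derive f (map e w')) y != 0.
Proof.
move=> fy; elim: w => [|j w ih] /=; first by rewrite fy eqxx.
have [w0 nz|/ih//] := eqVneq (iter_derive f (map e w) y) 0.
by exists w, j.
Qed.

Theorem recovery_finite_dimensional (R : realType) (k : scalars) (X : normedModType R)
    (A V : set X) (d : nat) (e : 'I_d -> X) (s M q : nat) (Z : ptopologicalType)
    (atlas : set (chart R Z q)) (vol : {measure set (borel Z) -> \bar R})
    (mu : probability (borel Z) R) (m : X -> Z -> scalar_field R k) :
  open A -> V = lin_span (range e) -> (0 < s <= d)%N -> (s + s < M)%N ->
  (1 <= q)%N -> analytic_manifold atlas -> connected [set: Z] ->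
  smooth_positive_volume atlas vol -> mu `<< vol -> analytic_on_product atlas A m ->
  (forall a1 a2, (A `&` V) a1 -> (A `&` V) a2 -> a1 <> a2 ->
     ~ forall z, m a1 z - m a2 z = 0) ->
  almost_sure_recovery (A `&` sparse e s) mu m M.
Proof.
case: q atlas => // q atlas oA VE sd sM _ manZ conn svol muvol anm inj.
apply: (recovery_of_thin sd sM VE) => sg sg'.
have [C1 C10 HC1] := param_bound e sg.
have [C2 C20 HC2] := param_bound e sg'.
pose C := C1 + C2.
have C0 : 0 < C by exact: addr_gt0.
have lC p : `|lparam e sg p| <= C * `|p|.
  by apply: le_trans (HC1 p).1 _; rewrite ler_wpM2r// lerDl ltW.
have rC p : `|rparam e sg' p| <= C * `|p|.
  by apply: le_trans (HC2 p).2 _; rewrite ler_wpM2r// lerDr ltW.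
have ll := lparam_linear e sg; have rl := rparam_linear e sg'.
have [ch [ach chz]] := countable_atlas manZ.
have [_ _ isch _ _] := manZ.
have /choice[D HD] : forall n, exists D : nat -> set (q.+1.-tuple R),
    [/\ forall n, measurable (D n), forall t, exists n, D n t &
     forall l E, measurable E ->
      (mu (chart_dom (ch n) `&` chart_tuple (ch n) @^-1` (E `&` D l)) <=
       l%:R%:E * tuple_measure (@lebesgue_measure R) q.+1 E)%E].
  move=> n; have [rho [srho _ volE]] := svol _ (ach n).
  exact: (chart_levels (isch _ (ach n)) srho volE muvol).
pose gp b n := gap (N := s + s) m (lparam e sg) (rparam e sg') b (ch n).
pose U n := gap_dom A (lparam e sg) (rparam e sg') (ch n).
have gpan b n y : U n y -> analytic_at (gp b n) y.
  by move=> Uy; exact: (gap_analytic ll rl C0 lC rC anm b (ach n) Uy).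
have oU n : open (U n) by exact: (open_gap_dom ll rl C0 lC rC oA manZ (ach n)).
pose hh b n w := iter_derive (gp b n) (map (@axis R (s + s) q.+1) w).
(* In order: chart, component of the scalar, word of derivatives, direction, regularity grade, cell,
   density level. *)
pose I : countType := (nat * bool * seq 'I_q.+1 * 'I_q.+1 * nat * {ffun 'I_q.+1 -> int} * nat)%type.
pose S (i : I) : 'rV[R]_(s + s) -> set (borel Z) :=
  let: (n, b, w, j, L, r, l) := i in
  stratum (ch n) (U n) (hh b n w) j L r (D n l).
exists I, S; split.
  move=> [[[[[[n b] w] j] L] r] l]; have [mD _ Dle] := HD n.
  apply: (@thin_stratum _ _ _ _ _ _ (isch _ (ach n)) _ _ _ _ _ _ l) => //.
    by move=> y Uy; apply: analytic_at_iter_derive; exact: gpan.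
  by move=> E mE; exact: Dle.
move=> p z [Al Vl] [Ar Vr] lr mz.
have [n Dz] := chz z; set x := chart_map (ch n) z.
have [_ _ mK _ _] := isch _ (ach n).
have Ux : U n (p, x) by split => //; exists z.
have [b nb] : exists b, ~ forall z, part b (m (lparam e sg p) z - m (rparam e sg' p) z) = 0.
  apply/not_existsP => H; apply: (inj _ _ (conj Al Vl) (conj Ar Vr) lr) => z'.
  by apply: part_eq0 => b; have := H b; rewrite notK; exact.
have [w nw] : exists w, hh b n w (p, x) != 0.
  apply/not_existsP => H; apply: nb.
  apply: (gap_identity ll rl C0 lC rC manZ anm conn Al Ar (ach n) Dz) => w.
  by have := H w; move/negP/negPn/eqP.
have g0 : gp b n (p, x) = 0.
  rewrite /gp /gap /= mK ?inE// mz subrr.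
  exact: part0.
have [w' [j [hw Dw]]] := last_vanishing_word g0 nw.
have [L reg] := analytic_regular (oU n) (fun y Uy => analytic_at_iter_derive
   (map (@axis R (s + s) q.+1) w') (gpan b n y Uy)) Ux Dw.
have [r cr] := cell_cover L x.
have [_ Dt _] := HD n; have [l Dl] := Dt (chart_tuple (ch n) z).
by exists (n, b, w', j, L, r, l); split.
Qed.

(** * Gaussian small balls and the Riesz representation *)

Section normal_moments.
Variable R : realType.
Local Notation leb := (@lebesgue_measure R).

Lemma integral_normal_prob (m s : R) (f : R -> \bar R) : (forall x, 0 <= f x)%E ->
  measurable_fun [set: R] f ->
  (\int[normal_prob m s]_x f x = \int[leb]_x (f x * (normal_pdf m s x)%:E))%E.
Proof.
move=> f0 mf; have dom := normal_prob_dominates m s.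
rewrite -(Radon_Nikodym_SigmaFinite.change_of_variables dom f0 measurableT mf).
have mpdf : measurable_fun [set: R] (EFin \o normal_pdf m s).
  by apply/measurable_EFinP; exact: measurable_normal_pdf.
have iRN := Radon_Nikodym_SigmaFinite.f_integrable dom.
have mRN := measurable_int _ iRN.
apply: ae_eq_integral => //; [exact: emeasurable_funM|exact: emeasurable_funM|].
apply: ae_eqe_mul2l.
apply: integral_ae_eq => // E _ mE.
by rewrite -Radon_Nikodym_SigmaFinite.f_integral.
Qed.

(** Only a bound is needed, so the integrand is compared with 8 s^2 times the density of deviation
    2s. With t = (x-m)^2/(4s^2) this reduces to t exp(-2t) <= exp(-t/2); the 8 is 4 from the square
    times 2 from the ratio of the peaks. *)
Lemma normal_second_moment (m s : R) : s != 0 ->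
  (\int[normal_prob m s]_x ((x - m) ^+ 2)%:E <= (8 * s ^+ 2)%:E)%E.
Proof.
move=> s0; have s20 : 2 * s != 0 by rewrite mulf_neq0.
have msq : measurable_fun [set: R] (fun x : R => ((x - m) ^+ 2)%:E).
  apply/measurable_EFinP; apply: measurable_funX.
  exact: measurable_funB.
rewrite integral_normal_prob//; last by move=> x; rewrite lee_fin sqr_ge0.
have mpdf a : measurable_fun [set: R] (EFin \o normal_pdf m a).
  by apply/measurable_EFinP; exact: measurable_normal_pdf.
apply: (@le_trans _ _ (\int[leb]_x ((8 * s ^+ 2)%:E * (normal_pdf m (2 * s) x)%:E))%E).
  apply: ge0_le_integral => //.
  - by move=> x _; rewrite -EFinM lee_fin mulr_ge0 ?sqr_ge0 ?normal_pdf_ge0.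
  - exact: (emeasurable_funM msq (mpdf s)).
  - exact: (emeasurable_funM (measurable_cst _) (mpdf (2 * s))).
  - move=> x _; rewrite -!EFinM lee_fin !normal_pdfE//=.
    set y := x - m.
    have peakE : normal_peak s = 2 * normal_peak (2 * s).
      rewrite /normal_peak.
      rewrite (_ : (2 * s) ^+ 2 * pi *+ 2 = 2 ^+ 2 * (s ^+ 2 * pi *+ 2)); last by ring.
      by rewrite sqrtrM ?sqr_ge0// sqrtr_sqr ger0_norm// invfM mulrA divff ?mul1r.
    rewrite peakE /normal_fun -/y.
    pose t := y ^+ 2 / (4 * s ^+ 2).
    have s2 : 0 < s ^+ 2 by rewrite exprn_even_gt0.
    have t0 : 0 <= t by rewrite divr_ge0 ?sqr_ge0// mulr_ge0// ltW.
    have -> : - y ^+ 2 / (s ^+ 2 *+ 2) = - (t + t) by rewrite /t; field.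
    have -> : - y ^+ 2 / ((2 * s) ^+ 2 *+ 2) = - (t / 2) by rewrite /t; field.
    have -> : y ^+ 2 = 4 * s ^+ 2 * t by rewrite /t; field.
    set P := normal_peak _; have P0 : 0 <= P by exact: normal_peak_ge0.
    rewrite (_ : _ * (2 * P * _) = 8 * s ^+ 2 * (P * (t * expR (- (t + t))))); last by ring.
    apply: ler_wpM2l; first by rewrite mulr_ge0// ltW.
    apply: (ler_wpM2l P0).
    apply: (@le_trans _ _ (expR t * expR (- (t + t)))).
      apply: (ler_wpM2r (expR_ge0 _)).
      by apply: le_trans (expR_ge1Dx t); rewrite lerDr.
    by rewrite -expRD ler_expR; lra.
have -> : (\int[leb]_x ((8 * s ^+ 2)%:E * (normal_pdf m (2 * s) x)%:E))%E =
    ((8 * s ^+ 2)%:E * \int[leb]_x (normal_pdf m (2 * s) x)%:E)%E.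
  apply: ge0_integralZl => //; first exact: mpdf.
    by move=> x _; rewrite lee_fin normal_pdf_ge0.
  by rewrite lee_fin mulr_ge0// sqr_ge0.
by rewrite integral_normal_pdf mule1.
Qed.

Lemma normal_peak_le (s : R) : s != 0 -> normal_peak s <= `|s|^-1.
Proof.
move=> s0; rewrite /normal_peak lef_pV2 ?posrE ?normr_gt0 ?sqrtr_gt0//; last first.
  by rewrite mulrn_wgt0// mulr_gt0 ?pi_gt0// exprn_even_gt0.
rewrite -sqrtr_sqr ler_wsqrtr// -mulr_natr -mulrA ler_peMr ?sqr_ge0//.
by have := pi_ge2 R; lra.
Qed.

Lemma normal_small_ball (m s a ep : R) : s != 0 -> 0 <= ep ->
  (normal_prob m s `[(a - ep)%R, (a + ep)%R]%classic <= (2 * ep / `|s|)%:E)%E.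
Proof.
move=> s0 ep0; rewrite /normal_prob; set I := `[_, _]%classic.
have mI : measurable I by exact: measurable_itv.
apply: (@le_trans _ _ (\int[leb]_(x in I) (cst (`|s|^-1)%:E) x)%E).
  apply: ge0_le_integral => //.
  - by move=> x _; rewrite lee_fin normal_pdf_ge0.
  - by apply/measurable_EFinP; apply: measurable_funTS; exact: measurable_normal_pdf.
  - move=> x _; rewrite lee_fin (le_trans (normal_pdf_ub m x s0))//.
    exact: normal_peak_le.
rewrite integral_cst//.
have leI : (leb I <= (2 * ep)%:E)%E.
  rewrite lebesgue_measure_itv/= lte_fin; case: ifP => _.
    by rewrite -EFinB lee_fin; lra.
  by rewrite lee_fin mulr_ge0.
apply: le_trans (lee_wpmul2l _ leI) _; first by rewrite lee_fin invr_ge0.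
by rewrite -EFinM lee_fin mulrC.
Qed.

End normal_moments.

Section gaussian_small_ball.
Context d (T : measurableType d) (R : realType) (P : probability T R) (X : T -> R).
Hypothesis mX : measurable_fun setT X.

(** Variance is unchanged by subtracting m and is at most the second moment. The finite bound also
    provides the square integrability. *)
Lemma variance_le_shift (m : R) (b : R) :
  (\int[P]_w ((X w - m) ^+ 2)%:E <= b%:E)%E ->
  (covariance P X X <= b%:E)%E.
Proof.
move=> le; pose Y : T -> R := X \+ cst (- m).
have mY : measurable_fun setT Y by apply: measurable_funD.
have Y2 : Y \in Lfun P 2%:E.
  rewrite inE; apply/andP; split; rewrite inE//=.
  rewrite /finite_norm unlock /Lnorm; apply: poweR_lty.
  apply: le_lt_trans (ltry b); apply: le_trans le.
  rewrite le_eqVlt; apply/orP; left; apply/eqP; apply: eq_integral => w _ /=.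
  by rewrite powR_mulrn// -normrX ger0_norm ?sqr_ge0.
have XE : X = Y \+ cst m by apply/funext => w; rewrite /Y /= subrK.
rewrite XE -/(variance P _) varianceD_cst_r// varianceE//.
apply: (@le_trans _ _ ('E_P[Y ^+ 2])%E); last first.
  by rewrite unlock.
rewrite -[leRHS]sube0; apply: leeB => //.
by rewrite -(fineK (expectation_fin_num (Lfun_subset12 (fin_num_measure P _ measurableT) Y2))) -EFin_expe lee_fin sqr_ge0.
Qed.

Hypothesis gX : gaussian_law (fun B => P (X @^-1` B)).

(* The density of N(m, s^2) is at most 1/|s|, and its variance at most 8 s^2. *)
Lemma gaussian_small_ball (v a ep : R) : (covariance P X X = v%:E)%E -> 0 < v -> 0 <= ep ->
  (P (X @^-1` `[(a - ep)%R, (a + ep)%R]%classic) <= (2 * ep * (Num.sqrt 8 / Num.sqrt v))%:E)%E.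
Proof.
move=> cv v0 ep0; have [m [s law]] := gX.
have sqv : 0 < Num.sqrt v by rewrite sqrtr_gt0.
pose OT := g_sigma_algebraType (R.-ocitv.-measurable).
pose f (x : OT) : \bar R := (((x : R) - m) ^+ 2)%:E.
have mf : measurable_fun [set: OT] f.
  by apply/measurable_EFinP; apply: measurable_funX; exact: measurable_funB.
have int2 : (\int[P]_w ((X w - m) ^+ 2)%:E =
   \int[@pushforward _ _ T OT R P X]_x f x)%E.
  rewrite (@ge0_integral_pushforward _ _ T OT R X mX P setT f)//.
  by move=> x _; rewrite lee_fin sqr_ge0.
(* Deviation 0 means a Dirac law, whose variance 0 contradicts v > 0. *)
have [s0|s0] := eqVneq s 0.
  have : (covariance P X X <= 0%:E)%E.
    apply: (@variance_le_shift m); rewrite int2.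
    rewrite (@eq_measure_integral _ OT _ _ (dirac (m : OT))).
      rewrite integral_dirac// /f.
      by rewrite diracE in_setT mul1e subrr expr0n.
    by move=> A mA _; have := law A mA; rewrite s0 eqxx; exact.
  by rewrite cv lee_fin leNgt v0.
have vs : v <= 8 * s ^+ 2.
  rewrite -lee_fin -cv; apply: (@variance_le_shift m); rewrite int2.
  apply: le_trans (normal_second_moment m s0).
  rewrite le_eqVlt; apply/orP; left; apply/eqP; apply: eq_measure_integral.
  by move=> A mA _; have := law A mA; rewrite (negbTE s0); exact.
rewrite law; last exact: measurable_itv.
rewrite (negbTE s0); apply: (le_trans (normal_small_ball _ _ s0 ep0)).
rewrite lee_fin; apply: ler_wpM2l; first by rewrite mulr_ge0.
rewrite -[leLHS]mul1r ler_pdivrMr ?normr_gt0// mulrAC ler_pdivlMr// mul1r.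
by rewrite -sqrtr_sqr -sqrtrM// ler_wsqrtr.
Qed.

End gaussian_small_ball.

Section riesz.
Variables (R : realType) (Z : completeNormedModType R) (ip : Z -> Z -> R).
Hypothesis ipP : @inner_product R RealScalars Z ip.

Lemma ip_linear a x y z : ip (a *: x + y) z = a * ip x z + ip y z.
Proof. by case: ipP. Qed.
Lemma ipC x y : ip y x = ip x y.
Proof. by case: ipP. Qed.
Lemma ip_norm x : ip x x = `|x| ^+ 2.
Proof. by case: ipP. Qed.
Lemma ipD x y z : ip (x + y) z = ip x z + ip y z.
Proof. by rewrite -[x]scale1r ip_linear mul1r scale1r. Qed.
Lemma ip0 z : ip 0 z = 0.
Proof. by have := ipD 0 0 z; rewrite addr0 => /eqP; rewrite addrC -subr_eq subrr eq_sym => /eqP. Qed.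
Lemma ipZ a x z : ip (a *: x) z = a * ip x z.
Proof. by rewrite -[a *: x]addr0 ip_linear ip0 addr0. Qed.
Lemma ip_linearr a x y z : ip z (a *: x + y) = a * ip z x + ip z y.
Proof. by rewrite ipC ip_linear ![ip _ z]ipC. Qed.

Lemma sqr_norm_addZ (x y : Z) (t : R) : `|x + t *: y| ^+ 2 = `|x| ^+ 2 + 2 * t * ip x y + t ^+ 2 * `|y| ^+ 2.
Proof.
rewrite -!ip_norm addrC ip_linear !(ipC (t *: y + x)) !ip_linear [ip y x]ipC; ring.
Qed.

Lemma parallelogram (x y : Z) : `|x - y| ^+ 2 + `|x + y| ^+ 2 = 2 * `|x| ^+ 2 + 2 * `|y| ^+ 2.
Proof.
have := sqr_norm_addZ x y 1; have := sqr_norm_addZ x y (-1).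
rewrite scale1r scaleN1r => -> ->; ring.
Qed.

Lemma ip_bound (x y : Z) : `|ip x y| <= `|x| * `|y|.
Proof.
have [->|y0] := eqVneq y 0; first by rewrite ipC ip0 !normr0 mulr0.
have ny : 0 < `|y| by rewrite normr_gt0.
pose t := - ip x y / `|y| ^+ 2.
have : 0 <= `|x + t *: y| ^+ 2 by exact: sqr_ge0.
rewrite sqr_norm_addZ.
have -> : `|x| ^+ 2 + 2 * t * ip x y + t ^+ 2 * `|y| ^+ 2 =
    `|x| ^+ 2 - ip x y ^+ 2 / `|y| ^+ 2.
  by rewrite /t; field; rewrite gt_eqF.
rewrite subr_ge0 ler_pdivrMr ?exprn_gt0// -exprMn -[X in X <= _]ger0_norm ?sqr_ge0//.
by rewrite normrX ler_pXn2r// nnegrE ?mulr_ge0.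
Qed.

(** Take y of minimal norm on the hyperplane l = 1. A minimising sequence is Cauchy by the
    parallelogram law, y is orthogonal to the kernel, and y divided by its squared norm represents
    l. *)
Lemma riesz (l : Z -> R) (B : R) : (forall a x y, l (a *: x + y) = a * l x + l y) ->
  (forall x, `|l x| <= B * `|x|) -> exists u, forall x, l x = ip u x.
Proof.
move=> ll lB.
have l0 : l 0 = 0 by have := lB 0; rewrite normr0 mulr0 normr_le0 => /eqP.
have lZ a x : l (a *: x) = a * l x by rewrite -[a *: x]addr0 ll l0 addr0.
have lD x y : l (x + y) = l x + l y by rewrite -[x]scale1r ll mul1r scale1r.
have lN x : l (- x) = - l x by rewrite -scaleN1r lZ mulN1r.
have [H|/existsNP[e le]] := pselect (forall x, l x = 0).
  by exists 0 => x; rewrite H ip0.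
have {}le : l e != 0 by exact/eqP.
pose S := [set `|x| | x in [set x | l x = 1]].
have hS : has_inf S.
  split; last by exists 0 => _ [x _ <-].
  by exists `|(l e)^-1 *: e|, ((l e)^-1 *: e) => //=; rewrite lZ mulVf.
pose dl := inf S.
have dl0 : 0 <= dl by apply: lb_le_inf; [case: hS|move=> _ [x _ <-]].
have dlle x : l x = 1 -> dl <= `|x|.
  by move=> lx; apply: ge_inf; [case: hS|exists x].
have /choice[x Hx] : forall n : nat, exists x, l x = 1 /\ `|x| < dl + n.+1%:R^-1.
  move=> n; have e0 : 0 < n.+1%:R^-1 :> R by rewrite invr_gt0 ltr0n.
  by have [_ [x lx <-] xd] := inf_adherent e0 hS; exists x.
have near_min e' : 0 < e' -> exists n0, forall n m, (n0 <= n)%N -> (n0 <= m)%N ->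
    `|x n - x m| < e'.
  move=> e0.
  (* The parallelogram law bounds the squared distance by 4(dl+c)^2 - 4 dl^2, which is at most c(8
     dl + 4) as c <= 1; the 5 makes the inequality strict. *)
  have c0 : 0 < Num.min 1 (e' ^+ 2 / (8 * dl + 5)).
    by rewrite lt_min ltr01 divr_gt0 ?exprn_gt0// ltr_wpDl// mulr_ge0.
  have [n0 Hn0] := invS_lt_eventually c0.
  exists n0 => n m n0n n0m.
  set c := Num.min _ _ in c0 Hn0.
  have [lxn xn] := Hx n; have [lxm xm] := Hx m.
  have {}xn : `|x n| < dl + c by apply: lt_trans xn _; rewrite ltrD2l Hn0.
  have {}xm : `|x m| < dl + c by apply: lt_trans xm _; rewrite ltrD2l Hn0.
  have mid : 2 * dl <= `|x n + x m|.
    have := dlle (2^-1 *: (x n + x m)); rewrite lZ lD lxn lxm mulVf// => /(_ erefl).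
    by rewrite normrZ ger0_norm ?invr_ge0// ler_pdivlMl.
  have par := parallelogram (x n) (x m).
  have c1 : c <= 1 by rewrite /c ge_min lexx.
  have c2 : c * (8 * dl + 5) <= e' ^+ 2.
    rewrite -ler_pdivlMr; first by rewrite /c ge_min lexx orbT.
    by rewrite ltr_wpDl// mulr_ge0.
  rewrite -(ltr_pXn2r (n := 2))// ?nnegrE ?(ltW e0)//.
  have b1 : `|x n| ^+ 2 <= (dl + c) ^+ 2.
    by rewrite lerXn2r ?nnegrE ?addr_ge0 ?(ltW c0)// ltW.
  have b2 : `|x m| ^+ 2 <= (dl + c) ^+ 2.
    by rewrite lerXn2r ?nnegrE ?addr_ge0 ?(ltW c0)// ltW.
  have b3 : (2 * dl) ^+ 2 <= `|x n + x m| ^+ 2.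
    by rewrite lerXn2r ?nnegrE ?mulr_ge0.
  have cc : c ^+ 2 <= c by rewrite expr2 ler_piMl// ltW.
  move: b1 b2 b3; rewrite [(dl + c) ^+ 2]sqrrD exprMn => b1 b2 b3.
  nra.
have /cauchy_cvgP cx : cauchy (x @ \oo).
  apply: cauchy_exP => e' e0; have [n0 Hn0] := near_min e' e0.
  exists (x n0); exists n0 => // n n0n /=.
  by rewrite -ball_normE /ball_/= Hn0.
set y := lim (x @ \oo) in cx.
have cl : l \o x @ \oo --> l y.
  apply/cvgrPdist_lt => e' e0.
  have B0 : 0 < `|B| + 1 by rewrite ltr_wpDl.
  have /cvgrPdist_lt/(_ _ (divr_gt0 e0 B0)) := cx.
  apply: filterS => n /= yn.
  have -> : l y - l (x n) = l (y - x n).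
    by rewrite lD lN.
  apply: le_lt_trans (lB _) _; apply: (@le_lt_trans _ _ ((`|B| + 1) * `|y - x n|)).
    by rewrite ler_wpM2r// (le_trans (ler_norm B))// lerDl.
  by rewrite mulrC -ltr_pdivlMr.
have ly : l y = 1.
  apply/esym; apply: (@cvg_unique _ (@norm_hausdorff _ R^o) (l \o x @ \oo)) => //.
  rewrite (_ : l \o x = cst 1); first exact: cvg_cst.
  by apply/funext => n; have [] := Hx n.
have yd : `|y| <= dl.
  apply/ler_addgt0Pr => e' e0; have e2 : 0 < e' / 2 by rewrite divr_gt0.
  have [n0 Hn0] := invS_lt_eventually e2.
  have /cvgrPdist_lt/(_ _ e2)[n1 _ Hn1] := cx.
  pose N := maxn n0 n1.
  have h1 : `|y - x N| < e' / 2 by exact: Hn1 (leq_maxr _ _).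
  have h2 : N.+1%:R^-1 < e' / 2 by exact: Hn0 (leq_maxl _ _).
  have [_ h3] := Hx N.
  rewrite -[y](subrK (x N)) (le_trans (ler_normD _ _))//.
  move: h1 h2 h3; move: `|y - x N| (`|x N|) (N.+1%:R^-1 : R) => a b c; lra.
have orth h : l h = 0 -> ip y h = 0.
  move=> lh.
  (* Moving along the kernel stays on the hyperplane, so minimality of y makes this quadratic
     nonnegative; its minimum in t forces the inner product to vanish. *)
  have H t : 0 <= 2 * t * ip y h + t ^+ 2 * `|h| ^+ 2.
    have : `|y| ^+ 2 <= `|y + t *: h| ^+ 2.
      rewrite lerXn2r ?nnegrE// (le_trans yd)// dlle// addrC.
      by rewrite ll lh mulr0 add0r.
    by rewrite sqr_norm_addZ; lra.
  have [h0|h0] := eqVneq h 0; first by rewrite h0 ipC ip0.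
  have nh : 0 < `|h| ^+ 2 by rewrite exprn_gt0// normr_gt0.
  have := H (- ip y h / `|h| ^+ 2).
  have -> : 2 * (- ip y h / `|h| ^+ 2) * ip y h +
     (- ip y h / `|h| ^+ 2) ^+ 2 * `|h| ^+ 2 = - (ip y h ^+ 2 / `|h| ^+ 2).
    by field; rewrite -sqrf_eq0 gt_eqF.
  rewrite oppr_ge0 pmulr_lle0 ?invr_gt0// => h1.
  by apply/eqP; rewrite -sqrf_eq0 eq_le h1 sqr_ge0.
have y0 : `|y| ^+ 2 != 0.
  rewrite sqrf_eq0 normr_eq0; apply/eqP => y0; move: ly; rewrite y0 l0 => /eqP.
  by rewrite eq_sym oner_eq0.
exists ((`|y| ^+ 2)^-1 *: y) => z.
have := orth (z - l z *: y); rewrite lD lN lZ ly mulr1 subrr => /(_ erefl).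
rewrite -scaleNr.
rewrite addrC ip_linearr ip_norm => E.
rewrite ipZ; have -> : ip y z = l z * `|y| ^+ 2 by move: E; lra.
by rewrite mulrCA mulVf// mulr1.
Qed.

End riesz.

(** * Strata for Gaussian multilinear sampling *)

Section multilinear_form_bounds.
Variables (R : realType) (k : scalars).
Local Notation K := (scalar_field R k).
Variables (H : normedModType K) (r : nat).
Implicit Types (f : mform H r) (h : 'I_r -> H).

Lemma mform_norm_real f : real_norm f = mnorm f.
Proof. exact: of_realK. Qed.

Lemma mform_scale f (c : 'I_r -> K) h : f (fun i => c i *: h i) = (\prod_i c i) *: f h.
Proof.
have mf := mform_multilinear f.
have E : forall l : seq 'I_r, uniq l ->
    f (fun i => if i \in l then c i *: h i else h i) = (\prod_(i <- l) c i) *: f h.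
  elim=> [_|i l ih /= /andP[il ul]]; first by rewrite big_nil scale1r.
  rewrite big_cons -scalerA -ih//.
  rewrite -(multilinear_scale1 mf (fun j => if j \in l then c j *: h j else h j) i).
  rewrite (negbTE il); congr (mform_fun f _).
  apply/funext => j; have [<-|ij] := eqVneq i j.
    by rewrite dfwithin inE eqxx.
  by rewrite dfwithout// inE eq_sym (negbTE ij).
have := E (index_enum 'I_r) (index_enum_uniq _) => <-.
by congr (mform_fun f _); apply/funext => i; rewrite mem_index_enum.
Qed.

Lemma mform_le f h : real_norm (f h) <= mnorm f * \prod_i real_norm (h i).
Proof.
pose c i : K := of_real k (real_norm (h i)).
have -> : f h = (\prod_i c i) *: f (fun i => (c i)^-1 *: h i).
  rewrite -mform_scale; congr (mform_fun f _); apply/funext => i.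
  rewrite scalerA; have [h0|h0] := eqVneq (h i) 0; first by rewrite h0 scaler0.
  by rewrite divff ?scale1r// /c of_real_norm_real normr_eq0.
have cE : \prod_i c i = of_real k (\prod_i real_norm (h i)).
  by rewrite (big_morph _ (@of_realM R k) (@of_real1 R k)).
rewrite cE real_norm_of_realZ ger0_norm ?prodr_ge0//; last first.
  by move=> i _; exact: real_norm_ge0.
rewrite mulrC ler_wpM2r ?prodr_ge0//; first by move=> i _; exact: real_norm_ge0.
apply: mform_le_mnorm => i; rewrite normrZ /c of_real_norm_real normfV normr_id.
have [->|h0] := eqVneq (h i) 0; first by rewrite normr0 mulr0.
by rewrite mulVf// normr_eq0.
Qed.

Lemma mform_neq0 f : f != 0 -> exists h, f h != 0.
Proof.
move=> f0; apply/not_existsP => nf; move/eqP: f0; apply.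
apply/val_inj/funext => h /=; have := nf h; move/negP/negPn/eqP.
by [].
Qed.

End multilinear_form_bounds.

Section gaussian_multilinear.
Variables (R : realType) (k : scalars).
Local Notation K := (scalar_field R k).
Variables (H : normedModType K) (Z : completeNormedModType R) (ip : Z -> Z -> R).
Variables (r : nat) (psi : Z -> H) (gamma : probability (borel Z) R).
Variables (Cov : {linear Z -> Z}) (Cpsi : R).
Hypothesis ipP : @inner_product R RealScalars Z ip.
Hypothesis sepZ : separable_space Z.
Hypothesis psil : forall a x y, psi (a *: x + y) = of_real k a *: psi x + psi y.
Hypothesis Cpsi0 : 0 < Cpsi.
Hypothesis psi_le : forall x, real_norm (psi x) <= Cpsi * `|x|.
Hypothesis psi_dense : closure (lin_span (range psi)) = setT.
Hypothesis gammaG : gaussian_measure gamma.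
Hypothesis CovP : covariance_operator ip gamma Cov.
Hypothesis Cov_inj : forall u, Cov u = 0 -> u = 0.

Lemma covE u v : covariance gamma (ip u) (ip v) = (ip (Cov u) v)%:E.
Proof. by case: CovP => _; apply. Qed.

Lemma cov_sym u v : ip (Cov u) v = ip (Cov v) u.
Proof. by apply: EFin_inj; rewrite -!covE covarianceC. Qed.

Lemma cov_ge0 u : 0 <= ip (Cov u) u.
Proof. by rewrite -lee_fin -covE; exact: variance_ge0. Qed.

Lemma cov_cauchy u w : ip (Cov u) w ^+ 2 <= ip (Cov u) u * ip (Cov w) w.
Proof.
have q t : 0 <= ip (Cov u) u + 2 * t * ip (Cov u) w + t ^+ 2 * ip (Cov w) w.
  have := cov_ge0 (t *: w + u).
  rewrite linearP (ip_linear ipP) !(ip_linearr ipP) (cov_sym w u) => h.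
  by apply: le_trans h _; rewrite le_eqVlt; apply/orP; left; apply/eqP; ring.
have [w0|w0] := eqVneq (ip (Cov w) w) 0.
  rewrite w0 mulr0; rewrite le_eqVlt; apply/orP; left; rewrite sqrf_eq0.
  apply/negPn/negP => c0.
  (* With the quadratic coefficient zero, q is affine in t; this t would give it the value -1. *)
  have := q (- (ip (Cov u) u + 1) / (2 * ip (Cov u) w)); rewrite w0 mulr0 addr0.
  have -> : 2 * (- (ip (Cov u) u + 1) / (2 * ip (Cov u) w)) * ip (Cov u) w =
    - (ip (Cov u) u + 1) by field.
  by lra.
have wpos : 0 < ip (Cov w) w by rewrite lt_neqAle eq_sym w0 cov_ge0.
have := q (- ip (Cov u) w / ip (Cov w) w).
rewrite (_ : _ + _ + _ = ip (Cov u) u - ip (Cov u) w ^+ 2 / ip (Cov w) w); last by field.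
by rewrite subr_ge0 ler_pdivrMr.
Qed.

Lemma bounded_functional_continuous (l : Z -> R^o) (B : R) :
  (forall a x y, l (a *: x + y) = a * l x + l y) ->
  (forall x, `|l x| <= B * `|x|) -> continuous l.
Proof.
move=> ll lB x; apply/cvgrPdist_lt => e e0.
have B0 : 0 < `|B| + 1 by rewrite ltr_wpDl.
apply/nbhs_ballP; exists (e / (`|B| + 1)); first by rewrite /= divr_gt0.
move=> y; rewrite -ball_normE /ball_/= => xy.
have -> : l x - l y = l (x - y).
  by have := ll (-1) y x; rewrite scaleN1r mulN1r addrC [in RHS]addrC => ->.
apply: le_lt_trans (lB _) _; apply: (@le_lt_trans _ _ ((`|B| + 1) * `|x - y|)).
  by rewrite ler_wpM2r// (le_trans (ler_norm B))// lerDl.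
by rewrite mulrC -ltr_pdivlMr.
Qed.

(* The variance of [l] is at least [l (Cov w) ^ 2 / <Cov w, w>]. *)
Lemma functional_small_ball (l : Z -> R) (B kp eta : R) (w : Z) :
  (forall a x y, l (a *: x + y) = a * l x + l y) ->
  (forall x, `|l x| <= B * `|x|) -> 0 < kp -> kp <= `|l (Cov w)| -> 0 <= eta ->
  (gamma [set x | (`|l x| <= eta)%R] <=
    (2 * eta * (Num.sqrt 8 * Num.sqrt (ip (Cov w) w) / kp))%:E)%E.
Proof.
move=> ll lB kp0 lw eta0.
have [u lu] := riesz ipP ll lB.
have cl := @bounded_functional_continuous l B ll lB.
pose L : {linear Z -> R^o} := HB.pack (l : Z -> R^o)
  (GRing.isLinear.Build R Z R^o *:%R (l : Z -> R^o) ll).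
have gl : gaussian_law (fun A => gamma (l @^-1` A)) by exact: (gammaG (f := L) cl).
have ml : measurable_fun [set: borel Z] l.
  apply: measurable_fun_itv_preimage => // a b; rewrite setTI.
  apply: borel_open_measurable; apply: open_comp; first by move=> x _; exact: cl.
  exact: interval_open.
have lE : l = ip u by apply/funext => x; exact: lu.
have uw : ip (Cov u) w = l (Cov w) by rewrite lu cov_sym (ipC ipP).
have kk : kp ^+ 2 <= ip (Cov u) u * ip (Cov w) w.
  apply: le_trans (cov_cauchy u w); rewrite uw -[leRHS]ger0_norm ?sqr_ge0// normrX.
  by rewrite lerXn2r ?nnegrE ?(ltW kp0).
have k20 : 0 < kp ^+ 2 by rewrite exprn_gt0.
have uu : 0 < ip (Cov u) u.
  rewrite lt_neqAle cov_ge0 andbT eq_sym; apply/negP => /eqP E.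
  by move: kk; rewrite E mul0r leNgt k20.
have cv : covariance gamma l l = (ip (Cov u) u)%:E by rewrite lE covE.
have := gaussian_small_ball (T := borel Z) ml gl 0 cv uu eta0.
rewrite (_ : l @^-1` _ = [set x | `|l x| <= eta]); last first.
  by apply/seteqP; split => x; rewrite /= in_itv/= sub0r add0r -ler_norml.
move=> /le_trans; apply; rewrite lee_fin; apply: ler_wpM2l; first by rewrite mulr_ge0.
rewrite -mulrA; apply: ler_wpM2l; first exact: sqrtr_ge0.
have su : 0 < Num.sqrt (ip (Cov u) u) by rewrite sqrtr_gt0.
rewrite -[leLHS]mul1r ler_pdivrMr// mulrAC ler_pdivlMr// mul1r.
rewrite mulrC -sqrtrM ?cov_ge0// -[leLHS]ger0_norm ?(ltW kp0)// -sqrtr_sqr.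
exact: ler_wsqrtr.
Qed.

Definition eval_part b (f : mform H r) (z : 'I_r -> Z) : R := part b (f (psi \o z)).

Lemma comp_dfwith (z : 'I_r -> Z) (i : 'I_r) (x : Z) :
  psi \o dfwith z i x = dfwith (psi \o z) i (psi x) :> ('I_r -> H).
Proof.
apply/funext => j /=; have [<-|ij] := eqVneq i j; first by rewrite !dfwithin.
by rewrite !dfwithout.
Qed.

Lemma eval_part_linear b f (z : 'I_r -> Z) (i : 'I_r) (a : R) (x y : Z) :
  eval_part b f (dfwith z i (a *: x + y)) =
  a * eval_part b f (dfwith z i x) + eval_part b f (dfwith z i y).
Proof.
rewrite /eval_part !comp_dfwith psil (mform_multilinear f).
exact: part_linear.
Qed.

Lemma eval_partB b f g z : eval_part b (f - g) z = eval_part b f z - eval_part b g z.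
Proof.
rewrite /eval_part -[f - g]addrC -scaleN1r.
have -> : (-1 : K) = of_real k (-1).
  by apply/eqP; rewrite eq_sym -addr_eq0 -(@of_real1 R k) -of_realD addNr of_real0.
by rewrite [LHS](part_linear b (-1) (g (psi \o z)) (f (psi \o z))) mulN1r addrC.
Qed.

Lemma eval_part_le b f z : `|eval_part b f z| <= mnorm f * \prod_i (Cpsi * `|z i|).
Proof.
apply: le_trans (part_le b (f (psi \o z) : K^o)) _.
apply: le_trans (mform_le f _) _; apply: ler_wpM2l; first exact: mnorm_ge0.
by apply: ler_prod => i _; rewrite real_norm_ge0 psi_le.
Qed.

(** A path from z to v changing one slot at a time, so that each step is governed by a linear
    functional. *)
Definition mixed (v z : 'I_r -> Z) (n : nat) : 'I_r -> Z :=
  fun j => if (j < n)%N then v j else z j.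

Lemma mixedE v z (i : 'I_r) : mixed v z i = dfwith (mixed v z i) i (z i).
Proof. by rewrite -[in RHS](_ : mixed v z i i = z i) ?dfwith_id// /mixed ltnn. Qed.

Lemma mixedS v z (i : 'I_r) : mixed v z i.+1 = dfwith (mixed v z i) i (v i).
Proof.
apply/funext => j; have [<-|ij] := eqVneq i j; first by rewrite dfwithin /mixed ltnSn.
rewrite dfwithout// /mixed ltnS leq_eqVlt; suff /negbTE -> : (j != i :> nat) by [].
by apply: contra_neqN ij => /eqP/val_inj.
Qed.

Lemma eval_part_continuous b f (z : 'I_r -> Z) (e : R) : 0 < e ->
  exists2 d : R, 0 < d & forall z', (forall i, `|z' i - z i| < d) ->
    `|eval_part b f z' - eval_part b f z| < e.
Proof.
move=> e0.
pose D : R := 1 + \sum_i `|z i|.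
have D1 : 1 <= D by rewrite lerDl sumr_ge0.
have zD i : `|z i| + 1 <= D + 1.
  by rewrite lerD2r /D (bigD1 i)//= addrCA lerDl addr_ge0// sumr_ge0.
(* Adding 1 gives E >= 1, so the product over the slots other than i may be bounded by E^r. *)
pose E := Cpsi * (D + 1) + 1.
have E0 : 0 < Cpsi * (D + 1) by rewrite mulr_gt0// addr_gt0// (lt_le_trans _ D1).
have E1 : 1 <= E by rewrite lerDr ltW.
have Ep : 0 < E by exact: lt_le_trans E1.
pose M := mnorm f * (Cpsi * E ^+ r) * r%:R + 1.
have M0 : 0 < M.
  by rewrite ltr_wpDl// mulr_ge0// mulr_ge0 ?mnorm_ge0// mulr_ge0 ?exprn_ge0 ?ltW.
exists (Num.min 1 (e / M)); first by rewrite lt_min ltr01 divr_gt0.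
move=> z' zz'; set d := Num.min _ _ in zz'.
have dM : d * M <= e by rewrite -ler_pdivlMr// /d ge_min lexx orbT.
have d0 : 0 < d by rewrite /d lt_min ltr01 divr_gt0.
have z'D i : `|z' i| <= D + 1.
  rewrite -[z' i](subrK (z i)) (le_trans (ler_normD _ _))// addrC.
  apply: le_trans (zD i); rewrite lerD2l; apply: le_trans (ltW (zz' i)) _.
  by rewrite /d ge_min lexx.
have zD' i : `|z i| <= D + 1 by apply: le_trans (zD i); rewrite lerDl.
have step (i : 'I_r) : `|eval_part b f (mixed z' z i.+1) - eval_part b f (mixed z' z i)|
    <= mnorm f * (Cpsi * E ^+ r) * d.
  rewrite mixedS [in X in _ - X]mixedE.
  have -> : eval_part b f (dfwith (mixed z' z i) i (z' i)) -
      eval_part b f (dfwith (mixed z' z i) i (z i)) =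
      eval_part b f (dfwith (mixed z' z i) i (z' i - z i)).
    have := eval_part_linear b f (mixed z' z i) i (-1) (z i) (z' i).
    by rewrite scaleN1r mulN1r addrC [in RHS]addrC => ->.
  apply: le_trans (eval_part_le _ _ _) _; rewrite -mulrA.
  apply: ler_wpM2l; first exact: mnorm_ge0.
  rewrite (bigD1 i)//= dfwithin [leRHS]mulrAC.
  apply: ler_pM.
  - by rewrite mulr_ge0// ltW.
  - by apply: prodr_ge0 => j _; rewrite mulr_ge0// ltW.
  - by rewrite ler_wpM2l ?ltW.
  apply: (@le_trans _ _ (\prod_(j | j != i) E)).
    apply: ler_prod => j ji; rewrite mulr_ge0 ?(ltW Cpsi0)//=.
    rewrite dfwithout 1?eq_sym// /mixed; apply: (@le_trans _ _ (Cpsi * (D + 1))).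
      by rewrite ler_wpM2l ?(ltW Cpsi0)//; case: ifP.
    by rewrite lerDl.
  rewrite prodr_const; apply: ler_weXn2l => //.
  by rewrite -[X in (_ <= X)%N](card_ord r) max_card.
have tele n : (n <= r)%N ->
    `|eval_part b f (mixed z' z n) - eval_part b f (mixed z' z 0)| <=
    (mnorm f * (Cpsi * E ^+ r) * d) * n%:R.
  elim: n => [_|n ih nr]; first by rewrite subrr normr0 mulr0.
  rewrite -(subrKA (eval_part b f (mixed z' z n))) (le_trans (ler_normD _ _))//.
  rewrite -natr1 mulrDr mulr1 addrC lerD ?ih ?(ltnW nr)//.
  exact: (step (Ordinal nr)).
have := tele r (leqnn r).
have -> : mixed z' z r = z' by apply/funext => j; rewrite /mixed ltn_ord.
have -> : mixed z' z 0 = z by apply/funext => j.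
move=> /le_lt_trans; apply.
apply: lt_le_trans dM; rewrite mulrAC [d * M]mulrC ltr_pM2r// /M ltrDl ltr01 //.
Qed.

Lemma eval_part_measurable b f (v : 'I_r -> Z) n :
  measurable_fun [set: r.-tuple (borel Z)]
    (fun z => eval_part b f (mixed v (fun j => tnth z j) n)).
Proof.
have [B [oB HB]] := separable_base sepZ.
apply: measurable_fun_itv_preimage => // x y; rewrite setTI.
apply: (@tuple_open_measurable _ (borel Z) B) => [i|z].
  exact: borel_open_measurable.
rewrite /= in_itv/= => /andP[xz zy].
set c := eval_part _ _ _ in xz zy.
have e0 : 0 < Num.min (c - x) (y - c) by rewrite lt_min !subr_gt0 xz zy.
have [d d0 Hd] := eval_part_continuous b f (mixed v (fun j => tnth z j) n) e0.
have /choice[g Hg] : forall i : 'I_r, exists l, B l (tnth z i) /\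
    forall z', B l z' -> `|z' - tnth z i| < d by move=> i; exact: HB.
exists [ffun i => g i]; split=> [i|z' Hz']; first by rewrite ffunE; case: (Hg i).
rewrite in_itv/=.
have := Hd (mixed v (fun j => tnth z' j) n); rewrite -/c => H1.
have {}H1 : `|eval_part b f (mixed v (fun j => tnth z' j) n) - c| < Num.min (c - x) (y - c).
  apply: H1 => i; rewrite /mixed; case: ifP => _; first by rewrite subrr normr0.
  by have [_] := Hg i; apply; have := Hz' i; rewrite ffunE.
move: H1; rewrite lt_min !ltr_norml => /andP[/andP[? ?] /andP[? ?]].
by apply/andP; split; lra.
Qed.

(** The density hypothesis concerns the K-span, so g must be K-linear; real components may be taken
    only afterwards. *)
Lemma vanish_on_range (g : H -> K) (B : R) :
  (forall a x y, g (a *: x + y) = a * g x + g y) ->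
  (forall x, real_part `|g x| <= B * real_norm x) ->
  (forall z, g (psi z) = 0) -> forall x, g x = 0.
Proof.
move=> gl gB gpsi.
have g0 : g 0 = 0.
  by have := gl 1 0 0; rewrite scale1r addr0 mul1r => /eqP; rewrite addrC -subr_eq subrr eq_sym => /eqP.
have gD x y : g (x + y) = g x + g y by rewrite -[x]scale1r gl mul1r scale1r.
have gZ a x : g (a *: x) = a * g x by rewrite -[a *: x]addr0 gl g0 addr0.
have gspan x : lin_span (range psi) x -> g x = 0.
  move=> [n [c [v [vr ->]]]]; rewrite (big_morph g gD g0) big1// => i _.
  by have [z _ <-] := vr i; rewrite gZ gpsi mulr0.
move=> x; have clx : closure (lin_span (range psi)) x by rewrite psi_dense.
apply: (@real_norm_eq0 _ _ K^o (g x)); apply/eqP; rewrite eq_le real_norm_ge0 andbT.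
apply/ler_addgt0Pr => e e0; rewrite add0r.
have B0 : 0 < `|B| + 1 by rewrite ltr_wpDl.
have d0 : 0 < e / (`|B| + 1) by rewrite divr_gt0.
have d0' : 0 < of_real k (e / (`|B| + 1)) :> K.
  rewrite lt_neqAle -of_real0 of_real_le ?ltW// andbT of_real0 eq_sym.
  by apply/negP => /eqP/of_real_eq0/eqP; rewrite gt_eqF.
have [y [/gspan gy]] := clx _ (nbhsx_ballx x _ d0').
rewrite -ball_normE /ball_/= => xy.
have gxy : g x = g (x - y).
  by rewrite gD -scaleN1r gZ gy mulr0 addr0.
rewrite gxy; apply: le_trans (gB _) _.
have nxy : real_norm (x - y) <= e / (`|B| + 1).
  by rewrite -[leRHS](@of_realK R k); apply: real_part_le; exact: ltW.
apply: (@le_trans _ _ ((`|B| + 1) * real_norm (x - y))).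
  by rewrite ler_wpM2r ?real_norm_ge0// (le_trans (ler_norm B))// lerDl.
by rewrite mulrC -ler_pdivlMr.
Qed.

Lemma form_slice_le (f : mform H r) h (i : 'I_r) : exists2 B : R, 0 <= B &
  forall x, real_part `|f (dfwith h i x)| <= B * real_norm x.
Proof.
exists (mnorm f * \prod_(j | j != i) real_norm (h j)).
  by rewrite mulr_ge0 ?mnorm_ge0// prodr_ge0// => j _; exact: real_norm_ge0.
move=> x; apply: le_trans (mform_le f _) _.
rewrite (bigD1 i)//= dfwithin -mulrA [_ * real_norm x]mulrC.
rewrite (eq_bigr (fun j => real_norm (h j)))// => j ji.
by rewrite dfwithout// eq_sym.
Qed.

Variable dns : nat -> Z.
Hypothesis dns_dense : forall z (e : R), 0 < e -> exists n, `|dns n - z| < e.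

(** Represent l by u. Injectivity gives Cov u <> 0, and l (Cov d) is the inner product of Cov u with
    d, which is nonzero once d is closer to Cov u than the norm of Cov u. Witnesses from a countable
    set keep the strata countable. *)
Lemma functional_witness (l : Z -> R) (B : R) :
  (forall a x y, l (a *: x + y) = a * l x + l y) ->
  (forall x, `|l x| <= B * `|x|) -> (exists z, l z != 0) ->
  exists n, l (Cov (dns n)) != 0.
Proof.
move=> ll lB [z lz]; have [u lu] := riesz ipP ll lB.
have u0 : Cov u != 0.
  apply/eqP => /Cov_inj u0; move: lz; rewrite lu u0 (ip0 ipP) eqxx //.
have nu : 0 < `|Cov u| by rewrite normr_gt0.
have [n Hn] := dns_dense (Cov u) nu.
exists n; rewrite lu (ipC ipP) cov_sym.
apply/negP => /eqP E.
have : ip (Cov u) (Cov u) <= `|Cov u| * `|dns n - Cov u|.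
  apply: le_trans (ip_bound ipP _ _); apply: le_trans (ler_norm _) _.
  have := ip_linearr ipP (-1) (Cov u) (dns n) (Cov u).
  rewrite E addr0 mulN1r scaleN1r [- Cov u + _]addrC => ->.
  by rewrite normrN.
rewrite (ip_norm ipP) expr2 leNgt ltr_pM2l// => /negP; apply.
exact: Hn.
Qed.

(** Slots are replaced one at a time: density moves the vector into the range of psi, then a nonzero
    real component supplies a functional to which [functional_witness] applies. *)
Lemma form_witness (f : mform H r) : f != 0 ->
  exists w : {ffun 'I_r -> nat}, f (psi \o (fun i => Cov (dns (w i)))) != 0.
Proof.
move=> /mform_neq0[h0 fh0].
suff /(_ r (leqnn r)) [h [fh Hh]] : forall n, (n <= r)%N -> exists h, f h != 0 /\
    forall i : 'I_r, (i < n)%N -> exists l, h i = psi (Cov (dns l)).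
  have /choice[w Hw] : forall i, exists l, h i = psi (Cov (dns l)).
    by move=> i; apply: Hh; rewrite ltn_ord.
  exists [ffun i => w i]; apply: contra_neq fh => <-.
  by congr (mform_fun f _); apply/funext => i; rewrite /= ffunE Hw.
elim=> [_|n ih nr]; first by exists h0.
have [h [fh Hh]] := ih (ltnW nr); pose i := Ordinal nr.
have [B B0 HB] := form_slice_le f h i.
have fl a x y : f (dfwith h i (a *: x + y)) = a * f (dfwith h i x) + f (dfwith h i y).
  exact: (mform_multilinear f i h a x y).
have [z fz] : exists z, f (dfwith h i (psi z)) != 0.
  apply/not_existsP => nz; move/negP: fh; apply; apply/eqP.
  rewrite -[h](dfwith_id h i).
  apply: (vanish_on_range fl HB) => z; have := nz z; move/negP/negPn/eqP.
  by [].
have [b bz] : exists b, part b (f (dfwith h i (psi z))) != 0.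
  apply/not_existsP => nb; move/negP: fz; apply; apply/eqP.
  by apply: part_eq0 => b; have := nb b; move/negP/negPn/eqP.
pose l (t : Z) : R := part b (f (dfwith h i (psi t))).
have ll a x y : l (a *: x + y) = a * l x + l y.
  by rewrite /l psil fl; exact: part_linear.
have lB x : `|l x| <= (B * Cpsi) * `|x|.
  apply: le_trans (part_le b (f (dfwith h i (psi x)) : K^o)) _.
  apply: le_trans (HB _) _; rewrite -mulrA; apply: (ler_wpM2l B0).
  exact: psi_le.
have [q lq] := functional_witness ll lB (ex_intro _ z bz).
exists (dfwith h i (psi (Cov (dns q)))); split.
  by apply: contra_neq lq; rewrite /l => ->; exact: part0.
move=> j; rewrite ltnS leq_eqVlt => /orP[/eqP jn|jn].
  have -> : j = i by exact/val_inj.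
  by exists q; rewrite dfwithin.
rewrite dfwithout; first exact: Hh.
by apply/eqP => ij; move: jn; rewrite -ij ltnn.
Qed.

Lemma prob_tuple_slice (i : 'I_r) (S : set (r.-tuple (borel Z))) (c : R) :
  measurable S -> 0 <= c ->
  (forall z, (gamma [set t | S (tupd z i t)] <= c%:E)%E) ->
  (tuple_measure gamma r S <= c%:E)%E.
Proof.
case: (r) i S => [[]//|n] i S mS c0 HS.
rewrite -[c]mulr1 -(expr1n _ n).
apply: (@tuple_measure_slice _ (borel Z) R gamma n i setT) => //.
have E : (gamma setT <= 1%:E)%E by rewrite probability_setT.
exact: E.
Qed.

Variable N : nat.
Variable Phi : 'rV[R]_N -> mform H r.

(** Slot i is where the path of [mixed] first leaves the zero set; n0 bounds the sample from above
    and the new value from below. *)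
Definition gauss_stratum (w : {ffun 'I_r -> nat}) (i : 'I_r) b (L n0 : nat) (p : 'rV[R]_N) :
    set (r.-tuple (borel Z)) :=
  let v j := Cov (dns (w j)) in
  [set z | [/\ forall p', `|p' - p| <= L.+1%:R^-1 ->
      real_norm (Phi p' - Phi p) <= L.+1%:R * `|p' - p|,
    forall j, `|tnth z j : Z| <= n0.+1%:R,
    eval_part b (Phi p) (mixed v (tnth z) i) = 0 &
    n0.+1%:R^-1 <= `|eval_part b (Phi p) (mixed v (tnth z) i.+1)|]].

Lemma tuple_measure_le1 (S : set (r.-tuple (borel Z))) : (0 < r)%N -> measurable S ->
  (tuple_measure gamma r S <= 1)%E.
Proof.
move=> r0 mS; apply: (@prob_tuple_slice (Ordinal r0)) => // z.
have mS' : measurable [set t | S (tupd z (Ordinal r0) t)].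
  by rewrite -[X in measurable X]setTI; exact: (tupd_measurable z (Ordinal r0)).
exact: probability_le1.
Qed.

Lemma eval_part_bound b (f g : mform H r) (z : 'I_r -> Z) (D : R) :
  (forall j, `|z j| <= D) ->
  `|eval_part b f z - eval_part b g z| <= real_norm (f - g) * (Cpsi * D) ^+ r.
Proof.
move=> zD; rewrite -eval_partB mform_norm_real.
apply: le_trans (eval_part_le b (f - g) z) _; apply: ler_wpM2l; first exact: mnorm_ge0.
rewrite -[r in leRHS]card_ord -prodr_const; apply: ler_prod => j _.
by rewrite mulr_ge0 ?(ltW Cpsi0)//= ler_wpM2l ?(ltW Cpsi0).
Qed.

(** Calmness transfers both conditions from p to a fixed p1, with error eta. With the other slots
    frozen, what remains is a functional of slot i that is at most eta at the sample and at least kp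
    at v i, and its Gaussian small-ball probability is O(eta). *)
Lemma thin_gauss_stratum (w : {ffun 'I_r -> nat}) (i : 'I_r) b (L n0 : nat) :
  thin (tuple_measure gamma r) (gauss_stratum w i b L n0).
Proof.
pose v j := Cov (dns (w j)).
have r0 : (0 < r)%N by apply: leq_ltn_trans (ltn_ord i).
have L0 : 0 < L.+1%:R :> R by rewrite ltr0n.
have n00 : 0 < n0.+1%:R :> R by rewrite ltr0n.
pose Dz : R := n0.+1%:R + \sum_j `|v j|.
have Dz0 : 0 < Dz by rewrite ltr_wpDr// sumr_ge0.
pose Bz := (Cpsi * Dz) ^+ r.
have Bz0 : 0 < Bz by rewrite exprn_gt0// mulr_gt0.
(* Half of the lower bound survives the change of parameter, provided eta <= kp. *)
pose kp : R := n0.+1%:R^-1 / 2.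
have kp0 : 0 < kp by rewrite divr_gt0// invr_gt0.
pose Gk := Num.sqrt 8 * Num.sqrt (ip (Cov (dns (w i))) (dns (w i))) / kp.
have Gk0 : 0 <= Gk by rewrite divr_ge0 ?(ltW kp0)// mulr_ge0 ?sqrtr_ge0.
pose C2 := 4 * L.+1%:R * Bz * Gk.
have C20 : 0 <= C2 := mulr_ge0 (mulr_ge0 (mulr_ge0 (ler0n _ 4) (ltW L0)) (ltW Bz0)) Gk0.
(* Once m + 1 reaches th, the first summand puts 2/(m+1) within the calmness radius and the second
   ensures eta <= kp; smaller m use the whole space. *)
pose th := 2 * L.+1%:R + 2 * L.+1%:R * Bz / kp.
have th1 : 0 <= 2 * L.+1%:R :> R := mulr_ge0 (ler0n _ 2) (ltW L0).
have th2 : 0 <= 2 * L.+1%:R * Bz / kp := divr_ge0 (mulr_ge0 th1 (ltW Bz0)) (ltW kp0).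
have th0 : 0 <= th := addr_ge0 th1 th2.
exists (th + C2) => m p0.
have m0 : 0 < m.+1%:R :> R by rewrite ltr0n.
have [mth|thm] := ltP (m.+1%:R : R) th.
  exists setT; split => //; apply: (le_trans (tuple_measure_le1 r0 measurableT)).
  by rewrite lee_fin ler_pdivlMr// mul1r (le_trans (ltW mth))// lerDl.
have [[p1 [z1 [p01 [calm _ _ _]]]]|nS] := pselect (exists p1 z1,
    `|p1 - p0| <= m.+1%:R^-1 /\ gauss_stratum w i b L n0 p1 z1); last first.
  exists set0; split => //.
    have [mu ->] := tuple_measureE gamma r.
    by rewrite measure0 lee_fin; apply: divr_ge0 (addr_ge0 th0 C20) (ltW m0).
  by move=> p pp0 z Sz; apply: nS; exists p, z.
pose eta : R := L.+1%:R * (2 / m.+1%:R) * Bz.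
have eta0 : 0 <= eta.
  by apply: mulr_ge0 (ltW Bz0); apply: mulr_ge0 (ltW L0) _; rewrite divr_ge0// ltW.
have etak : eta <= kp.
  have : 2 * L.+1%:R * Bz / kp <= m.+1%:R.
    by apply: le_trans thm; rewrite lerDr.
  rewrite ler_pdivrMr// => h.
  rewrite /eta (_ : _ * Bz = 2 * L.+1%:R * Bz / m.+1%:R); last by field; rewrite gt_eqF.
  by rewrite ler_pdivrMr// [kp * _]mulrC.
have mL : 2 / m.+1%:R <= L.+1%:R^-1 :> R.
  rewrite ler_pdivrMr// mulrC ler_pdivlMr//.
  by apply: le_trans thm; rewrite lerDl.
pose ev n (z : r.-tuple (borel Z)) := eval_part b (Phi p1) (mixed v (tnth z) n).
pose T : set (r.-tuple (borel Z)) :=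
  (fun z => `|ev i z|) @^-1` `]-oo, eta] `&` (fun z => `|ev i.+1 z|) @^-1` `[kp, +oo[.
have mev n : measurable_fun setT (fun z => `|ev n z|).
  apply: measurableT_comp => //; exact: eval_part_measurable.
have mT : measurable T.
  apply: measurableI; rewrite -[X in measurable X]setTI; apply: mev => //;
    exact: measurable_itv.
have evi z t : ev i (tupd z i t) = eval_part b (Phi p1) (dfwith (mixed v (tnth z) i) i t).
  rewrite /ev; congr eval_part; apply/funext => j.
  have [<-|ij] := eqVneq i j; first by rewrite dfwithin /mixed ltnn tnth_mktuple eqxx.
  by rewrite dfwithout// /mixed tnth_mktuple eq_sym (negbTE ij).
(* Here slot i already carries v i, so the value does not depend on t; if it is below kp, the slice
   of T is empty. *)
have evS z t : ev i.+1 (tupd z i t) = eval_part b (Phi p1) (dfwith (mixed v (tnth z) i) i (v i)).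
  rewrite -mixedS /ev; congr eval_part; apply/funext => j; rewrite /mixed ltnS.
  case: (leqP j i) => // ij; rewrite tnth_mktuple; case: eqP => // ji.
  by move: ij; rewrite ji ltnn.
exists T; split => //.
- apply: (@le_trans _ _ (2 * eta * Gk)%:E).
    apply: (@prob_tuple_slice i) => // [|z].
      by rewrite mulr_ge0// mulr_ge0.
    pose l (t : Z) : R := eval_part b (Phi p1) (dfwith (mixed v (tnth z) i) i t).
    have [small|big] := ltP `|l (v i)| kp.
      rewrite (_ : [set t | _] = set0).
        by rewrite measure0 lee_fin mulr_ge0// mulr_ge0.
      rewrite -subset0 => t /= [_]; rewrite /= evS in_itv/= andbT leNgt.
      by rewrite -/(l (v i)) small.
    have ll a x y : l (a *: x + y) = a * l x + l y by exact: eval_part_linear.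
    pose Bl := mnorm (Phi p1) * (Cpsi * \prod_(j | j != i) (Cpsi * `|mixed v (tnth z) i j|)).
    have lB t : `|l t| <= Bl * `|t|.
      apply: le_trans (eval_part_le _ _ _) _; rewrite /Bl -mulrA.
      apply: ler_wpM2l; first exact: mnorm_ge0.
      rewrite (bigD1 i)//= dfwithin mulrAC le_eqVlt; apply/orP; left; apply/eqP.
      congr (_ * _ * _); apply: eq_bigr => j ji; by rewrite dfwithout// eq_sym.
    apply: le_trans (functional_small_ball ll lB kp0 big eta0).
    have ml : measurable_fun [set: borel Z] l.
      apply: measurable_fun_itv_preimage => // x y; rewrite setTI.
      apply: borel_open_measurable; apply: open_comp; last exact: interval_open.
      move=> u _; exact: (bounded_functional_continuous ll lB).
    have mabs : measurable [set x : borel Z | `|l x| <= eta].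
      have mnl : measurable_fun [set: borel Z] (fun x => `|l x|).
        exact: measurableT_comp.
      rewrite (_ : [set x | _] = (fun x => `|l x|) @^-1` `]-oo, eta]).
        by rewrite -[X in measurable X]setTI; apply: mnl => //; exact: measurable_itv.
      by apply/seteqP; split => x; rewrite /= in_itv.
    apply: le_measure; rewrite ?inE//.
      by rewrite -[X in measurable X]setTI; exact: (tupd_measurable z i).
    by move=> t [/=]; rewrite evi in_itv.
  rewrite lee_fin ler_pdivlMr// /eta.
  rewrite (_ : _ * m.+1%:R = C2); last by rewrite /C2; field; rewrite gt_eqF.
  by rewrite lerDr.
- move=> p pp0 z [calmp zn hz1 hz2].
  have pp1 : `|p - p1| <= 2 / m.+1%:R.
    rewrite -[p - p1](subrKA p0) (le_trans (ler_normD _ _))//.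
    by rewrite mulr_natl mulr2n lerD// distrC.
  have dPhi : real_norm (Phi p - Phi p1) <= L.+1%:R * (2 / m.+1%:R).
    apply: le_trans (calm p (le_trans pp1 mL)) _.
    by rewrite ler_wpM2l// ltW.
  have close n : `|eval_part b (Phi p) (mixed v (tnth z) n) - ev n z| <= eta.
    have zD j : `|mixed v (tnth z) n j| <= Dz.
      rewrite /mixed /Dz; case: ifP => _.
        by rewrite (bigD1 j)//= addrCA lerDl addr_ge0 ?sumr_ge0// ltW.
      by apply: ler_wpDr; [rewrite sumr_ge0|exact: zn].
    apply: le_trans (eval_part_bound b _ _ zD) _.
    by rewrite ler_wpM2r// ltW.
  split; rewrite /= in_itv/= ?andbT.
    by have := close i; rewrite hz1 sub0r normrN.
  have := close i.+1; have := ler_normD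
    (eval_part b (Phi p) (mixed v (tnth z) i.+1) - ev i.+1 z) (ev i.+1 z).
  rewrite subrK => h1 h2.
  have := le_trans hz2 h1.
  have : n0.+1%:R^-1 = kp + kp by rewrite /kp; field; rewrite gt_eqF.
  move=> ->; move: h2 etak; rewrite /ev.
  by move: `|eval_part b (Phi p) _ - _| `|eval_part b (Phi p1) _| => x y; lra.
Qed.

(* Replace the coordinates of [z] one by one by those of a point at which the
   form does not vanish: at the first step where the value becomes nonzero, the
   form is a nonzero functional of the replaced coordinate. *)
Lemma gauss_stratum_cover p (z : r.-tuple (borel Z)) (rho L0 : R) :
  0 < rho -> (forall u, `|u| < rho -> real_norm (Phi (p + u) - Phi p) <= L0 * `|u|) ->
  Phi p != 0 -> Phi p (fun j => psi (tnth z j)) = 0 ->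
  exists w i b L n0, gauss_stratum w i b L n0 p z.
Proof.
move=> rho0 calm Phi0 hz.
have [w fw] := form_witness Phi0; exists w.
pose v j := Cov (dns (w j)).
pose val n := Phi p (psi \o mixed v (tnth z) n).
have [i [vi vi1]] : exists i : 'I_r, val i = 0 /\ val i.+1 != 0.
  have v0 : val 0 = 0.
    by rewrite -[RHS]hz; congr (mform_fun _ _); apply/funext => j.
  have vr : val r != 0.
    apply: contra_neq fw => <-; congr (mform_fun _ _); apply/funext => j.
    by rewrite /= /mixed ltn_ord.
  have ex : exists n, val n != 0 by exists r.
  case: (ex_minnP ex) => n vn nmin.
  have nr : (n <= r)%N by exact: nmin.
  case: n vn nmin nr => [|n] vn nmin nr; first by rewrite v0 eqxx in vn.
  exists (Ordinal nr); split=> //=; apply/eqP; apply: contraT => vn'.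
  by have := nmin n vn'; rewrite ltnn.
have [b bv] : exists b, part b (val i.+1) != 0.
  apply/not_existsP => nb; move/negP: vi1; apply; apply/eqP.
  by apply: part_eq0 => b; have := nb b; move/negP/negPn/eqP.
have [n1 Hn1] := invS_lt_eventually rho0.
have bv0 : 0 < `|part b (val i.+1)| by rewrite normr_gt0.
have [n2 Hn2] := invS_lt_eventually bv0.
pose L := maxn n1 (Num.truncn `|L0|).
pose n3 := (\max_j Num.truncn `|tnth z j : Z|)%N.
exists i, b, L, (maxn n2 n3); split.
- move=> p' pp'; have := calm (p' - p); rewrite subrKC => H1.
  apply: le_trans (H1 _) _.
    by apply: (le_lt_trans pp'); apply: Hn1; rewrite leq_maxl.
  rewrite ler_wpM2r// (le_trans (ler_norm _))//.
  have /andP[_ /ltW h] := Num.Theory.truncn_itv (normr_ge0 L0).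
  by apply: (le_trans h); rewrite ler_nat ltnS leq_maxr.
- move=> j; have /andP[_ /ltW h] := Num.Theory.truncn_itv (normr_ge0 (tnth z j : Z)).
  apply: (le_trans h); rewrite ler_nat ltnS.
  apply: leq_trans (leq_maxr _ _).
  exact: (leq_bigmax (F := fun j => Num.truncn `|tnth z j : Z|)).
- by rewrite /eval_part -/v -/(val i) vi part0.
- rewrite /eval_part -/v -/(val i.+1); apply: ltW; apply: Hn2; exact: leq_maxl.
Qed.

End gaussian_multilinear.

Theorem recovery_gaussian_multilinear (R : realType) (k : scalars)
    (X : normedModType R) (A V : set X) (d : nat) (e : 'I_d -> X) (s M : nat)
    (H : normedModType (scalar_field R k)) (Z : completeNormedModType R)
    (ipZ : Z -> Z -> R) (r : nat) (F : X -> mform H r) (psi : Z -> H)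
    (gamma : probability (borel Z) R) :
  V = lin_span (range e) -> (0 < s <= d)%N -> (s + s < M)%N ->
  @inner_product R RealScalars Z ipZ -> separable_space Z ->
  real_analytic A F -> set_inj (A `&` V) F -> bounded_real_linear psi ->
  closure (lin_span (range psi)) = setT ->
  gaussian_measure gamma -> nondegenerate_gaussian ipZ gamma ->
  almost_sure_recovery (A `&` sparse e s) (tuple_measure gamma r)
    (fun a z => F a (fun j => psi (tnth z j))) M.
Proof.
move=> VE sd sM ipP sepZ anF injF [psil [C0 HC0]] dpsi gG [Cov [CovP Cov_inj]].
pose C : R := `|C0| + 1.
have Cp : 0 < C by rewrite ltr_wpDl.
have psi_le x : real_norm (psi x) <= C * `|x|.
  apply: le_trans (HC0 x) _; rewrite ler_wpM2r// (le_trans (ler_norm _))//.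
  by rewrite lerDl.
have [B [_ HB]] := separable_base sepZ.
(* A dense sequence is obtained from one point in each nonempty member of the base. *)
have /choice[dns Hdns] : forall n, exists z, B n !=set0 -> B n z.
  move=> n; have [[z Bz]|nB] := pselect (B n !=set0); first by exists z.
  by exists 0.
have dns_dense z (ep : R) : 0 < ep -> exists n, `|dns n - z| < ep.
  move=> /(HB z)[n [Bz Hn]]; exists n; apply: Hn; apply: Hdns.
  by exists z.
apply: (recovery_of_thin sd sM VE) => sg sg'.
pose Phi (p : 'rV[R]_(s + s)) := F (lparam e sg p) - F (rparam e sg' p).
pose I : countType := ({ffun 'I_r -> nat} * 'I_r * bool * nat * nat)%type.
pose S (l : I) : 'rV[R]_(s + s) -> set (r.-tuple (borel Z)) :=
  let: (w, i, b, L, n0) := l in gauss_stratum psi Cov dns Phi w i b L n0.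
exists I, S; split.
  move=> [[[[w i] b] L] n0].
  exact: (thin_gauss_stratum ipP sepZ psil Cp psi_le gG CovP).
move=> p z [Al Vl] [Ar Vr] lr mz.
have [C1 C10 HC1] := param_bound e sg.
have [C2 C20 HC2] := param_bound e sg'.
have [T1 mT1 f1] := real_analytic_expands anF Al.
have [T2 mT2 f2] := real_analytic_expands anF Ar.
have ll := lparam_linear e sg; have rl := rparam_linear e sg'.
have e1 := expands_comp ll C10 (fun p => (HC1 p).1) f1.
have e2 := expands_comp rl C20 (fun p => (HC2 p).2) f2.
have mT := symm_multilinearB (symm_multilinear_comp ll mT1) (symm_multilinear_comp rl mT2).
have eT := expandsB e1 e2.
have [rho [L0 [rho0 _ calm]]] := expands_calm mT eT.
have calm' u : `|u| < rho -> real_norm (Phi (p + u) - Phi p) <= L0 * `|u|.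
  by move=> /calm; rewrite (expands_center mT eT).
have Phi0 : Phi p != 0.
  rewrite subr_eq0; apply/eqP => /injF E; apply: lr; apply: E; rewrite inE //.
have Phiz : Phi p (fun j => psi (tnth z j)) = 0.
  have -> : Phi p (fun j => psi (tnth z j)) =
      F (lparam e sg p) (fun j => psi (tnth z j)) - F (rparam e sg' p) (fun j => psi (tnth z j)).
    by [].
  by rewrite mz subrr.
have [w [i [b [L [n0 Sz]]]]] :=
  gauss_stratum_cover ipP psil psi_le dpsi CovP Cov_inj dns_dense rho0 calm' Phi0 Phiz.
by exists (w, i, b, L, n0).
Qed.

Theorem theorem2p5 (R : realType) (k : scalars) (X : completeNormedModType R)
    (A : set X) (V : set X) (d : nat) (e : 'I_d -> X) (s M : nat) :
  open A -> lin_basis V e -> (1 <= s <= d)%N ->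
  (2 * minn d (2 * s) + 1 <= M)%N ->
  (* (I) finite-dimensional analytic sampling *)
  (forall (q : nat) (Z : ptopologicalType) (atlas : set (chart R Z q))
     (vol : {measure set (borel Z) -> \bar R}) (mu : probability (borel Z) R)
     (m : X -> Z -> scalar_field R k),
     (1 <= q)%N ->
     analytic_manifold atlas -> connected [set: Z] ->
     smooth_positive_volume atlas vol -> mu `<< vol ->
     analytic_on_product atlas A m ->
     (forall a1 a2, (A `&` V) a1 -> (A `&` V) a2 -> a1 <> a2 ->
        ~ forall z, m a1 z - m a2 z = 0) ->
     almost_sure_recovery (A `&` sparse e s) mu m M)
  /\
  (* (II) Gaussian multilinear sampling *)
  (forall (H : completeNormedModType (scalar_field R k))
     (ipH : H -> H -> scalar_field R k)
     (Z : completeNormedModType R) (ipZ : Z -> Z -> R) (r : nat)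
     (F : X -> mform H r) (psi : Z -> H) (gamma : probability (borel Z) R),
     inner_product ipH -> separable_space H ->
     @inner_product R RealScalars Z ipZ -> separable_space Z ->
     ~ finite_dimensional Z ->
     (1 <= r)%N ->
     real_analytic A F -> set_inj (A `&` V) F ->
     bounded_real_linear psi ->
     closure (lin_span (range psi)) = setT ->
     gaussian_measure gamma -> nondegenerate_gaussian ipZ gamma ->
     almost_sure_recovery (A `&` sparse e s) (tuple_measure gamma r)
       (fun a z => F a (fun j => psi (tnth z j))) M).
Proof.
move=> oA [_ VE] sd dM; have /andP[s1 sled] := sd.
(* Since s <= min(d, 2s), the assumption on M exceeds 2s, the number of coordinates of a pair. *)
have sM : (s + s < M)%N.
  apply: leq_trans dM; rewrite addn1 ltnS addnn -mul2n leq_mul2l /=.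
  by rewrite leq_min sled leq_pmull.
split=> [q Z atlas vol mu m q1 manZ conn svol muvol anm inj|].
  exact: (recovery_finite_dimensional oA VE sd sM q1 manZ conn svol muvol anm inj).
move=> H ipH Z ipZ r F psi gamma _ _ ipP sepZ _ r1 anF injF bpsi dpsi gG ndG.
exact: (recovery_gaussian_multilinear VE sd sM ipP sepZ anF injF bpsi dpsi gG ndG).
Qed.
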